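(* Let $R$ be a commutative ring and $n\ge 1$ an integer, and suppose that $R$ is a $\mathbb{Q}$-algebra or $n=1$. The additive formal group of $\mathbb{W}_{\mathbb{Z}_{\ge 0}^n-0}(R)$ represents the functor $$G\mapsto \mathrm{Mor}_{\mathrm{fs}}(\hat{\mathbb{A}}^n,G)$$ from commutative formal groups over $R$ to groups; i.e. there is a natural identification (isomorphism of groups, natural in $G$) $$\mathrm{Mor}_{\mathrm{fg}}\big(\mathbb{W}_{\mathbb{Z}_{\ge 0}^n-0}(R),\,G\big)\;\cong\;\mathrm{Mor}_{\mathrm{fs}}(\hat{\mathbb{A}}^n,G)$$ for commutative formal groups $G$ over $R$, where on the left $\mathbb{W}_{\mathbb{Z}_{\ge 0}^n-0}(R)$ denotes the additive formal group.
   Context: Rings are commutative with unit and $\mathbb{N}=\mathbb{Z}_{>0}$. Witt vectors. For $\vec J=(j_1,\dots,j_n)\in \mathbb{Z}_{\ge 0}^n-0$ let $\gcd(\vec J)$ be the greatest common divisor of the nonzero $j_i$. Put $S=\mathbb{Z}_{\ge 0}^n-0$. For a ring $B$, $\mathbb{W}_S(B)$ is the ring with underlying set $B^S$ whose addition and multiplication are the unique ones, functorial in $B$, such that for every $B$ the ghost map $\mathbb{W}_S(B)\to B^S$, $(r_{\vec I})_{\vec I\in S}\mapsto (w_{\vec I})_{\vec I\in S}$, with $$w_{\vec I}=\sum_{k\vec J=\vec I,\ k\in\mathbb{N},\ \vec J\in S}\gcd(\vec J)\, r_{\vec J}^{\,k},$$ is a ring homomorphism ($B^S$ carrying the componentwise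 ring structure). The additive group scheme of $\mathbb{W}_S(R)$ is the commutative affine group scheme over $R$ given by $B\mapsto(\mathbb{W}_S(B),+)$ on $R$-algebras $B$; its Hopf algebra has underlying algebra the polynomial ring $R[a_{\vec I}:\vec I\in S]$. The additive formal group of $\mathbb{W}_S(R)$ is $\mathrm{Spf}\,R[[a_{\vec I}:\vec I\in S]]$, where $R[[a_{\vec I}:\vec I\in S]]$ is the ring of all formal power series (the product of copies of $R$ over all monomials in the $a_{\vec I}$, with the product topology, $R$ discrete), with the formal group structure given by the same Witt vector addition polynomials. Formal groups. A commutative formal group over $R$ is a commutative group object in formal schemes over $\mathrm{Spf}\,R$ ($R$ discrete) which, locally on $\mathrm{Spf}\,R$, is affine, i.e. of the form $\mathrm{Spf}\,A$ with $A$ a commutative topological algebra whose underlying topological module is isomorphic to a product of copies of the discrete base ring with the product topology. The identity section makes a formal group a pointed formal scheme. $\mathrm{Mor}_{\mathrm{fg}}$ denotes morphisms of commutative formal groups over $R$. $\hat{\mathbb{A}}^n=\mathrm{Spf}\,R[[t_1,\dots,t_n]]$ is formal affine $n$-space, pointed by the section $\mathrm{Spf}\,R\to\hat{\mathbb{A}}^n$ corresponding to the ideal $\langle t_1,\dots,t_n\rangle$. $\mathrm{Mor}_{\mathrm{fs}}(\hat{\mathbb{A}}^n,G)$ is the set of morphisms of pointed formal schemes over $R$, with the group structure induced by that of $G$. *)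

(* Defs.v *)
From HB Require Import structures.
From mathcomp Require Import all_boot all_order all_algebra finmap multiset.
From mathcomp Require Import boolp classical_sets functions cardinality fsbigop.
From mathcomp Require Import topology tvs.
From mathcomp Require Import ring.

Set Implicit Arguments.
Unset Strict Implicit.
Unset Printing Implicit Defensive.

Import GRing.Theory.
Local Open Scope classical_set_scope.
Local Open Scope ring_scope.

(* Rings are comPzRingType throughout, so that the zero ring is allowed: it     *)
(* occurs as a localization.  A formal scheme over R is given by its functor of *)
(* points on (discrete, commutative) R-algebras.                                *)

HB.mixin Record Nmodule_isLocallyFinite M of GRing.Nmodule M := {
  finite_decomp : forall m : M, finite_set [set p : M * M | p.1 + p.2 = m]
}.
#[short(type="locFinMonoidType")]
HB.structure Definition LocallyFiniteMonoid :=
  {M of GRing.Nmodule M & Nmodule_isLocallyFinite M}.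

Definition decomp (M : locFinMonoidType) (m : M) : {fset M * M} :=
  fset_set [set p : M * M | p.1 + p.2 = m].

Lemma mem_decomp (M : locFinMonoidType) (m : M) p :
  (p \in decomp m) = (p.1 + p.2 == m).
Proof.
rewrite in_fset_set; last exact: finite_decomp.
by apply/idP/eqP => [/set_mem|H]; last exact/mem_set.
Qed.

Section ProductTopology.
Context {K : choiceType} {T : choiceType}.
Let PT := {ptws K -> discrete_topology T}.

Lemma nbhs_ptws_discrete (f : PT) (U : set PT) :
  nbhs f U <-> exists F : seq K, forall g : PT, {in F, g =1 f} -> U g.
Proof.
split => [|[F FU]].
  pose N : set_system PT :=
    [set V | exists F : seq K, forall g : PT, {in F, g =1 f} -> V g].
  have NF : Filter N.
    split; first by exists [::].
      move=> A B [F FA] [G GB]; exists (F ++ G) => g gf; split.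
        by apply: FA => x xF; apply: gf; rewrite mem_cat xF.
      by apply: GB => x xG; apply: gf; rewrite mem_cat xG orbT.
    by move=> A B AB [F FA]; exists F => g /FA /AB.
  suff Nf : N --> f by move=> /Nf.
  apply/cvg_sup => i; move=> A [B [[C oC <-] Cf CA]].
  by exists [:: i] => g gf; apply: CA; rewrite /= (gf i)// mem_head.
elim: F U FU => [|k F IH] U FU.
  by apply: filterS filterT => g _; exact: FU.
have h1 : nbhs f [set g : PT | {in F, g =1 f}] by apply: IH.
have h2 : nbhs f ((fun g : PT => g k) @^-1` [set f k]).
  by apply: (@proj_continuous _ (fun=> discrete_topology T) k f); exact: discrete_set1.
apply: filterS (filterI h1 h2) => g [gF gk]; apply: FU => x.
by rewrite inE => /orP[/eqP->|/gF].
Qed.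
End ProductTopology.

(* Formal series indexed by a locally finite monoid, with the convolution       *)
(* product below.  M = nat gives R[[t]]; the power series ring in variables     *)
(* indexed by I is obtained with M = monomial I, the finite multisets on I.     *)
Definition series (M R : Type) := M -> R.

HB.instance Definition _ (M R : choiceType) :=
  Topological.copy (series M R) {ptws M -> discrete_topology R}.

Lemma nbhs_seriesE (M R : choiceType) (f : series M R) (U : set (series M R)) :
  nbhs f U <-> exists F : seq M, forall g : series M R, {in F, g =1 f} -> U g.
Proof. exact: nbhs_ptws_discrete. Qed.

Section SeriesRing.
Context {M : locFinMonoidType} {R : comPzRingType}.
Implicit Types f g h : series M R.

Lemma seriesP f g : f =1 g -> f = g.
Proof. by move=> fg; apply/funext. Qed.

Definition series_add f g : series M R := fun m => f m + g m.
Definition series_opp f : series M R := fun m => - f m.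
Definition series_zero : series M R := fun=> 0.
Definition series_mul f g : series M R :=
  fun m => \sum_(p <- decomp m) f p.1 * g p.2.
Definition monom (c : R) (m : M) : series M R := fun k => if k == m then c else 0.

Fact series_addA : associative series_add.
Proof. by move=> f g h; apply/seriesP => m; rewrite /series_add addrA. Qed.
Fact series_addC : commutative series_add.
Proof. by move=> f g; apply/seriesP => m; rewrite /series_add addrC. Qed.
Fact series_add0 : left_id series_zero series_add.
Proof. by move=> f; apply/seriesP => m; rewrite /series_add add0r. Qed.
Fact series_addN : left_inverse series_zero series_opp series_add.
Proof. by move=> f; apply/seriesP => m; rewrite /series_add addNr. Qed.

HB.instance Definition _ := GRing.isZmodule.Build (series M R)
  series_addA series_addC series_add0 series_addN.

Lemma sum_decompC (F : M -> M -> R) m :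
  \sum_(p <- decomp m) F p.1 p.2 = \sum_(p <- decomp m) F p.2 p.1.
Proof.
pose sw (p : M * M) := (p.2, p.1).
transitivity (\sum_(p <- [seq sw p | p <- decomp m]) F p.2 p.1).
  by rewrite big_map.
apply: perm_big.
apply: uniq_perm; rewrite ?fset_uniq//.
  by rewrite map_inj_uniq ?fset_uniq// => -[a b] [c d] [-> ->].
move=> [a b]; apply/mapP/idP => [[[c d]]|].
  by rewrite !mem_decomp/= => /eqP <- [-> ->]; rewrite addrC.
by rewrite mem_decomp /= => ab; exists (b, a); rewrite ?mem_decomp//= addrC.
Qed.

Lemma sum_decompA (F : M -> M -> M -> R) m :
  \sum_(p <- decomp m) \sum_(q <- decomp p.1) F q.1 q.2 p.2 =
  \sum_(p <- decomp m) \sum_(q <- decomp p.2) F p.1 q.1 q.2.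
Proof.
pose s1 := [seq (q.1, q.2, p.2) | p <- decomp m, q <- decomp p.1].
pose s2 := [seq (p.1, q.1, q.2) | p <- decomp m, q <- decomp p.2].
transitivity (\sum_(t <- s1) F t.1.1 t.1.2 t.2).
  by rewrite big_allpairs_dep.
transitivity (\sum_(t <- s2) F t.1.1 t.1.2 t.2); last first.
  by rewrite big_allpairs_dep.
apply: perm_big; apply: uniq_perm.
- apply: allpairs_uniq_dep; rewrite ?fset_uniq//.
    by move=> p _; rewrite fset_uniq.
  move=> p q /allpairsPdep[[a b] [[c d] [_ cd ->]]].
  move=> /allpairsPdep[[a' b'] [[c' d'] [_ cd' ->]]]; move: cd cd'.
  by rewrite !mem_decomp/= => /eqP <- /eqP <- [-> -> ->].
- apply: allpairs_uniq_dep; rewrite ?fset_uniq//.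
    by move=> p _; rewrite fset_uniq.
  move=> p q /allpairsPdep[[a b] [[c d] [_ cd ->]]].
  move=> /allpairsPdep[[a' b'] [[c' d'] [_ cd' ->]]]; move: cd cd'.
  by rewrite !mem_decomp/= => /eqP <- /eqP <- [-> -> ->].
move=> [[a b] c]; apply/allpairsPdep/allpairsPdep => /=.
  move=> [[u v] [[x y] [+ + [-> -> ->]]]]; rewrite !mem_decomp/= => /eqP <- /eqP <-.
  by exists (x, y + v), (y, v); rewrite !mem_decomp/= addrA !eqxx.
move=> [[u v] [[x y] [+ + [-> -> ->]]]]; rewrite !mem_decomp/= => /eqP <- /eqP <-.
by exists (u + x, y), (u, x); rewrite !mem_decomp/= addrA !eqxx.
Qed.

Fact series_mulC : commutative series_mul.
Proof.
move=> f g; apply/seriesP => m; rewrite /series_mul.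
rewrite (sum_decompC (fun a b => f a * g b)).
by apply: eq_bigr => p _; rewrite mulrC.
Qed.

Fact series_mulA : associative series_mul.
Proof.
move=> f g h; apply/seriesP => m; rewrite /series_mul.
transitivity (\sum_(p <- decomp m) \sum_(q <- decomp p.2) f p.1 * g q.1 * h q.2).
  by apply: eq_bigr => p _; rewrite mulr_sumr; apply: eq_bigr => q _; rewrite mulrA.
rewrite -(sum_decompA (fun a b c => f a * g b * h c)).
by apply: eq_bigr => p _; rewrite mulr_suml.
Qed.

Lemma monom_mulE c k f m : series_mul (monom c k) f m =
  \sum_(p <- decomp m | p.1 == k) c * f p.2.
Proof.
rewrite /series_mul [RHS]big_mkcond; apply: eq_bigr => p _.
by rewrite /monom; case: eqP => // _; rewrite mul0r.
Qed.

Fact series_mul1 : left_id (monom 1 0) series_mul.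
Proof.
move=> f; apply/seriesP => m; rewrite monom_mulE big_mkcond.
rewrite (bigD1_seq (0, m)) ?fset_uniq ?mem_decomp ?add0r//= eqxx mul1r.
rewrite big_seq_cond big1 ?addr0// => -[a b]; rewrite mem_decomp/= => /andP[/eqP ab].
by have [a0|//] := eqVneq a 0; rewrite -ab a0 add0r eqxx.
Qed.

Fact series_mulDl : left_distributive series_mul series_add.
Proof.
move=> f g h; apply/seriesP => m; rewrite /series_mul /series_add -big_split.
by apply: eq_bigr => p _; rewrite mulrDl.
Qed.

HB.instance Definition _ := GRing.Zmodule_isComPzRing.Build (series M R)
  series_mulA series_mulC series_mul1 series_mulDl.

Lemma series_addE f g m : (f + g) m = f m + g m. Proof. by []. Qed.
Lemma series_oppE f m : (- f) m = - f m. Proof. by []. Qed.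
Lemma series_0E m : (0 : series M R) m = 0. Proof. by []. Qed.
Lemma series_1E m : (1 : series M R) m = if m == 0 then 1 else 0.
Proof. by []. Qed.
Lemma series_mulE f g m : (f * g) m = \sum_(p <- decomp m) f p.1 * g p.2.
Proof. by []. Qed.
Lemma series_sumE (I : Type) (s : seq I) (P : pred I) (F : I -> series M R) m :
  (\sum_(i <- s | P i) F i) m = \sum_(i <- s | P i) F i m.
Proof. by elim/big_rec2: _ => // i x y _ <-. Qed.

Lemma monomM c d k l : monom c k * monom d l = monom (c * d) (k + l).
Proof.
apply/seriesP => m; rewrite [LHS]monom_mulE /monom big_mkcond.
have [->|mkl] := eqVneq m (k + l).
  rewrite (bigD1_seq (k, l)) ?fset_uniq ?mem_decomp//= !eqxx.
  rewrite big_seq_cond big1 ?addr0// => -[a b]; rewrite mem_decomp/= => /andP[_].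
  rewrite xpair_eqE; have [_|//] := eqVneq a k.
  by have [//|_] := eqVneq b l; rewrite mulr0.
rewrite big_seq big1// => -[a b]; rewrite mem_decomp/= => /eqP ab.
have [ak|//] := eqVneq a k; have [bl|] := eqVneq b l; last by rewrite mulr0.
by rewrite -ab ak bl eqxx in mkl.
Qed.

Fact monom0_additive : zmod_morphism (fun c : R => monom c 0).
Proof. by move=> c d; apply/seriesP => m; rewrite /monom !series_addE series_oppE; case: eqP; rewrite ?subrr. Qed.
Fact monom0_multiplicative : monoid_morphism (fun c : R => monom c 0).
Proof. by split=> // c d; rewrite monomM addr0. Qed.
Definition seriesC : R -> series M R := fun c => monom c 0.
HB.instance Definition _ := GRing.isZmodMorphism.Build R (series M R) seriesC
  monom0_additive.
HB.instance Definition _ := GRing.isMonoidMorphism.Build R (series M R) seriesC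
  monom0_multiplicative.

Lemma seriesCE c f m : (seriesC c * f) m = c * f m.
Proof.
rewrite [LHS]monom_mulE big_mkcond.
rewrite (bigD1_seq (0, m)) ?fset_uniq ?mem_decomp ?add0r//= eqxx.
rewrite big_seq_cond big1 ?addr0// => -[a b]; rewrite mem_decomp/= => /andP[/eqP ab].
by have [a0|//] := eqVneq a 0; rewrite -ab a0 add0r eqxx.
Qed.


Fact series_add_continuous :
  continuous (fun x : series M R * series M R => x.1 + x.2).
Proof.
move=> [f g] U /= /nbhs_seriesE[F FU].
exists ([set h : series M R | {in F, h =1 f}], [set h : series M R | {in F, h =1 g}]).
  by split; apply/nbhs_seriesE; exists F.
by move=> [h k] [/= hf kg]; apply: FU => m mF; rewrite !series_addE hf// kg.
Qed.

Fact series_opp_continuous : continuous (-%R : series M R -> series M R).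
Proof.
move=> f U /nbhs_seriesE[F FU]; apply/nbhs_seriesE; exists F => g gf.
by apply: FU => m mF; rewrite !series_oppE gf.
Qed.

Fact series_mul_continuous :
  continuous (fun x : series M R * series M R => x.1 * x.2).
Proof.
move=> [f g] U /= /nbhs_seriesE[F FU].
pose G := flatten [seq [seq p.1 | p <- decomp m] ++ [seq p.2 | p <- decomp m] | m <- F].
exists ([set h : series M R | {in G, h =1 f}], [set h : series M R | {in G, h =1 g}]).
  by split; apply/nbhs_seriesE; exists G.
move=> [h k] [/= hf kg]; apply: FU => m mF; rewrite !series_mulE.
rewrite !big_seq; apply: eq_bigr => p pm; rewrite hf ?kg//; apply/flatten_mapP;
  exists m => //; rewrite mem_cat map_f ?orbT//.
Qed.

End SeriesRing.

HB.mixin Record TopologicalZmodule_isTopologicalComPzRing A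
    of TopologicalZmodule A & GRing.ComPzRing A := {
  mul_continuous : continuous (fun x : A * A => x.1 * x.2)
}.
#[short(type="topComRingType")]
HB.structure Definition TopologicalComPzRing :=
  {A of TopologicalZmodule A & GRing.ComPzRing A
        & TopologicalZmodule_isTopologicalComPzRing A}.

HB.instance Definition _ (M : locFinMonoidType) (R : comPzRingType) :=
  PreTopologicalNmodule_isTopologicalNmodule.Build (series M R)
    series_add_continuous.
HB.instance Definition _ (M : locFinMonoidType) (R : comPzRingType) :=
  TopologicalNmodule_isTopologicalZmodule.Build (series M R)
    series_opp_continuous.
HB.instance Definition _ (M : locFinMonoidType) (R : comPzRingType) :=
  TopologicalZmodule_isTopologicalComPzRing.Build (series M R)
    series_mul_continuous.

Fact nat_finite_decomp (m : nat) : finite_set [set p : nat * nat | (p.1 + p.2 = m)%R].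
Proof.
apply: (@sub_finite_set _ _ (`I_m.+1 `*` `I_m.+1)); last first.
  by apply: finite_setX; exact: finite_II.
move=> [a b] /= ab; have {}ab : (a + b)%N = m := ab.
by split => /=; rewrite ltnS -ab ?leq_addl ?leq_addr.
Qed.
HB.instance Definition _ := Nmodule_isLocallyFinite.Build nat nat_finite_decomp.

Definition monomial (I : choiceType) := {mset I}%mset.
HB.instance Definition _ (I : choiceType) := Choice.on (monomial I).
Section Monomial.
Context {I : choiceType}.
Local Open Scope mset_scope.
HB.instance Definition _ := GRing.isNmodule.Build (monomial I)
  (@msetDA I) (@msetDC I) (@mset0D I).

Lemma monomial_ind (P : monomial I -> Prop) :
  P 0%R -> (forall i m, P m -> P (([mset i] : monomial I) + m)%R) -> forall m, P m.
Proof.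
move=> P0 PS m; rewrite -[m]seq_mset_id; elim: (EnumMset.f m) => [|i s IH].
  by have -> : seq_mset [::] = mset0 :> {mset I} by apply/msetP => a; rewrite mset_seqE mset0E.
by rewrite mset_cons; exact: PS.
Qed.

Fact monomial_finite_decomp (m : monomial I) :
  finite_set [set p : monomial I * monomial I | (p.1 + p.2 = m)%R].
Proof.
elim/monomial_ind: m => [|i m IH].
  apply: (@sub_finite_set _ _ [set (0, 0)%R]) => // -[a b] /= ab.
  congr (_, _); apply/msetP => x.
    have : (a `+` b) x = 0%N by rewrite (_ : a `+` b = mset0)// mset0E.
    by rewrite msetE2 mset0E => /eqP; rewrite addn_eq0 => /andP[/eqP].
  have : (a `+` b) x = 0%N by rewrite (_ : a `+` b = mset0)// mset0E.
  by rewrite msetE2 mset0E => /eqP; rewrite addn_eq0 => /andP[_ /eqP].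
pose l (p : monomial I * monomial I) := ((([mset i] : monomial I) + p.1)%R, p.2).
pose r (p : monomial I * monomial I) := (p.1, (([mset i] : monomial I) + p.2)%R).
set D := [set p | _] in IH.
apply: (@sub_finite_set _ _ (l @` D `|` r @` D)); last first.
  by rewrite finite_setU; split; exact: finite_image.
move=> [a b] /= ab.
have E x : (a x + b x = (x == i) + m x)%N.
  have := congr1 (fun A : {mset I} => A x) (ab : a `+` b = i +` m).
  by rewrite msetE2 mset1DE.
have : i \in (a `+` b) by rewrite (ab : a `+` b = i +` m) mset1D1.
rewrite in_msetD => /orP[] ix; [left|right].
  exists (a `\ i, b)%mset; last by congr (_, _); exact: msetB1K.
  apply/msetP => x; apply/eqP; rewrite msetE2 msetB1E -(eqn_add2l (x == i)) -E addnA.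
  by rewrite subnKC//; case: eqVneq => // ->; rewrite mset_gt0.
exists (a, b `\ i)%mset; last by congr (_, _); exact: msetB1K.
apply/msetP => x; apply/eqP; rewrite msetE2 msetB1E -(eqn_add2l (x == i)) -E.
by rewrite addnCA subnKC//; case: eqVneq => // ->; rewrite mset_gt0.
Qed.
HB.instance Definition _ := Nmodule_isLocallyFinite.Build (monomial I)
  monomial_finite_decomp.
End Monomial.

(* An R-algebra is a ring with a morphism from R: algType excludes the zero     *)
(* ring.                                                                        *)
Record algebra (R : comPzRingType) := Algebra {
  alg_ring :> comPzRingType;
  alg_map : {rmorphism R -> alg_ring}
}.

Record alg_hom (R : comPzRingType) (B C : algebra R) := AlgHom {
  alg_fun :> {rmorphism B -> C};
  alg_funE : forall r, alg_fun (alg_map B r) = alg_map C r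
}.

Record top_algebra (R : comPzRingType) := TopAlgebra {
  talg_ring :> topComRingType;
  talg_map : {rmorphism R -> talg_ring}
}.

Lemma rmorphism_ext (B C : pzRingType) (f g : {rmorphism B -> C}) :
  f =1 g -> f = g.
Proof.
case: f g => [f [[f1] [f2]]] [g [[g1] [g2]]] /= /funext fg.
case: _ / fg in g1 g2 *.
by rewrite (Prop_irrelevance f1 g1) (Prop_irrelevance f2 g2).
Qed.

Lemma alg_hom_ext (R : comPzRingType) (B C : algebra R) (f g : alg_hom B C) :
  f =1 g -> f = g.
Proof.
case: f g => [f f1] [g g1] /= /rmorphism_ext fg; case: _ / fg in g1 *.
by rewrite (Prop_irrelevance f1 g1).
Qed.

Definition alg_id (R : comPzRingType) (B : algebra R) : alg_hom B B :=
  @AlgHom R B B idfun (fun=> erefl).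

Definition alg_comp (R : comPzRingType) (B C D : algebra R)
    (g : alg_hom C D) (f : alg_hom B C) : alg_hom B D :=
  @AlgHom R B D (g \o f : {rmorphism B -> D})
    (fun r => etrans (congr1 g (alg_funE f r)) (alg_funE g r)).

Definition restrict_scalars (R R' : comPzRingType) (h : {rmorphism R -> R'})
    (B : algebra R') : algebra R :=
  Algebra (alg_map B \o h : {rmorphism R -> B}).

Definition restrict_hom (R R' : comPzRingType) (h : {rmorphism R -> R'})
    (B C : algebra R') (f : alg_hom B C) :
    alg_hom (restrict_scalars h B) (restrict_scalars h C) :=
  @AlgHom R (restrict_scalars h B) (restrict_scalars h C) f (fun r => alg_funE f (h r)).

Record functor (R : comPzRingType) := Functor {
  fobj :> algebra R -> Type;
  fmap : forall B C : algebra R, alg_hom B C -> fobj B -> fobj C;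
  fmap_id : forall (B : algebra R) (x : fobj B), fmap (alg_id B) x = x;
  fmap_comp : forall (B C D : algebra R) (g : alg_hom C D) (f : alg_hom B C)
    (x : fobj B), fmap (alg_comp g f) x = fmap g (fmap f x)
}.

(* Spf A sends a discrete R-algebra B to the continuous R-algebra morphisms     *)
(* from A to B.                                                                 *)
Record spf_point (R : comPzRingType) (A : top_algebra R) (B : algebra R) :=
  SpfPoint {
    spf_fun :> {rmorphism A -> B};
    spf_funE : forall r, spf_fun (talg_map A r) = alg_map B r;
    spf_cont : continuous (spf_fun : A -> discrete_topology B)
  }.

Lemma spf_point_ext (R : comPzRingType) (A : top_algebra R) (B : algebra R)
  (f g : spf_point A B) : f =1 g -> f = g.
Proof.
case: f g => [f f1 f2] [g g1 g2] /= /rmorphism_ext fg; case: _ / fg in g1 g2 *.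
by rewrite (Prop_irrelevance f1 g1) (Prop_irrelevance f2 g2).
Qed.

Section Spf.
Variables (R : comPzRingType) (A : top_algebra R).

Lemma continuous_discreteP (T : topologicalType) (U : choiceType) (f : T -> U) :
  continuous (f : T -> discrete_topology U) <->
  forall x, nbhs x [set y | f y = f x].
Proof.
split=> [fc x|fn x V].
  by have := fc x _ (discrete_set1 (f x : discrete_topology U)).
by move=> /= /(@nbhs_singleton (discrete_topology U)) Vx; apply: filterS (fn x) => y /= ->.
Qed.

Fact spf_map_cont (B C : algebra R) (f : alg_hom B C) (x : spf_point A B) :
  continuous (f \o x : A -> discrete_topology C).
Proof.
apply/continuous_discreteP => a.
by apply: filterS ((continuous_discreteP _).1 (@spf_cont _ _ _ x) a) => b /= ->.
Qed.

Definition spf_map (B C : algebra R) (f : alg_hom B C) (x : spf_point A B) :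
    spf_point A C :=
  @SpfPoint R A C (f \o x : {rmorphism A -> C})
    (fun r => etrans (congr1 f (spf_funE x r)) (alg_funE f r))
    (@spf_map_cont B C f x).

Fact spf_map_id (B : algebra R) (x : spf_point A B) : spf_map (alg_id B) x = x.
Proof. exact: spf_point_ext. Qed.

Fact spf_map_comp (B C D : algebra R) (g : alg_hom C D) (f : alg_hom B C)
  (x : spf_point A B) : spf_map (alg_comp g f) x = spf_map g (spf_map f x).
Proof. exact: spf_point_ext. Qed.

Definition Spf : functor R := Functor spf_map_id spf_map_comp.

End Spf.

(* l exhibits C as the localization of B inverting g.                           *)
Definition is_localization (B C : comPzRingType) (g : B) (l : B -> C) :=
  [/\ exists u, l g * u = 1,
      forall c, exists b k, c * l g ^+ k = l b
    & forall b, l b = 0 -> exists k, g ^+ k * b = 0].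

Definition unit_family (B : comPzRingType) (k : nat) (g : 'I_k -> B) :=
  exists c : 'I_k -> B, \sum_i c i * g i = 1.

(* The C i are the localizations B[1/g_i] of a finite standard open cover of    *)
(* Spec B, and D i j is B[1/(g_i g_j)].                                         *)
Definition zariski_sheaf (R : comPzRingType) (X : functor R) :=
  forall (B : algebra R) (k : nat) (g : 'I_k -> B)
    (C : 'I_k -> algebra R) (D : 'I_k -> 'I_k -> algebra R)
    (l : forall i, alg_hom B (C i))
    (p : forall i j, alg_hom (C i) (D i j))
    (q : forall i j, alg_hom (C j) (D i j)),
  unit_family g ->
  (forall i, is_localization (g i) (l i)) ->
  (forall i j, is_localization (g i * g j) (p i j \o l i)) ->
  (forall i j, p i j \o l i =1 q i j \o l j) ->
  forall x : forall i, X (C i),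
  (forall i j, fmap (p i j) (x i) = fmap (q i j) (x j)) ->
  exists! y : X B, forall i, fmap (l i) y = x i.

Definition is_product_module (R : comPzRingType) (A : top_algebra R) :=
  exists (K : choiceType) (e : A -> {ptws K -> discrete_topology R})
      (e' : {ptws K -> discrete_topology R} -> A),
    [/\ forall (r s : R) (a b : A) (k : K),
          e (talg_map A r * a + talg_map A s * b) k = r * e a k + s * e b k,
        cancel e e', cancel e' e, continuous e & continuous e'].

(* Over each open subset Spec R[1/f_i] of a cover of Spec R, the functor X is   *)
(* Spf A with A a topological R[1/f_i]-algebra that is a product of copies of   *)
(* R[1/f_i] as a topological module.  R' stands for R[1/f_i].                   *)
Definition locally_affine (R : comPzRingType) (X : functor R) :=
  exists (k : nat) (f : 'I_k -> R), unit_family f /\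
  forall i, exists (R' : comPzRingType) (h : {rmorphism R -> R'})
      (A : top_algebra R')
      (e : forall B : algebra R', X (restrict_scalars h B) -> Spf A B),
    [/\ is_localization (f i) h,
        is_product_module A,
        forall B, bijective (e B)
      & forall (B C : algebra R') (u : alg_hom B C) (x : X (restrict_scalars h B)),
          e C (fmap (restrict_hom h u) x) = fmap u (e B x)].

(* A commutative group object in functors is a functor to abelian groups.       *)
Record group_functor (R : comPzRingType) := GroupFunctor {
  gobj :> algebra R -> zmodType;
  gmap : forall B C : algebra R, alg_hom B C -> {additive gobj B -> gobj C};
  gmap_id : forall (B : algebra R) (x : gobj B), gmap (alg_id B) x = x;
  gmap_comp : forall (B C D : algebra R) (g : alg_hom C D) (f : alg_hom B C)
    (x : gobj B), gmap (alg_comp g f) x = gmap g (gmap f x)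
}.

Definition underlying (R : comPzRingType) (G : group_functor R) : functor R :=
  @Functor R (fun B => G B) (fun B C f => gmap G f) (@gmap_id R G)
    (@gmap_comp R G).

Record formal_group (R : comPzRingType) := FormalGroup {
  fg_functor :> group_functor R;
  fg_sheaf : zariski_sheaf (underlying fg_functor);
  fg_local : locally_affine (underlying fg_functor)
}.

Record fg_hom (R : comPzRingType) (G H : group_functor R) := FgHom {
  fg_fun :> forall B : algebra R, {additive G B -> H B};
  fg_natural : forall (B C : algebra R) (f : alg_hom B C) (x : G B),
    fg_fun C (gmap G f x) = gmap H f (fg_fun B x)
}.

Record pointed_functor (R : comPzRingType) := PointedFunctor {
  pfunctor :> functor R;
  basepoint : forall B : algebra R, pfunctor B;
  basepoint_natural : forall (B C : algebra R) (f : alg_hom B C),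
    fmap f (basepoint B) = basepoint C
}.

Definition pointed_group (R : comPzRingType) (G : group_functor R) :
    pointed_functor R :=
  @PointedFunctor R (underlying G) (fun B => (0 : G B))
    (fun B C f => raddf0 (gmap G f)).

Record pointed_mor (R : comPzRingType) (X Y : pointed_functor R) := PointedMor {
  pmor_fun :> forall B : algebra R, X B -> Y B;
  pmor_natural : forall (B C : algebra R) (f : alg_hom B C) (x : X B),
    pmor_fun (fmap f x) = fmap f (pmor_fun x);
  pmor_base : forall B : algebra R, pmor_fun (basepoint X B) = basepoint Y B
}.

Section HomGroups.
Variables (R : comPzRingType).

Definition fg_comp (F G H : group_functor R) (v : fg_hom G H) (u : fg_hom F G) :
    fg_hom F H :=
  @FgHom R F H (fun B => v B \o u B : {additive F B -> H B})
    (fun B C f x => etrans (congr1 (v C) (fg_natural u f x))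
      (fg_natural v f (u B x))).

Definition pmor_fg_comp (X : pointed_functor R) (G H : group_functor R)
    (v : fg_hom G H) (c : pointed_mor X (pointed_group G)) :
    pointed_mor X (pointed_group H) :=
  @PointedMor R X (pointed_group H) (fun B x => v B (c B x))
    (fun B C f x => etrans (congr1 (v C) (pmor_natural c f x))
      (fg_natural v f (c B x)))
    (fun B => etrans (congr1 (v B) (pmor_base c B)) (raddf0 (v B))).

Variables (F G : group_functor R) (X : pointed_functor R).

Fact fg_add_natural (u v : fg_hom F G) (B C : algebra R) (f : alg_hom B C) x :
  (u C \+ v C) (gmap F f x) = gmap G f ((u B \+ v B) x).
Proof. by rewrite /= !fg_natural raddfD. Qed.

Definition fg_add (u v : fg_hom F G) : fg_hom F G :=
  @FgHom R F G (fun B => u B \+ v B : {additive F B -> G B})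
    (fg_add_natural u v).

Definition pmor_add_fun (c d : pointed_mor X (pointed_group G)) (B : algebra R)
  (x : X B) : G B := (c B x : G B) + (d B x : G B).

Fact pmor_add_natural (c d : pointed_mor X (pointed_group G)) (B C : algebra R)
    (f : alg_hom B C) (x : X B) :
  pmor_add_fun c d (fmap f x) = gmap G f (pmor_add_fun c d x).
Proof. by rewrite /pmor_add_fun !pmor_natural raddfD. Qed.

Fact pmor_add_base (c d : pointed_mor X (pointed_group G)) (B : algebra R) :
  pmor_add_fun c d (basepoint X B) = 0.
Proof. by rewrite /pmor_add_fun !pmor_base /= addr0. Qed.

Definition pmor_add (c d : pointed_mor X (pointed_group G)) :
    pointed_mor X (pointed_group G) :=
  @PointedMor R X (pointed_group G) (pmor_add_fun c d)
    (pmor_add_natural c d) (pmor_add_base c d).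

End HomGroups.

Section SpfSheaf.
Variables (B : comPzRingType) (k : nat) (g : 'I_k -> B).
Hypothesis g1 : unit_family g.

Lemma unit_family_exp N : unit_family (fun i => g i ^+ N).
Proof.
suff main n (e : 'I_k -> nat) : (\sum_i e i <= n)%N ->
    exists d : 'I_k -> B, \sum_i d i * g i ^+ e i = 1.
  by have [d d1] := main _ (fun=> N) (leqnn _); exists d.
have base (f : 'I_k -> nat) i : f i = 0%N ->
    exists d : 'I_k -> B, \sum_i d i * g i ^+ f i = 1.
  move=> f0; exists (fun j => (j == i)%:R); rewrite (bigD1 i)//= eqxx f0 expr0 mulr1.
  by rewrite big1 ?addr0// => j /negPf ->; rewrite mul0r.
elim: n e => [|n IH] e en.
  have [i _|k0] := pickP (fun i : 'I_k => true).
    by apply: (base e i); move: en; rewrite leqn0 sum_nat_eq0 => /forallP/(_ i)/eqP.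
  by have [c c1] := g1; exists c; rewrite -c1; apply: eq_bigr => i; have := k0 i.
have [/existsP[i /eqP /base//]|] := boolP [exists i, e i == 0%N].
rewrite negb_exists => /forallP epos.
have gi i : exists d : 'I_k -> B, \sum_j d j * g j ^+ e j = g i.
  have [|d d1] := IH (fun j => (e j - (j == i))%N).
    rewrite -ltnS; apply: leq_trans en.
    rewrite (bigD1 i)//= [leqRHS](bigD1 i)//= eqxx -addSn leq_add//.
      by rewrite subn1 prednK// lt0n epos.
    by apply: leq_sum => j _; rewrite leq_subr.
  exists (fun j => if j == i then d j else g i * d j).
  rewrite -[RHS]mulr1 -d1 mulr_sumr; apply: eq_bigr => j _.
  case: eqVneq => [->|_]; last by rewrite subn0 mulrA.
  by rewrite subn1 mulrCA -exprS prednK// lt0n epos.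
have [c c1] := g1; have [d dE] := choice gi.
exists (fun j => \sum_i c i * d i j); rewrite -[RHS]c1.
under eq_bigr do rewrite mulr_suml.
rewrite exchange_big; apply: eq_bigr => i _.
by rewrite -[in RHS]dE mulr_sumr; apply: eq_bigr => j _; rewrite mulrA.
Qed.

Variables (C : 'I_k -> comPzRingType) (D : 'I_k -> 'I_k -> comPzRingType).
Variables (l : forall i, {rmorphism B -> C i}).
Variables (p : forall i j, {rmorphism C i -> D i j}).
Variables (q : forall i j, {rmorphism C j -> D i j}).
Hypothesis lloc : forall i, is_localization (g i) (l i).
Hypothesis ploc : forall i j, is_localization (g i * g j) (p i j \o l i).
Hypothesis plql : forall i j, p i j \o l i =1 q i j \o l j.

Lemma glue_uniq b b' : (forall i, l i b = l i b') -> b = b'.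
Proof.
move=> bb'; apply/eqP; rewrite -subr_eq0; apply/eqP.
have /choice[N NE] i : exists N, g i ^+ N * (b - b') = 0.
  by have [_ _] := lloc i; apply; rewrite rmorphB bb' subrr.
have [d d1] := unit_family_exp (\sum_i N i).
rewrite -[LHS]mul1r -d1 mulr_suml big1// => i _.
by rewrite (bigD1 i)//= addnC exprD -!mulrA NE !mulr0.

Qed.

Lemma glue_ex (y : forall i, C i) : (forall i j, p i j (y i) = q i j (y j)) ->
  exists b, forall i, l i b = y i.
Proof.
move=> yE.
have H1 i : exists bN : B * nat, y i * l i (g i) ^+ bN.2 = l i bN.1.
  by have [_ /(_ (y i))[b [N bE]] _] := lloc i; exists (b, N).
have [bN bNE] := choice H1.
pose N := \sum_i (bN i).2.
pose b i := (bN i).1 * g i ^+ (N - (bN i).2).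
have bE i : y i * l i (g i) ^+ N = l i (b i).
  rewrite /b rmorphM rmorphXn -bNE -mulrA -exprD subnKC//.
  by rewrite /N (bigD1 i)//= leq_addr.
clearbody b.
have H2 (ij : 'I_k * 'I_k) : exists M,
    (g ij.1 * g ij.2) ^+ M * (g ij.2 ^+ N * b ij.1 - g ij.1 ^+ N * b ij.2) = 0.
  have [_ _] := ploc ij.1 ij.2; apply; case: ij => i j /=.
  rewrite !rmorphB !rmorphM/= -(bE i); apply/eqP; rewrite subr_eq0; apply/eqP.
  have e c : p i j (l i c) = q i j (l j c) := plql i j c.
  rewrite (e (b j)) -bE !rmorphM !rmorphXn/= yE -!e.
  by ring.
have [M ME] := choice H2; pose M' := (\sum_ij M ij)%N.
have {}ME i j : (g i * g j) ^+ M' * (g j ^+ N * b i) = (g i * g j) ^+ M' * (g i ^+ N * b j).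
  apply/eqP; rewrite -subr_eq0 -mulrBr; apply/eqP.
  rewrite /M' (bigD1 (i, j))//= addnC exprD -mulrA (ME (i, j)) mulr0//.
pose b' i := g i ^+ M' * b i.
have b'E i j : g j ^+ (N + M') * b' i = g i ^+ (N + M') * b' j.
  rewrite /b' !exprD; transitivity ((g i * g j) ^+ M' * (g j ^+ N * b i)).
    by rewrite exprMn; ring.
  by rewrite ME exprMn; ring.
have [d d1] := unit_family_exp (N + M').
exists (\sum_j d j * b' j) => i.
have [[u u1] _ _] := lloc i.
have cancel_g c : l i (g i) ^+ (N + M') * c = 0 -> c = 0.
  move=> c0; rewrite -[c]mul1r -(expr1n _ (N + M')) -u1 exprMn.
  by rewrite mulrAC c0 mul0r.
apply/eqP; rewrite -subr_eq0; apply/eqP; apply: cancel_g.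
rewrite mulrBr -rmorphXn -rmorphM.
have -> : g i ^+ (N + M') * (\sum_j d j * b' j) = b' i.
  rewrite -[RHS]mul1r -d1 mulr_suml mulr_sumr; apply: eq_bigr => j _.
  by rewrite mulrCA -b'E mulrA.
rewrite /b' rmorphM -bE exprD rmorphM -rmorphXn mulrA.
by rewrite !rmorphXn; ring.
Qed.

End SpfSheaf.

Lemma Spf_sheaf (R : comPzRingType) (A : top_algebra R) : zariski_sheaf (Spf A).
Proof.
move=> B k g C D l p q g1 lloc ploc plql x xE.
have uniq := glue_uniq g1 (l := l) lloc.
have ex (a : A) : exists b : B, forall i, l i b = x i a.
  apply: (@glue_ex B k g g1 C D l p q lloc ploc plql (fun i => x i a)) => i j.
  by have := congr1 (fun z : spf_point A (D i j) => z a) (xE i j).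
have [f fE] := choice ex.
have fB : zmod_morphism f.
  by move=> a b; apply: uniq => i; rewrite rmorphB !fE rmorphB.
have fM : monoid_morphism f.
  split; first by apply: uniq => i; rewrite fE !rmorph1.
  by move=> a b; apply: uniq => i; rewrite rmorphM !fE rmorphM.
pose mB := GRing.isZmodMorphism.Build A B f fB.
pose mM := GRing.isMonoidMorphism.Build A B f fM.
pose F : {rmorphism A -> B} := HB.pack f mB mM.
have FE r : F (talg_map A r) = alg_map B r.
  by apply: uniq => i; rewrite fE spf_funE alg_funE.
have Fc : continuous (F : A -> discrete_topology B).
  apply/continuous_discreteP => a.
  have : nbhs a [set b | forall i, x i b = x i a].
    apply: filter_forall => i.
    exact: ((continuous_discreteP _).1 (@spf_cont _ _ _ (x i)) a).
  by apply: filterS => b bE; apply: uniq => i; rewrite !fE; exact: bE.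
exists (SpfPoint FE Fc); split => [i|y yE].
  by apply: spf_point_ext => a; exact: fE.
apply: spf_point_ext => a; apply: uniq => i; rewrite [LHS]fE -yE//.
Qed.

Lemma Spf_locally_affine (R : comPzRingType) (A : top_algebra R) :
  is_product_module A -> locally_affine (Spf A).
Proof.
move=> Aprod; exists 1%N, (fun=> 1); split.
  by exists (fun=> 1); rewrite big_ord1 mulr1.
move=> _; exists R, idfun, A.
pose e (B : algebra R) (x : Spf A (restrict_scalars idfun B)) : Spf A B :=
  @SpfPoint R A B (spf_fun x) (@spf_funE _ _ _ x) (@spf_cont _ _ _ x).
exists e; split => //.
- split=> [|c|b].
  + by exists 1; rewrite mulr1.
  + by exists c, 0%N; rewrite mulr1.
  + by move=> /= ->; exists 0%N; rewrite mulr0.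
- move=> B; exists (fun x : Spf A B => @SpfPoint R A (restrict_scalars idfun B) (spf_fun x)
    (@spf_funE _ _ _ x) (@spf_cont _ _ _ x)); by move=> x; apply: spf_point_ext.
- by move=> B C u x; apply: spf_point_ext.
Qed.

Definition power_series (R : comPzRingType) (I : choiceType) : top_algebra R :=
  @TopAlgebra R (series (monomial I) R)
    (@seriesC (monomial I) R : {rmorphism R -> series (monomial I) R}).

Definition ps_var (R : comPzRingType) (I : choiceType) (i : I) :
  power_series R I := monom 1 ([mset i]%mset : monomial I).

Lemma power_series_product (R : comPzRingType) (I : choiceType) :
  is_product_module (power_series R I).
Proof.
exists (monomial I), id, id; split => //; last 2 first.
- by move=> f; exact: cvg_id.
- by move=> f; exact: cvg_id.
by move=> r s a b k; rewrite series_addE !seriesCE.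
Qed.

Section MonEval.
Variables (I : choiceType) (B : comPzRingType).

Definition mon_eval (x : I -> B) (m : monomial I) : B :=
  \prod_(i <- EnumMset.f m) x i.

Lemma mon_eval0 x : mon_eval x 0 = 1.
Proof. by rewrite /mon_eval enum_mset0 big_nil. Qed.

Lemma mon_eval1 x i : mon_eval x ([mset i]%mset : monomial I) = x i.
Proof. by rewrite /mon_eval enum_msetn big_seq1. Qed.

Lemma mon_evalD x m n : mon_eval x (m + n) = mon_eval x m * mon_eval x n.
Proof.
rewrite /mon_eval -big_cat; apply: perm_big.
by apply/allP => i _ /=; rewrite count_cat !count_mem_mset msetE2.
Qed.

(* By ps_eval, coord_cofinitely_null and coord_inj below, these families are    *)
(* exactly the values of the variables under the continuous morphisms from a    *)
(* power series ring to a discrete algebra.                                     *)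
Definition cofinitely_null (x : I -> B) :=
  finite_set [set m : monomial I | mon_eval x m != 0].

End MonEval.

Section Eval.
Variables (R : comPzRingType) (I : choiceType) (B : algebra R).
Variables (x : I -> B) (xfin : cofinitely_null x).

Let N := fset_set [set m : monomial I | mon_eval x m != 0].

Definition ps_eval_fun (f : power_series R I) : B :=
  \sum_(m <- N) alg_map B (f m) * mon_eval x m.

Lemma mem_N m : (m \in N) = (mon_eval x m != 0).
Proof. by rewrite in_fset_set//; apply/idP/idP => [/set_mem|/mem_set]. Qed.

Lemma ps_eval_monom c m :
  ps_eval_fun (monom c m) = alg_map B c * mon_eval x m.
Proof.
have [m0|mN] := eqVneq (mon_eval x m) 0.
  rewrite m0 mulr0 /ps_eval_fun big1// => k _; rewrite /monom.
  by have [->|_] := eqVneq k m; rewrite ?m0 ?mulr0// rmorph0 mul0r.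
rewrite /ps_eval_fun (bigD1_seq m) ?fset_uniq ?mem_N//= {1}/monom eqxx.
by rewrite big1 ?addr0// => k /negPf km; rewrite /monom km rmorph0 mul0r.
Qed.

Fact ps_eval_additive : zmod_morphism ps_eval_fun.
Proof.
move=> f g; rewrite /ps_eval_fun -sumrB; apply: eq_bigr => m _.
by rewrite -mulrBl -rmorphB.
Qed.

Fact ps_eval_multiplicative : monoid_morphism ps_eval_fun.
Proof.
split; first by rewrite [LHS]ps_eval_monom mon_eval0 rmorph1 mulr1.
move=> f g; pose h (p : monomial I * monomial I) :=
  (alg_map B (f p.1) * mon_eval x p.1) * (alg_map B (g p.2) * mon_eval x p.2).
have hE p : h p = alg_map B (f p.1 * g p.2) * mon_eval x (p.1 + p.2).
  by rewrite /h rmorphM mon_evalD; ring.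
transitivity (\sum_(p <- [seq p | m <- N, p <- decomp m]) h p).
  rewrite big_allpairs_dep/=; apply: eq_bigr => m _.
  rewrite rmorph_sum/= mulr_suml !big_seq; apply: eq_bigr => p.
  by rewrite mem_decomp => /eqP pm; rewrite hE pm.
transitivity (\sum_(p <- [seq (a, b) | a <- N, b <- N]) h p); last first.
  rewrite big_allpairs_dep/= /ps_eval_fun mulr_suml; apply: eq_bigr => a _.
  by rewrite mulr_sumr; apply: eq_bigr.
rewrite [RHS](bigID (fun p => p.1 + p.2 \in N))/= [X in _ + X]big1 ?addr0; last first.
  by move=> p; rewrite mem_N negbK hE => /eqP ->; rewrite mulr0.
rewrite -[RHS]big_filter; apply: perm_big; apply: uniq_perm.
- apply: allpairs_uniq_dep; rewrite ?fset_uniq//.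
    by move=> m _; rewrite fset_uniq.
  move=> p q /allpairsPdep[m [a [_ am ->]]] /allpairsPdep[n [b [_ bn ->]]] /= ab.
  by move: am bn; rewrite !mem_decomp ab => /eqP -> /eqP ->.
- by rewrite filter_uniq// allpairs_uniq ?fset_uniq// => -[a b] [c d].
move=> [a b]; rewrite mem_filter /=; apply/allpairsPdep/andP => /=.
  move=> [m [p [mN + pE]]]; rewrite mem_decomp -pE /= => /eqP ab.
  rewrite ab mN; split=> //; apply/allpairsP; exists (a, b).
  move: mN; rewrite /= !mem_N -ab mon_evalD => abN.
  by split=> //; apply: contraNneq abN => ->; rewrite ?mul0r ?mulr0.
by move=> [abN _]; exists (a + b), (a, b); rewrite mem_decomp.
Qed.

HB.instance Definition _ := GRing.isZmodMorphism.Build (power_series R I) B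
  ps_eval_fun ps_eval_additive.
HB.instance Definition _ := GRing.isMonoidMorphism.Build (power_series R I) B
  ps_eval_fun ps_eval_multiplicative.

Fact ps_eval_funE r :
  ps_eval_fun (talg_map (power_series R I) r) = alg_map B r.
Proof. by rewrite [LHS]ps_eval_monom mon_eval0 mulr1. Qed.

Fact ps_eval_cont :
  continuous (ps_eval_fun : power_series R I -> discrete_topology B).
Proof.
apply/continuous_discreteP => f; apply/nbhs_seriesE; exists N => g gf /=.
by rewrite /ps_eval_fun !big_seq; apply: eq_bigr => m mN; rewrite gf.
Qed.

Definition ps_eval : Spf (power_series R I) B :=
  @SpfPoint R (power_series R I) B
    (ps_eval_fun : {rmorphism power_series R I -> B}) ps_eval_funE ps_eval_cont.

Lemma ps_eval_var i : ps_eval (ps_var R i) = x i.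
Proof. by rewrite [LHS]ps_eval_monom mon_eval1 rmorph1 mul1r. Qed.

End Eval.

Section Coordinates.
Variables (R : comPzRingType) (I : choiceType).

Definition ps_coord (B : algebra R) (u : Spf (power_series R I) B) (i : I) : B :=
  spf_fun u (ps_var R i).

Lemma mon_eval_coord (B : algebra R) (u : Spf (power_series R I) B) m :
  mon_eval (ps_coord u) m = spf_fun u (monom 1 m).
Proof.
elim/(@monomial_ind I): m => [|i m IH]; first by rewrite mon_eval0; apply/esym; exact: (rmorph1 (spf_fun u)).
rewrite mon_evalD mon_eval1 IH /ps_coord -rmorphM; congr (spf_fun u _).
by rewrite [LHS]monomM mulr1.
Qed.

Lemma coord_cofinitely_null (B : algebra R) (u : Spf (power_series R I) B) :
  cofinitely_null (ps_coord u).
Proof.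
have /nbhs_seriesE[F FE] := (continuous_discreteP _).1 (@spf_cont _ _ _ u) 0.
apply: (@sub_finite_set _ _ [set` F]); last exact: finite_seq.
move=> m /=; apply: contraNT => mF; apply/eqP; rewrite mon_eval_coord.
rewrite -[RHS](rmorph0 (spf_fun u)); apply: FE => k kF.
by rewrite /monom; case: eqVneq => // km; rewrite -km kF in mF.
Qed.

Lemma coord_inj (B : algebra R) (u v : Spf (power_series R I) B) :
  ps_coord u =1 ps_coord v -> u = v.
Proof.
move=> uv; apply: spf_point_ext => f.
have /nbhs_seriesE[F FE] := (continuous_discreteP _).1 (@spf_cont _ _ _ u) f.
have /nbhs_seriesE[G GE] := (continuous_discreteP _).1 (@spf_cont _ _ _ v) f.
pose H := undup (F ++ G).
pose g : power_series R I :=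
  \sum_(m <- H) talg_map (power_series R I) (f m) * monom 1 m.
have gf : {in H, g =1 f}.
  move=> m mH; rewrite /g series_sumE (bigD1_seq m) ?undup_uniq//=.
  rewrite seriesCE {1}/monom eqxx mulr1 big1 ?addr0// => k /negPf km.
  by rewrite seriesCE /monom eq_sym km mulr0.
have ug : spf_fun u g = spf_fun u f.
  by apply: FE => m mF; apply: gf; rewrite mem_undup mem_cat mF.
have vg : spf_fun v g = spf_fun v f.
  by apply: GE => m mF; apply: gf; rewrite mem_undup mem_cat mF orbT.
rewrite -ug -vg /g !rmorph_sum; apply: eq_bigr => m _.
rewrite !rmorphM !spf_funE; congr (_ * _).
by rewrite -!mon_eval_coord; apply: eq_bigr => i _; exact: uv.
Qed.

Lemma coord_map (B C : algebra R) (f : alg_hom B C)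
  (u : Spf (power_series R I) B) i : ps_coord (fmap f u) i = f (ps_coord u i).
Proof. by []. Qed.

End Coordinates.

Lemma null_cofinitely_null (I : choiceType) (B : comPzRingType) :
  cofinitely_null (fun _ : I => 0 : B).
Proof.
apply: (@sub_finite_set _ _ [set 0]) => // m /=; elim/(@monomial_ind I): m => // i m _.
by rewrite mon_evalD mon_eval1 mul0r eqxx.
Qed.

(* The base point sends every variable to 0.                                    *)
Fact affine_space_base_natural (R : comPzRingType) (n : nat)
    (B C : algebra R) (f : alg_hom B C) :
  fmap f (ps_eval (@null_cofinitely_null 'I_n B)) =
  ps_eval (@null_cofinitely_null 'I_n C) :> Spf (power_series R 'I_n) C.
Proof.
by apply: coord_inj => i; rewrite coord_map /ps_coord !ps_eval_var rmorph0.
Qed.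

Definition affine_space (R : comPzRingType) (n : nat) : pointed_functor R :=
  @PointedFunctor R (Spf (power_series R 'I_n))
    (fun B => ps_eval (@null_cofinitely_null 'I_n B))
    (@affine_space_base_natural R n).

Section BigWitt.
Variable B : comPzRingType.
Implicit Types (f g : series nat B) (a b : nat -> B).

(* euler_series a is prod_(d >= 1) (1 - a_d t^d), and euler_inv recovers the    *)
(* a_d from the coefficients; the value a 0 is not used.                        *)
Definition euler a N : series nat B := \prod_(1 <= d < N.+1) (1 - monom (a d) d).
Definition euler_series a : series nat B := fun m => euler a m m.

Fixpoint wlog_seq f m : seq B :=
  if m is m'.+1 then
    let s := wlog_seq f m' in rcons s (euler (nth 0 s) m' m - f m)
  else [:: 0].
Definition euler_inv f (m : nat) : B := nth 0 (wlog_seq f m) m.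

Definition series_inv f : series nat B :=
  fun m => (\sum_(k < m.+1) (1 - f) ^+ k) m.

Lemma mem_decomp_leq (m : nat) p : p \in decomp m -> (p.1 <= m)%N /\ (p.2 <= m)%N.
Proof. by rewrite mem_decomp => /eqP <-; split; [exact: leq_addr|exact: leq_addl]. Qed.

Lemma trunc_mul N f f' g g' : (forall m, (m <= N)%N -> f m = f' m) ->
  (forall m, (m <= N)%N -> g m = g' m) ->
  forall m, (m <= N)%N -> (f * g) m = (f' * g') m.
Proof.
move=> ff gg m mN; rewrite !series_mulE !big_seq; apply: eq_bigr => p.
move=> /mem_decomp_leq[p1 p2].
by rewrite ff ?gg ?(leq_trans p1)// (leq_trans p2).
Qed.

Lemma series_mul_monom f c k m :
  (f * monom c k) m = if (k <= m)%N then f (m - k)%N * c else 0.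
Proof.
rewrite mulrC [LHS]monom_mulE big_mkcond; case: leqP => km.
  rewrite (bigD1_seq (k, (m - k)%N)) ?fset_uniq//= ?eqxx.
    rewrite big_seq_cond big1 ?addr0; first by rewrite mulrC.
    move=> -[u v]; rewrite mem_decomp/= => /andP[/eqP uv].
    have {}uv : (u + v)%N = m := uv.
    by have [uk|//] := eqVneq u k; rewrite -uv uk addKn eqxx.
  by rewrite mem_decomp/=; apply/eqP; exact: subnKC.
rewrite big_seq big1// => -[u v]; rewrite mem_decomp/= => /eqP uv.
have {}uv : (u + v)%N = m := uv.
by have [uk|//] := eqVneq u k; rewrite -uv uk ltnNge leq_addr in km.
Qed.

Lemma series_mul0E f g : (f * g) 0%N = f 0%N * g 0%N.
Proof.
rewrite series_mulE (bigD1_seq (0%N, 0%N)) ?fset_uniq//= ?mem_decomp ?add0r//.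
rewrite big_seq_cond big1 ?addr0// => -[[|u] [|v]]; rewrite mem_decomp//=.
Qed.

Lemma eulerS a N : euler a N.+1 = euler a N * (1 - monom (a N.+1) N.+1).
Proof. by rewrite /euler big_nat_recr. Qed.

Lemma euler0 a N : euler a N 0%N = 1.
Proof.
elim: N => [|N IH]; first by rewrite /euler big_geq.
rewrite eulerS series_mul0E IH mul1r series_addE series_oppE.
by rewrite /monom/= subr0.
Qed.

Lemma eulerSE a N m :
  euler a N.+1 m = euler a N m - (if (N < m)%N then euler a N (m - N.+1)%N * a N.+1 else 0).
Proof. by rewrite eulerS mulrBr mulr1 series_addE series_oppE series_mul_monom. Qed.

Lemma euler_stable a N m : (m <= N)%N -> euler a N m = euler_series a m.
Proof.
rewrite /euler_series; elim: N => [|N IH]; first by rewrite leqn0 => /eqP ->.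
rewrite leq_eqVlt => /predU1P[->//|mN].
by rewrite eulerSE ltnNge -ltnS mN/= subr0 IH.
Qed.

Lemma euler_diag a N : euler_series a N.+1 = euler a N N.+1 - a N.+1.
Proof. by rewrite /euler_series eulerSE ltnSn subnn euler0 mul1r. Qed.

Lemma eq_euler a b N : (forall d, (0 < d <= N)%N -> a d = b d) -> euler a N = euler b N.
Proof.
move=> ab; rewrite /euler !big_nat; apply: eq_bigr => d /andP[d0 dN].
by rewrite ab// d0.
Qed.

Lemma eq_euler_series a b : (forall d, (0 < d)%N -> a d = b d) ->
  euler_series a = euler_series b.
Proof.
move=> ab; apply/seriesP => m; rewrite /euler_series (@eq_euler a b)// => d.
by move=> /andP[/ab].
Qed.

Lemma size_wlog_seq f m : size (wlog_seq f m) = m.+1.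
Proof. by elim: m => //= m IH; rewrite size_rcons IH. Qed.

Lemma nth_wlog_seq f m d : (d <= m)%N -> nth 0 (wlog_seq f m) d = euler_inv f d.
Proof.
elim: m => [|m IH]; first by rewrite leqn0 => /eqP ->.
rewrite leq_eqVlt => /predU1P[->//|dm].
by rewrite /= nth_rcons size_wlog_seq dm IH.
Qed.

Lemma euler_invS f m : euler_inv f m.+1 = euler (euler_inv f) m m.+1 - f m.+1.
Proof.
rewrite {1}/euler_inv /= nth_rcons size_wlog_seq ltnn eqxx.
rewrite (@eq_euler (nth 0 (wlog_seq f m)) (euler_inv f))// => d /andP[_].
exact: nth_wlog_seq.
Qed.

Lemma euler_invK f : f 0%N = 1 -> euler_series (euler_inv f) = f.
Proof.
move=> f0; apply/seriesP => -[|m]; first by rewrite f0 [LHS]euler0.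
by rewrite euler_diag euler_invS opprB addrC subrK.
Qed.

Lemma euler_series_inj a b : euler_series a = euler_series b ->
  forall d, (0 < d)%N -> a d = b d.
Proof.
move=> ab; elim/ltn_ind => -[//|d] IH _.
have := congr1 (fun f : series nat B => f d.+1) ab; rewrite !euler_diag.
rewrite (@eq_euler a b); first by move=> /addrI /oppr_inj.
by move=> k /andP[k0 kd]; exact: IH.
Qed.

Lemma series_exp_small f k m : f 0%N = 0 -> (m < k)%N -> (f ^+ k) m = 0.
Proof.
move=> f0; elim: k m => // k IH m mk; rewrite exprS series_mulE big_seq big1//.
move=> -[[|u] v]; rewrite mem_decomp/= => /eqP uv; first by rewrite f0 mul0r.
rewrite IH ?mulr0//; have {}uv : (u.+1 + v)%N = m := uv.
by rewrite -ltnS (leq_ltn_trans _ mk)// -uv addSn ltnS leq_addl.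
Qed.

Lemma series_mulV f : f 0%N = 1 -> f * series_inv f = 1.
Proof.
move=> f0; apply/seriesP => m.
have g0 : (1 - f) 0%N = 0 by rewrite series_addE series_oppE f0 series_1E eqxx subrr.
have E N j : (j <= N)%N -> series_inv f j = (\sum_(k < N.+1) (1 - f) ^+ k) j.
  move=> jN; rewrite /series_inv !series_sumE.
  rewrite -[LHS](big_mkord xpredT (fun k => ((1 - f) ^+ k) j)).
  rewrite -[RHS](big_mkord xpredT (fun k => ((1 - f) ^+ k) j)).
  rewrite [RHS](big_cat_nat (n := j.+1))//= [X in _ = _ + X]big_nat.
  by rewrite [X in _ = _ + X]big1 ?addr0// => k /andP[jk _]; rewrite series_exp_small.
rewrite (@trunc_mul m f f _ (\sum_(k < m.+1) (1 - f) ^+ k))//; last exact: E.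
have -> : f * (\sum_(k < m.+1) (1 - f) ^+ k) = 1 - (1 - f) ^+ m.+1.
  by rewrite -[RHS]opprB subrX1 -mulNr; congr (_ * _); ring.
by rewrite series_addE series_oppE series_exp_small// subr0.
Qed.

Lemma series_inv0 f : series_inv f 0%N = 1.
Proof. by rewrite /series_inv big_ord1. Qed.

Lemma series_mulI f g h : f 0%N = 1 -> f * g = f * h -> g = h.
Proof.
move=> f0 /(congr1 (fun k => series_inv f * k)).
by rewrite !mulrA ![series_inv f * f]mulrC series_mulV// !mul1r.
Qed.

Definition theta f : series nat B := fun m => f m *+ m.

Lemma thetaM f g : theta (f * g) = theta f * g + f * theta g.
Proof.
apply/seriesP => m; rewrite series_addE !series_mulE /theta series_mulE -sumrMnl.
rewrite -big_split /= !big_seq; apply: eq_bigr => p.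
rewrite mem_decomp => /eqP <-.
by rewrite mulrnDr mulrnAl mulrnAr.
Qed.

Definition unighost a m : B :=
  \sum_(1 <= d < m.+1 | (d %| m)%N) a d ^+ (m %/ d)%N *+ d.

Let G1 a d : series nat B :=
  fun m => if (0 < m)%N && (d %| m)%N then a d ^+ (m %/ d)%N *+ d else 0.

Lemma G1E a d : (0 < d)%N -> (1 - monom (a d) d) * G1 a d = monom (a d *+ d) d.
Proof.
move=> d0; apply/seriesP => m.
rewrite mulrBl mul1r series_addE series_oppE mulrC series_mul_monom /G1 /monom.
have [dm|md] := leqP d m; last first.
  rewrite subr0 (ltn_eqF md); case: andP => // -[m0 /dvdn_leq]/(_ m0).
  by rewrite leqNgt md.
rewrite (leq_trans d0 dm)/= subn_gt0 ltn_neqAle dm andbT dvdn_subl//.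
have [<-|dm'] := eqVneq d m.
  by rewrite /= mul0r subr0 dvdnn divnn d0 expr1.
rewrite /=; case: (boolP (d %| m)%N) => ddm; last by rewrite mul0r subr0.
have -> : ((m - d) %/ d)%N = (m %/ d).-1 by rewrite divnBr// divnn d0 subn1.
have q0 : (0 < m %/ d)%N by rewrite divn_gt0.
by rewrite mulrnAl -exprSr prednK// subrr.
Qed.

Lemma theta_euler a N :
  theta (euler a N) = - (euler a N * \sum_(1 <= d < N.+1) G1 a d).
Proof.
elim: N => [|N IH].
  rewrite [X in _ * X]big_geq// mulr0 oppr0 /euler big_geq//.
  by apply/seriesP => -[|m]; rewrite /theta ?mulr0n// series_1E mul0rn.
rewrite eulerS thetaM IH [in RHS]big_nat_recr//=.
have -> : theta (1 - monom (a N.+1) N.+1) = - monom (a N.+1 *+ N.+1) N.+1.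
  apply/seriesP => m; rewrite /theta series_addE !series_oppE series_1E /monom.
  case: eqVneq => [->|_]; first by rewrite mulr0n; case: eqVneq => //; rewrite oppr0.
  by rewrite sub0r mulNrn; case: eqVneq => [->|_] //; rewrite mul0rn.
by rewrite -G1E//; ring.
Qed.

Lemma theta_euler_series a :
  theta (euler_series a) = - (euler_series a * (unighost a : series nat B)).
Proof.
apply/seriesP => m; rewrite series_oppE.
transitivity (theta (euler a m) m); first by rewrite /theta.
rewrite theta_euler series_oppE; congr (- _).
apply: (@trunc_mul m) => // k km; first exact: euler_stable.
rewrite series_sumE [RHS]/unighost [RHS]big_mkcond/=.
rewrite (big_cat_nat (n := k.+1))//= [X in _ + X]big_nat [X in _ + X]big1 ?addr0.
  rewrite !big_nat; apply: eq_bigr => d /andP[d0 dk].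
  by rewrite /G1 (leq_trans d0).
move=> d /andP[kd _]; rewrite /G1; case: andP => // -[k0 /dvdn_leq] /(_ k0).
by rewrite leqNgt kd.
Qed.

Lemma unighostD a b c : euler_series c = euler_series a * euler_series b ->
  forall m, unighost c m = unighost a m + unighost b m.
Proof.
move=> cab m.
suff : (unighost c : series nat B) = (unighost a : series nat B) + (unighost b : series nat B).
  by move=> /(congr1 (fun f : series nat B => f m)).
apply: (@series_mulI (euler_series c)); first exact: euler0.
apply: oppr_inj; rewrite -theta_euler_series cab thetaM !theta_euler_series.
by rewrite mulNr mulrN -opprD mulrDr mulrAC mulrA.
Qed.

End BigWitt.

Definition windex (n : nat) := {J : {ffun 'I_n -> nat} | J != 0}.
HB.instance Definition _ n := Choice.on (windex n).
HB.instance Definition _ n := SubType.on (windex n).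

Section Index.
Variable n : nat.
Implicit Types I J : windex n.

Definition wgcd J : nat := \big[gcdn/0%N]_(i < n) val J i.

(* d times the primitive vector I / gcd(I), for d > 0.                          *)
Definition ray I (d : nat) : windex n :=
  insubd I ([ffun i => (val I i %/ wgcd I)%N] *+ d).

Lemma ffun_natMn (f : {ffun 'I_n -> nat}) d i : (f *+ d) i = (f i * d)%N.
Proof.
rewrite ffunMnE; elim: d => [|d IH]; first by rewrite mulr0n muln0.
by rewrite mulrS IH mulnS.
Qed.

Lemma big_gcd_dvd (f : 'I_n -> nat) i : (\big[gcdn/0%N]_(j < n) f j %| f i)%N.
Proof. by rewrite (bigD1 i)//= dvdn_gcdl. Qed.

Lemma big_gcdM (f : 'I_n -> nat) d :
  (\big[gcdn/0%N]_(j < n) (f j * d) = (\big[gcdn/0%N]_(j < n) f j) * d)%N.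
Proof. by elim/big_rec2: _ => // i y1 y2 _ ->; rewrite muln_gcdl. Qed.

Lemma wgcd_gt0 I : (0 < wgcd I)%N.
Proof.
rewrite lt0n; apply: contra_neq (valP I) => I0; apply/ffunP => i; rewrite ffunE.
by apply/eqP; rewrite -dvd0n -[X in (X %| _)%N]I0 big_gcd_dvd.
Qed.

Lemma val_ray I d : (0 < d)%N ->
  val (ray I d) = [ffun i => (val I i %/ wgcd I)%N] *+ d.
Proof.
move=> d0; rewrite /ray insubdK//; apply: contra_neq (valP I) => /ffunP E.
apply/ffunP => i; have := E i; rewrite ffun_natMn !ffunE.
move=> /eqP; rewrite muln_eq0 [d == _]eqn0Ngt d0 orbF => /eqP I0.
by rewrite -(divnK (big_gcd_dvd (val I) i)) -/(wgcd I) I0.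
Qed.

Lemma val_rayE I d i : (0 < d)%N -> val (ray I d) i = (val I i %/ wgcd I * d)%N.
Proof. by move=> d0; rewrite val_ray// ffun_natMn ffunE. Qed.

Lemma wgcd_ray I d : (0 < d)%N -> wgcd (ray I d) = d.
Proof.
move=> d0; rewrite /wgcd (eq_bigr _ (fun i _ => val_rayE I i d0)) big_gcdM.
rewrite (_ : \big[_/_]_(j < n) _ = 1%N) ?mul1n//.
apply/eqP; rewrite -(eqn_pmul2r (wgcd_gt0 I)) mul1n -big_gcdM; apply/eqP.
by apply: eq_bigr => i _; rewrite divnK// big_gcd_dvd.
Qed.

Lemma ray_ray I d e : (0 < d)%N -> (0 < e)%N -> ray (ray I d) e = ray I e.
Proof.
move=> d0 e0; apply/val_inj/ffunP => i.
by rewrite !val_rayE// wgcd_ray// mulnK.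
Qed.

Lemma ray_wgcd I : ray I (wgcd I) = I.
Proof.
apply/val_inj/ffunP => i; rewrite val_rayE ?wgcd_gt0// divnK//.
exact: big_gcd_dvd.
Qed.

Lemma ray_eq I J k : val J *+ k = val I -> J = ray I (wgcd J) /\ wgcd I = (wgcd J * k)%N.
Proof.
move=> JI; have IE i : val I i = (val J i * k)%N by rewrite -JI ffun_natMn.
have gE : wgcd I = (wgcd J * k)%N by rewrite /wgcd (eq_bigr _ (fun i _ => IE i)) big_gcdM.
split=> //; apply/val_inj/ffunP => i; rewrite val_rayE ?wgcd_gt0//.
have k0 : (0 < k)%N by move: (wgcd_gt0 I); rewrite gE muln_gt0 => /andP[].
by rewrite IE gE divnMr// divnK// big_gcd_dvd.
Qed.

End Index.

Definition witt (n : nat) (B : Type) := windex n -> B.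

Section Witt.
Variables (n : nat) (B : comPzRingType).
Implicit Types (a b c : witt n B) (I : windex n).

Definition ghost a I : B :=
  \sum_(p \in [set p : nat * windex n | (0 < p.1)%N /\ val p.2 *+ p.1 = val I])
    a p.2 ^+ p.1 *+ wgcd p.2.

Definition ray_series a I : series nat B := euler_series (a \o ray I).

(* Along each ray the Witt vector a is encoded by prod_(d >= 1)                 *)
(* (1 - a_(ray I d) t^d); since minus the logarithmic derivative of this series *)
(* has the ghost components as coefficients, multiplying the series adds ghost  *)
(* components.  Lemmas ghostD and witt_addM below (the addition is functorial   *)
(* and the ghost map is additive over every ring) are the properties that       *)
(* characterize the addition of Witt vectors.                                   *)
Definition witt_zero : witt n B := fun=> 0.
Definition witt_add a b : witt n B :=
  fun I => euler_inv (ray_series a I * ray_series b I) (wgcd I).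
Definition witt_opp a : witt n B :=
  fun I => euler_inv (series_inv (ray_series a I)) (wgcd I).

Lemma ray_series0 a I : ray_series a I 0%N = 1.
Proof. exact: euler0. Qed.

Lemma ray_series_ray a I d : (0 < d)%N -> ray_series a (ray I d) = ray_series a I.
Proof. by move=> d0; apply: eq_euler_series => e e0 /=; rewrite ray_ray. Qed.

Lemma ray_series_inj a b : (forall I, ray_series a I = ray_series b I) -> a = b.
Proof.
move=> ab; apply/funext => I.
by have /= := euler_series_inj (ab I) (wgcd_gt0 I); rewrite ray_wgcd.
Qed.

Lemma ray_series_inv (f : windex n -> series nat B) I :
  (forall d, (0 < d)%N -> f (ray I d) = f I) -> f I 0%N = 1 ->
  ray_series (fun J => euler_inv (f J) (wgcd J)) I = f I.
Proof.
move=> fr f1; rewrite -[RHS]euler_invK//; apply: eq_euler_series => d d0 /=.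
by rewrite wgcd_ray// fr.
Qed.

Lemma ray_series_add a b I :
  ray_series (witt_add a b) I = ray_series a I * ray_series b I.
Proof.
apply: (@ray_series_inv (fun J => ray_series a J * ray_series b J)) => [d d0|].
  by rewrite !ray_series_ray.
by rewrite series_mul0E !ray_series0 mulr1.
Qed.

Lemma ray_series_opp a I :
  ray_series (witt_opp a) I = series_inv (ray_series a I).
Proof.
apply: (@ray_series_inv (fun J => series_inv (ray_series a J))) => [d d0|].
  by rewrite !ray_series_ray.
exact: series_inv0.
Qed.

Lemma ray_series_zero I : ray_series witt_zero I = 1.
Proof.
apply/seriesP => m; rewrite /ray_series /euler_series /euler big1//= => d _.
apply/seriesP => k; rewrite series_addE series_oppE /monom /=.
by case: ifP; rewrite subr0.
Qed.

Fact witt_addA : associative witt_add.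
Proof. by move=> a b c; apply: ray_series_inj => I; rewrite !ray_series_add mulrA. Qed.
Fact witt_addC : commutative witt_add.
Proof. by move=> a b; apply: ray_series_inj => I; rewrite !ray_series_add mulrC. Qed.
Fact witt_add0 : left_id witt_zero witt_add.
Proof.
by move=> a; apply: ray_series_inj => I; rewrite ray_series_add ray_series_zero mul1r.
Qed.
Fact witt_addN : left_inverse witt_zero witt_opp witt_add.
Proof.
move=> a; apply: ray_series_inj => I.
by rewrite ray_series_add ray_series_opp ray_series_zero mulrC series_mulV// ray_series0.
Qed.

HB.instance Definition _ := Choice.copy (witt n B) (windex n -> B).
HB.instance Definition _ := GRing.isZmodule.Build (witt n B)
  witt_addA witt_addC witt_add0 witt_addN.

Lemma ghostE a I : ghost a I = unighost (a \o ray I) (wgcd I).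
Proof.
set g := wgcd I; have g0 : (0 < g)%N := wgcd_gt0 I.
pose r := [seq ((g %/ d)%N, ray I d) | d <- index_iota 1 g.+1 & (d %| g)%N].
rewrite /ghost (_ : [set p | _] = [set` r]).
  rewrite -fsbig_seq.
    rewrite big_map big_filter /unighost big_nat_cond [RHS]big_nat_cond.
    apply: eq_bigr => d /andP[/andP[d0 _] _] /=.
    by rewrite wgcd_ray.
  rewrite map_inj_in_uniq ?filter_uniq ?iota_uniq// => d e.
  rewrite !mem_filter !mem_index_iota => /andP[_ /andP[d0 _]] /andP[_ /andP[e0 _]].
  by move=> [_ /(congr1 (@wgcd n))]; rewrite !wgcd_ray.
apply/seteqP; split=> [[k J] /= [k0 JI]|[k J] /= /mapP[d]].
  have [JE gE] := ray_eq JI; have J0 := wgcd_gt0 J.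
  apply/mapP; exists (wgcd J).
    rewrite mem_filter mem_index_iota J0 ltnS /g gE dvdn_mulr//=.
    by rewrite leq_pmulr.
  by rewrite -JE /g gE mulKn.
rewrite mem_filter mem_index_iota => /andP[dg /andP[d0 _]] [-> ->].
split; first by rewrite divn_gt0// dvdn_leq.
apply/ffunP => i; rewrite ffun_natMn val_rayE// -mulnA [(d * _)%N]mulnC divnK//.
by rewrite divnK// big_gcd_dvd.
Qed.

Lemma ghostD a b I : ghost (a + b) I = ghost a I + ghost b I.
Proof. by rewrite !ghostE; apply: unighostD; exact: ray_series_add. Qed.

End Witt.

Section WittMap.
Variables (n : nat) (B C : comPzRingType) (h : {rmorphism B -> C}).

Definition series_map (f : series nat B) : series nat C := fun m => h (f m).

Lemma series_mapM f g : series_map (f * g) = series_map f * series_map g.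
Proof.
apply/seriesP => m; rewrite /series_map !series_mulE rmorph_sum.
by apply: eq_bigr => p _; rewrite rmorphM.
Qed.

Lemma euler_map (a : nat -> B) N : series_map (euler a N) = euler (h \o a) N.
Proof.
elim: N => [|N IH].
  rewrite /euler !big_geq//; apply/seriesP => m.
  by rewrite /series_map !series_1E; case: ifP; rewrite ?rmorph1 ?rmorph0.
rewrite !eulerS series_mapM IH; congr (_ * _); apply/seriesP => m.
rewrite /series_map !series_addE !series_oppE !series_1E rmorphB /monom.
by do 2!case: ifP; rewrite ?rmorph1 ?rmorph0.
Qed.

Lemma witt_addM (a b : witt n B) : h \o (a + b) = (h \o a : witt n C) + (h \o b).
Proof.
have hE (c : witt n B) I : ray_series (h \o c) I = series_map (ray_series c I).
  by apply/seriesP => m; rewrite /ray_series /euler_series -[h \o c \o _]/(h \o (c \o _)) -euler_map.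
apply: ray_series_inj => I.
by rewrite ray_series_add !hE -series_mapM -ray_series_add.
Qed.
End WittMap.

Section Filtration.
Variables (n : nat) (B : comPzRingType).
Variables (a b : witt n B) (afin : cofinitely_null a) (bfin : cofinitely_null b).

Definition isize (J : windex n) : nat := \sum_(i < n) val J i.
Definition mweight (m : monomial (windex n)) : nat :=
  \sum_(J <- EnumMset.f m) isize J.

Lemma mweight0 : mweight 0 = 0%N.
Proof. by rewrite /mweight enum_mset0 big_nil. Qed.
Lemma mweight1 J : mweight ([mset J]%mset : monomial (windex n)) = isize J.
Proof. by rewrite /mweight enum_msetn big_seq1. Qed.
Lemma mweightD m k : mweight (m + k) = (mweight m + mweight k)%N.
Proof.
rewrite /mweight -big_cat; apply: perm_big.
by apply/allP => i _ /=; rewrite count_cat !count_mem_mset msetE2.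
Qed.

Lemma isize_gt0 J : (0 < isize J)%N.
Proof.
rewrite lt0n; apply: contra_neq (valP J) => J0; apply/ffunP => i; rewrite ffunE.
by apply/eqP; move/eqP: J0; rewrite sum_nat_eq0 => /forallP/(_ i).
Qed.

Inductive fil : nat -> B -> Prop :=
| fil_zero k : fil k 0
| fil_add k c d : fil k c -> fil k d -> fil k (c + d)
| fil_gen k c m m' : (k <= mweight m + mweight m')%N ->
    fil k (c * (mon_eval a m * mon_eval b m')).

Lemma filT c : fil 0 c.
Proof.
by have := @fil_gen 0 c 0 0 (leq0n _); rewrite !mon_eval0 !mulr1.
Qed.

Lemma filM j k c d : fil j c -> fil k d -> fil (j + k) (c * d).
Proof.
move=> cj; elim: cj k d => {j c} [j|j c c' _ IH _ IH'|j c m m' jm] k d dk.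
- by rewrite mul0r; exact: fil_zero.
- by rewrite mulrDl; apply: fil_add; [exact: IH|exact: IH'].
elim: dk => {k d} [k|k d d' _ IH _ IH'|k d r r' kr].
- by rewrite mulr0; exact: fil_zero.
- by rewrite mulrDr; exact: fil_add.
have -> : c * (mon_eval a m * mon_eval b m') * (d * (mon_eval a r * mon_eval b r')) =
  (c * d) * (mon_eval a (m + r) * mon_eval b (m' + r')).
  by rewrite !mon_evalD; ring.
by apply: fil_gen; rewrite !mweightD addnACA leq_add.
Qed.

Lemma filN k c : fil k c -> fil k (- c).
Proof. by move=> ck; rewrite -mulN1r; exact: (filM (filT (-1)) ck). Qed.

Lemma fil_sum k (I : Type) (s : seq I) (P : pred I) (F : I -> B) :
  (forall i, P i -> fil k (F i)) -> fil k (\sum_(i <- s | P i) F i).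
Proof.
move=> FP; elim/big_rec: _ => [|i x Pi IH]; first exact: fil_zero.
by apply: fil_add => //; exact: FP.
Qed.

Lemma cofinitely_null_bound (x : windex n -> B) : cofinitely_null x ->
  exists K, forall m, (K <= mweight m)%N -> mon_eval x m = 0.
Proof.
move=> xfin; exists (\sum_(m <- fset_set [set m | mon_eval x m != 0%R]) mweight m).+1.
move=> m mK; apply/eqP; apply: contraTT mK => xm; rewrite -leqNgt.
by rewrite (bigD1_seq m) ?fset_uniq ?leq_addr//= in_fset_set//; exact/mem_set.
Qed.

Lemma fil_bound : exists K, forall k c, (K <= k)%N -> fil k c -> c = 0.
Proof.
have [Ka KaE] := cofinitely_null_bound afin.
have [Kb KbE] := cofinitely_null_bound bfin.
exists (Ka + Kb)%N => k c kK fc.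
elim: fc kK => {k c} [//|k c d _ IH _ IH' kK|k c m m' + kK].
  by rewrite IH// IH'// addr0.
move=> /(leq_trans kK) mm'; have [/KaE ->|ma] := leqP Ka (mweight m).
  by rewrite mul0r mulr0.
rewrite KbE ?mulr0//; rewrite leqNgt; apply: contraTN mm' => mb.
by rewrite -ltnNge -addnS leq_add// ltnW.
Qed.

Lemma finite_isize K : finite_set [set J : windex n | (isize J < K)%N].
Proof.
pose F (f : {ffun 'I_n -> 'I_K}) : {ffun 'I_n -> nat} := [ffun i => f i : nat].
have fin : finite_set (F @` [set: {ffun 'I_n -> 'I_K}]) by exact: finite_image.
rewrite -(eq_finite_set (inj_card_eq (in2W val_inj))).
apply: sub_finite_set fin => _ [J /= JK <-].
have JiK i : (val J i < K)%N.
  by apply: leq_ltn_trans JK; rewrite /isize (bigD1 i)//= leq_addr.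
by exists [ffun i => Ordinal (JiK i)] => //; apply/ffunP => i; rewrite !ffunE.
Qed.

Lemma finite_mweight K : finite_set [set m | (mweight m < K)%N].
Proof.
elim: K => [|K IH].
  by apply: (@sub_finite_set _ _ set0).
pose P := [set ([mset J]%mset : monomial (windex n)) + m |
  J in [set J : windex n | (isize J < K.+1)%N] & m in [set m | (mweight m < K)%N]].
apply: (@sub_finite_set _ _ ([set 0] `|` P)); last first.
  by rewrite finite_setU; split=> //; apply: finite_image2 => //; exact: finite_isize.
move=> m /=; elim/(@monomial_ind (windex n)): m => [|J m _]; first by left.
rewrite mweightD mweight1 => Jm; right; exists J => /=.
  by apply: leq_ltn_trans Jm; rewrite leq_addr.
exists m => //=; rewrite -ltnS; apply: leq_trans Jm.
by rewrite ltnS -add1n leq_add2r isize_gt0.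
Qed.

Lemma null_of_fil (c : witt n B) : (forall J, fil (isize J) (c J)) ->
  cofinitely_null c.
Proof.
move=> cJ; have [K KE] := fil_bound.
apply: sub_finite_set (finite_mweight K) => m /=.
rewrite ltnNge; apply: contraNN => Km; apply/eqP; apply: KE Km _.
elim/(@monomial_ind (windex n)): m => [|J m IH].
  by rewrite mweight0; exact: filT.
by rewrite mweightD mweight1 mon_evalD mon_eval1; exact: filM.
Qed.

Variable w : nat.
Definition fseries (f : series nat B) := forall m, fil (m * w) (f m).

Lemma fseriesM f g : fseries f -> fseries g -> fseries (f * g).
Proof.
move=> ff fg m; rewrite series_mulE big_seq; apply: fil_sum => p.
by rewrite mem_decomp => /eqP <-; rewrite mulnDl; exact: filM.
Qed.

Lemma fseries1 : fseries 1.
Proof.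
move=> m; rewrite series_1E; case: eqVneq => [->|_]; last exact: fil_zero.
by rewrite mul0n; exact: filT.
Qed.

Lemma fseriesB f g : fseries f -> fseries g -> fseries (f - g).
Proof.
move=> ff fg m; rewrite series_addE series_oppE.
by apply: fil_add => //; exact: filN.
Qed.

Lemma fseries_monom c d : fil (d * w) c -> fseries (monom c d).
Proof.
by move=> cd m; rewrite /monom; case: eqVneq => [->//|_]; exact: fil_zero.
Qed.

Lemma fseries_euler (c : nat -> B) N :
  (forall d, (0 < d <= N)%N -> fil (d * w) (c d)) -> fseries (euler c N).
Proof.
elim: N => [_|N IH cN]; first by rewrite /euler big_geq//; exact: fseries1.
rewrite eulerS; apply: fseriesM.
  by apply: IH => d /andP[d0 dN]; apply: cN; rewrite d0 leqW.
by apply: (fseriesB fseries1); apply: fseries_monom; apply: cN; rewrite ltnSn.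
Qed.

Lemma fseries_euler_series (c : nat -> B) :
  (forall d, (0 < d)%N -> fil (d * w) (c d)) -> fseries (euler_series c).
Proof.
by move=> cw m; apply: fseries_euler => d /andP[d0 _]; exact: cw.
Qed.

Lemma fseries_euler_inv f : fseries f ->
  forall d, (0 < d)%N -> fil (d * w) (euler_inv f d).
Proof.
move=> ff; elim/ltn_ind => -[//|d] IH _; rewrite euler_invS.
apply: fil_add; last exact: filN.
by apply: fseries_euler => e /andP[e0 ed]; exact: IH.
Qed.

Lemma fseries_inv f : fseries f -> fseries (series_inv f).
Proof.
move=> ff m; rewrite /series_inv series_sumE; apply: fil_sum => k _.
have fk : fseries ((1 - f) ^+ k).
  elim: (k : nat) => [|j IH]; first by rewrite expr0; exact: fseries1.
  by rewrite exprS; apply: fseriesM => //; exact: (fseriesB fseries1).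
exact: fk.
Qed.
End Filtration.

Section CofinitelyNull.
Variables (n : nat) (B : comPzRingType).
Implicit Types a b : witt n B.

Definition unit_size (I : windex n) : nat :=
  (\sum_(i < n) val I i %/ wgcd I)%N.

Lemma isize_ray (I : windex n) d : (0 < d)%N -> isize (ray I d) = (d * unit_size I)%N.
Proof.
move=> d0; rewrite /isize /unit_size big_distrr/=; apply: eq_bigr => i _.
by rewrite val_rayE// mulnC.
Qed.

Lemma isize_unit (I : windex n) : isize I = (wgcd I * unit_size I)%N.
Proof. by rewrite -{1}(ray_wgcd I) isize_ray// wgcd_gt0. Qed.

Lemma fil_coordl a b J : fil a b (isize J) (a J).
Proof.
have := @fil_gen n B a b (isize J) 1 ([mset J]%mset : monomial (windex n)) 0.
by rewrite mweight1 mweight0 addn0 mon_eval1 mon_eval0 mul1r mulr1; apply.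
Qed.

Lemma fil_coordr a b J : fil a b (isize J) (b J).
Proof.
have := @fil_gen n B a b (isize J) 1 0 ([mset J]%mset : monomial (windex n)).
by rewrite mweight1 mweight0 add0n mon_eval1 mon_eval0 !mul1r; apply.
Qed.

Lemma cofinitely_nullD a b : cofinitely_null a -> cofinitely_null b ->
  cofinitely_null (a + b).
Proof.
move=> afin bfin; apply: (null_of_fil afin bfin) => J; rewrite isize_unit.
apply: fseries_euler_inv; last exact: wgcd_gt0.
apply: fseriesM; apply: fseries_euler_series => d d0; rewrite -isize_ray//=.
  exact: fil_coordl.
exact: fil_coordr.
Qed.

Lemma cofinitely_nullN a : cofinitely_null a -> cofinitely_null (- a).
Proof.
move=> afin; apply: (null_of_fil afin afin) => J; rewrite isize_unit.
apply: fseries_euler_inv; last exact: wgcd_gt0.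
apply: fseries_inv; apply: fseries_euler_series => d d0; rewrite -isize_ray//=.
exact: fil_coordl.
Qed.
End CofinitelyNull.

Section WittFormalGroup.
Variables (R : comPzRingType) (n : nat).

(* The group law on Spf R[[a_I]] for which witt_coord, taking a point to its    *)
(* coordinates, is a morphism to the group of Witt vectors (witt_coordD).       *)
Definition witt_points (B : algebra R) : Type :=
  Spf (power_series R (windex n)) B.

Section Points.
Variable B : algebra R.
Implicit Types u v : witt_points B.

Definition witt_coord u : witt n B := ps_coord u.

Definition witt_points_zero : witt_points B :=
  ps_eval (@null_cofinitely_null (windex n) B).
Definition witt_points_add u v : witt_points B :=
  ps_eval (cofinitely_nullD (coord_cofinitely_null u) (coord_cofinitely_null v)).
Definition witt_points_opp u : witt_points B :=
  ps_eval (cofinitely_nullN (coord_cofinitely_null u)).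

Lemma witt_coord_inj : injective witt_coord.
Proof. by move=> u v uv; apply: coord_inj => I; exact: (congr1 (@^~ I) uv). Qed.

Lemma witt_coord0 : witt_coord witt_points_zero = 0.
Proof. by apply/funext => I; rewrite /witt_coord /ps_coord ps_eval_var. Qed.
Lemma witt_coordD u v :
  witt_coord (witt_points_add u v) = witt_coord u + witt_coord v.
Proof. by apply/funext => I; rewrite /witt_coord {1}/ps_coord ps_eval_var. Qed.
Lemma witt_coordN u : witt_coord (witt_points_opp u) = - witt_coord u.
Proof. by apply/funext => I; rewrite /witt_coord {1}/ps_coord ps_eval_var. Qed.

Fact witt_points_addA : associative witt_points_add.
Proof. by move=> u v w; apply: witt_coord_inj; rewrite !witt_coordD addrA. Qed.
Fact witt_points_addC : commutative witt_points_add.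
Proof. by move=> u v; apply: witt_coord_inj; rewrite !witt_coordD addrC. Qed.
Fact witt_points_add0 : left_id witt_points_zero witt_points_add.
Proof. by move=> u; apply: witt_coord_inj; rewrite witt_coordD witt_coord0 add0r. Qed.
Fact witt_points_addN : left_inverse witt_points_zero witt_points_opp witt_points_add.
Proof.
by move=> u; apply: witt_coord_inj; rewrite witt_coordD witt_coordN witt_coord0 addNr.
Qed.

HB.instance Definition _ := gen_eqMixin (witt_points B).
HB.instance Definition _ := gen_choiceMixin (witt_points B).
HB.instance Definition _ := GRing.isZmodule.Build (witt_points B)
  witt_points_addA witt_points_addC witt_points_add0 witt_points_addN.

End Points.

Section PointsMap.
Variables (B C : algebra R) (f : alg_hom B C).

Definition witt_points_map : witt_points B -> witt_points C :=
  @fmap R (Spf (power_series R (windex n))) B C f.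

Lemma witt_coord_map u : witt_coord (witt_points_map u) = f \o witt_coord u.
Proof. by []. Qed.

Fact witt_points_map_nmod : nmod_morphism witt_points_map.
Proof.
split=> [|u v]; apply: witt_coord_inj; rewrite witt_coord_map.
  by rewrite !witt_coord0; apply/funext => I /=; rewrite rmorph0.
by rewrite !witt_coordD witt_addM.
Qed.

HB.instance Definition _ := GRing.isNmodMorphism.Build
  (witt_points B) (witt_points C) witt_points_map witt_points_map_nmod.

End PointsMap.

Definition witt_group_functor : group_functor R :=
  @GroupFunctor R (fun B => witt_points B : zmodType)
    (fun B C f => witt_points_map f : {additive witt_points B -> witt_points C})
    (@fmap_id R (Spf (power_series R (windex n))))
    (@fmap_comp R (Spf (power_series R (windex n)))).

Definition witt_formal_group : formal_group R :=
  @FormalGroup R witt_group_functor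
    (@Spf_sheaf R (power_series R (windex n)))
    (Spf_locally_affine (power_series_product R (windex n))).
End WittFormalGroup.

(* Main.v *)
Require Import Defs.
From mathcomp Require Import all_boot all_order all_algebra.
From HB Require Import structures.
From mathcomp Require Import finmap multiset ring boolp classical_sets functions.
From mathcomp Require Import cardinality topology generic_quotient perm.
From mathcomp.multinomials Require Import mpoly.
Import Defs.

(* A curve c : A^n -> G is extended along the curve omega : A^n -> W with ghost *)
(* components b |-> b^I.  Over a suitable extension B' of B a point u of W(B)   *)
(* becomes a signed sum of values of omega; the corresponding sum of values of  *)
(* c is a point of G(B') that has to be descended to G(B).  This rests on two   *)
(* properties of a formal group, checked on affine charts: it turns injective   *)
(* ring morphisms into injective maps, and it preserves equalizers of rings.    *)
(* When n = 1, u is a polynomial with nilpotent non-constant coefficients, B'   *)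
(* splits it as the product of the 1 - x_i t, and the sum of the c(x_i) is      *)
(* symmetric in the x_i, hence descends by the fundamental theorem of symmetric *)
(* polynomials.                                                                 *)
(* Over Q, u is a finite family of nilpotent ghost components w_I, and W is the *)
(* direct sum of the additive groups of these components.  The iterated finite  *)
(* differences of c along square-zero elements depend only on the product of    *)
(* these elements, which gives a map from square-zero elements to G for each I; *)
(* B' writes w_I as a sum of square-zero elements, whose elementary symmetric   *)
(* functions are w_I^k / k!, so that the symmetric argument applies again.      *)

Set Implicit Arguments.
Unset Strict Implicit.
Unset Printing Implicit Defensive.

Import GRing.Theory.
Local Open Scope ring_scope.

(** * Quotients and localizations of commutative rings *)

(** The isomorphism is restriction along the curve [Omega]: a morphism u out of W goes to u composed
    with [Omega] ([curve_of]). [representable_criterion] reduces bijectivity to two facts. First,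
    over some injective extension of the base ring every point of W is a signed sum of values of
    [Omega] ([witt_span1], [witt_span_rational]); as G sends injections to injections
    ([formal_group_inj]), a morphism is determined by its curve. Second, every curve c extends to a
    morphism ([curve_extension1], [curve_extension_rational]).

    For the second fact, a decomposition of a point in terms of [Omega] is copied with c in place of
    [Omega]. By [curve_extension] it remains to see that the result depends only on the point and
    comes from the original ring. The universal expression lives over a truncated polynomial ring T
    and is equalized by suitable pairs of endomorphisms of T. Since G preserves equalizers of rings
    ([formal_group_equalizer]), the expression is already defined over the equalizer, and it
    suffices to map the equalizer to the original ring ([formal_group_descent]).

    In [symmetric_extension] the endomorphisms permute the variables, and the equalizer consists of
    polynomials in the elementary symmetric functions. This settles n = 1, where the point of W is
    the product of the 1 - x_i t. In [difference_descent] they kill variables, and the equalizer is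
    generated by the product of all variables. Over Q this defines [lambda] on square-zero elements,
    separately for each ghost index I. Each nilpotent ghost component is a sum of square-zero
    elements over an extension ([split_sum]), and [lambda_sum] applies [symmetric_extension] to that
    sum. The contributions of the finitely many nonzero ghost components are then added. *)

Section QuotientRing.
Local Open Scope quotient_scope.
Variables (A : comPzRingType) (I : A -> Prop).
Hypotheses (I0 : I 0) (ID : forall x y, I x -> I y -> I (x + y))
  (IM : forall a x, I x -> I (a * x)).

Let IN x : I x -> I (- x).
Proof. by rewrite -mulN1r; exact: IM. Qed.

Definition ideal_equiv (x y : A) : bool := `[< I (x - y) >].

Fact ideal_equiv_refl : reflexive ideal_equiv.
Proof. by move=> x; apply/asboolP; rewrite subrr. Qed.
Fact ideal_equiv_sym : ssrbool.symmetric ideal_equiv.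
Proof. by move=> x y; apply/asboolP/asboolP => /IN; rewrite opprB. Qed.
Fact ideal_equiv_trans : transitive ideal_equiv.
Proof.
move=> y x z /asboolP xy /asboolP yz; apply/asboolP.
by have := ID xy yz; rewrite addrA subrK.
Qed.

Canonical ideal_equiv_rel := EquivRel ideal_equiv
  ideal_equiv_refl ideal_equiv_sym ideal_equiv_trans.

Definition ideal_quotient := {eq_quot ideal_equiv_rel}.
HB.instance Definition _ := Choice.on ideal_quotient.

Let p (x : A) : ideal_quotient := \pi_ideal_quotient x.
Let r (x : ideal_quotient) : A := repr x.
Let rK x : p (r x) = x. Proof. exact: reprK. Qed.
Let pE x y : p x = p y <-> I (x - y).
Proof.
split=> [/eqmodP/asboolP//|xy]; apply/eqmodP; exact/asboolP.
Qed.
Let prE x : I (r (p x) - x). Proof. by apply/pE; rewrite rK. Qed.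

Let add x y := p (r x + r y).
Let opp x := p (- r x).
Let mul x y := p (r x * r y).

Let addE x y : add (p x) (p y) = p (x + y).
Proof. by apply/pE; rewrite opprD addrACA; apply: ID; exact: prE. Qed.
Let oppE x : opp (p x) = p (- x).
Proof. by apply/pE; rewrite -opprD; apply: IN; exact: prE. Qed.
Let mulE x y : mul (p x) (p y) = p (x * y).
Proof.
apply/pE.
have -> : r (p x) * r (p y) - x * y = r (p x) * (r (p y) - y) + y * (r (p x) - x) by ring.
by apply: ID; apply: IM; exact: prE.
Qed.

Fact ideal_quotient_addA : associative add.
Proof. by move=> x y z; rewrite -(rK x) -(rK y) -(rK z) !addE addrA. Qed.
Fact ideal_quotient_addC : commutative add.
Proof. by move=> x y; rewrite -(rK x) -(rK y) !addE addrC. Qed.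
Fact ideal_quotient_add0 : left_id (p 0) add.
Proof. by move=> x; rewrite -(rK x) addE add0r. Qed.
Fact ideal_quotient_addN : left_inverse (p 0) opp add.
Proof. by move=> x; rewrite -(rK x) oppE addE addNr. Qed.
HB.instance Definition _ := GRing.isZmodule.Build ideal_quotient
  ideal_quotient_addA ideal_quotient_addC ideal_quotient_add0 ideal_quotient_addN.
Fact ideal_quotient_mulA : associative mul.
Proof. by move=> x y z; rewrite -(rK x) -(rK y) -(rK z) !mulE mulrA. Qed.
Fact ideal_quotient_mulC : commutative mul.
Proof. by move=> x y; rewrite -(rK x) -(rK y) !mulE mulrC. Qed.
Fact ideal_quotient_mul1 : left_id (p 1) mul.
Proof. by move=> x; rewrite -(rK x) mulE mul1r. Qed.
Fact ideal_quotient_mulDl : left_distributive mul add.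
Proof.
by move=> x y z; rewrite -(rK x) -(rK y) -(rK z) !(mulE, addE) mulrDl.
Qed.
HB.instance Definition _ := GRing.Zmodule_isComPzRing.Build ideal_quotient
  ideal_quotient_mulA ideal_quotient_mulC ideal_quotient_mul1 ideal_quotient_mulDl.

Fact ideal_pi_additive : zmod_morphism p.
Proof.
by move=> x y; rewrite -addE -oppE.
Qed.
Fact ideal_pi_multiplicative : monoid_morphism p.
Proof. by split=> // x y; rewrite -mulE. Qed.

Lemma quotient_ring : exists (Q : comPzRingType) (q : {rmorphism A -> Q}),
  (forall y, exists x, q x = y) /\ forall x, q x = 0 <-> I x.
Proof.
pose mB := GRing.isZmodMorphism.Build A ideal_quotient p ideal_pi_additive.
pose mM := GRing.isMonoidMorphism.Build A ideal_quotient p ideal_pi_multiplicative.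
pose q : {rmorphism A -> ideal_quotient} := HB.pack p mB mM.
exists ideal_quotient, q; split=> [y|x]; first by exists (r y); exact: rK.
by rewrite -{2}[x]subr0; exact: pE.
Qed.
End QuotientRing.

Definition mk_rmorphism (A B : pzRingType) (f : A -> B)
    (fB : zmod_morphism f) (fM : monoid_morphism f) : {rmorphism A -> B} :=
  HB.pack f (GRing.isZmodMorphism.Build A B f fB)
    (GRing.isMonoidMorphism.Build A B f fM).

Lemma quotient_lift (A Q B : comPzRingType) (q : {rmorphism A -> Q})
    (f : {rmorphism A -> B}) :
  (forall y, exists x, q x = y) -> (forall x, q x = 0 -> f x = 0) ->
  exists g : {rmorphism Q -> B}, forall x, g (q x) = f x.
Proof.
move=> /choice[s sK] qf.
have E x y : q x = q y -> f x = f y.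
  move=> xy; apply/eqP; rewrite -subr_eq0 -rmorphB; apply/eqP/qf.
  by rewrite rmorphB xy subrr.
have gB : zmod_morphism (f \o s).
  by move=> x y /=; rewrite -rmorphB; apply: E; rewrite rmorphB !sK.
have gM : monoid_morphism (f \o s).
  split=> [|x y] /=; first by rewrite -(rmorph1 f); apply: E; rewrite rmorph1 sK.
  by rewrite -rmorphM; apply: E; rewrite rmorphM !sK.
by exists (mk_rmorphism gB gM) => x; apply: E; rewrite sK.
Qed.

(** Polynomials are formed over a [comNzRingType], whereas the zero ring does occur here as a
    localization; it is split off as a case in which all elements are equal. *)
Lemma nz_case (P : comPzRingType -> Prop) :
  (forall B : comNzRingType, P B) ->
  (forall B : comPzRingType, (forall x y : B, x = y) -> P B) -> forall B, P B.
Proof.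
move=> Pnz Pz B; have [B10|B10] := eqVneq (1 : B) 0.
  by apply: Pz => x y; rewrite -[x]mul1r -[y]mul1r B10 !mul0r.
case: B B10 => T c B10; pose B : comPzRingType := GRing.ComPzRing.Pack c.
exact: (Pnz (HB.pack T c (GRing.PzSemiRing_isNonZero.Build B B10))).
Qed.

Lemma principal_quotient (A : comPzRingType) (g : A) :
  exists (Q : comPzRingType) (q : {rmorphism A -> Q}),
  (forall y, exists x, q x = y) /\ forall x, q x = 0 <-> exists h, x = g * h.
Proof.
apply: (@quotient_ring A (fun x => exists h, x = g * h)).
- by exists 0; rewrite mulr0.
- by move=> _ _ [h ->] [k ->]; exists (h + k); rewrite mulrDr.
- by move=> a _ [h ->]; exists (a * h); rewrite mulrCA.
Qed.

(* B[1/g] is built as B[x]/(g x - 1). *)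
Lemma localization_exists (B : comPzRingType) (g : B) :
  exists (C : comPzRingType) (l : {rmorphism B -> C}), is_localization g l.
Proof.
elim/nz_case: B g => [B g|B B0 g]; last first.
  exists B, idfun; split=> [|c|b _]; first by exists 1; exact: B0.
    by exists c, 0%N; exact: B0.
  by exists 0%N; exact: B0.
have [Q [q [qs q0]]] := principal_quotient (g%:P * 'X - 1 : {poly B}).
pose l : {rmorphism B -> Q} := q \o polyC.
have lx : q g%:P * q 'X = 1.
  apply/eqP; rewrite -subr_eq0; apply/eqP; rewrite -rmorphM -(rmorph1 q) -rmorphB.
  by apply/q0; exists 1; rewrite mulr1.
exists Q, l; split=> [|c|b /q0[h bh]].
- by exists (q 'X).
- have [p <-] := qs c; elim/poly_ind: p => [|p a [b [k bk]]].
    by exists 0, 0%N; rewrite !rmorph0 mul0r.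
  exists (b + a * g ^+ k.+1), k.+1.
  rewrite !rmorphD !rmorphM rmorphXn -bk exprSr /=.
  rewrite mulrDl; congr (_ + _).
  transitivity (q p * q g%:P ^+ k * (q g%:P * q 'X)); first by ring.
  by rewrite lx mulr1.
(* Solving for h gives the geometric series with coefficients -(g^i b). Since h is a polynomial, g^i
   b vanishes for i = [size h]. *)
have {}bh : b%:P = g%:P * ('X * h) - h by rewrite bh mulrBl mul1r mulrA.
have hE i : h`_i = - (g ^+ i * b).
  have := congr1 (fun p : {poly B} => p`_i) bh.
  rewrite coefB coefC coefCM coefXM; elim: i => [|i IH] /=.
    by rewrite mulr0 sub0r expr0 mul1r => ->; rewrite opprK.
  have := congr1 (fun p : {poly B} => p`_i) bh.
  rewrite coefB coefC coefCM coefXM => /IH ->; rewrite exprS mulrN mulrA.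
  by move=> /esym/eqP; rewrite subr_eq0 => /eqP <-.
exists (size h); apply/eqP; rewrite -oppr_eq0 -hE nth_default//.
Qed.

Section LocalizationLift.
Variables (B C : comPzRingType) (g : B) (l : {rmorphism B -> C}).
Hypothesis lg : is_localization g l.

Lemma localization_cancel c k : c * l g ^+ k = 0 -> c = 0.
Proof.
have [[u u1] _ _] := lg => c0.
by rewrite -[c]mulr1 -(expr1n _ k) -u1 exprMn mulrA c0 mul0r.
Qed.

Lemma localization_ext (D : comPzRingType) (F F' : {rmorphism C -> D}) :
  (forall b, F (l b) = F' (l b)) -> forall c, F c = F' c.
Proof.
have [[u u1] lf _] := lg => FF c; have [b [k cb]] := lf c.
have -> : c = l b * u ^+ k by rewrite -cb -mulrA -exprMn u1 expr1n mulr1.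
rewrite !rmorphM FF !rmorphXn; congr (_ * _ ^+ _).
rewrite -[LHS]mulr1 -(rmorph1 F') -u1 rmorphM mulrA -FF -rmorphM.
by rewrite [u * _]mulrC u1 rmorph1 mul1r.
Qed.

Lemma localization_lift (D : comPzRingType) (f : {rmorphism B -> D}) :
  (exists v, f g * v = 1) ->
  exists F : {rmorphism C -> D}, forall b, F (l b) = f b.
Proof.
have [_ lf lz] := lg; move=> [v v1].
have [b /choice[k bk]] := choice lf.
pose F c := f (b c) * v ^+ k c.
(* [F] was defined through a chosen fraction; any other fraction representing c gives the same
   value. *)
have FE c a j : c * l g ^+ j = l a -> F c = f a * v ^+ j.
  move=> ca; have : l (b c * g ^+ j - a * g ^+ k c) = 0.
    by rewrite rmorphB !rmorphM -bk -ca !rmorphXn; ring.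
  move=> /lz[m /(congr1 f)]; rewrite rmorph0 rmorphM rmorphXn => E.
  have {}E : f (b c * g ^+ j - a * g ^+ k c) = 0.
    rewrite -[LHS]mul1r -(expr1n _ m) -v1 exprMn.
    by rewrite mulrAC E mul0r.
  move: E; rewrite rmorphB => /eqP; rewrite subr_eq0 !rmorphM !rmorphXn => /eqP E.
  have vj i : f g ^+ i * v ^+ i = 1 by rewrite -exprMn v1 expr1n.
  transitivity (f (b c) * f g ^+ j * (v ^+ j * v ^+ k c)).
    by rewrite /F -[f (b c) in LHS]mulr1 -(vj j); ring.
  rewrite E; transitivity (f a * v ^+ j * (f g ^+ k c * v ^+ k c)); first by ring.
  by rewrite vj mulr1.
have FB : zmod_morphism F.
  move=> x y; rewrite (@FE _ (b x * g ^+ k y - b y * g ^+ k x) (k x + k y)%N).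
    rewrite rmorphB !rmorphM !rmorphXn exprD /F.
    have vj i : f g ^+ i * v ^+ i = 1 by rewrite -exprMn v1 expr1n.
    transitivity (f (b x) * v ^+ k x * (f g ^+ k y * v ^+ k y) -
       f (b y) * v ^+ k y * (f g ^+ k x * v ^+ k x)); first by ring.
    by rewrite !vj !mulr1.
  by rewrite rmorphB !rmorphM -!bk !rmorphXn exprD; ring.
have FM : monoid_morphism F.
  split=> [|x y].
    by rewrite (@FE _ 1 0%N) ?rmorph1 ?mulr1.
  rewrite (@FE _ (b x * b y) (k x + k y)%N).
    by rewrite rmorphM exprD /F; ring.
  by rewrite rmorphM -!bk exprD; ring.
exists (mk_rmorphism FB FM) => a /=.
by rewrite (@FE _ a 0%N) ?mulr1.
Qed.
End LocalizationLift.

Section LocalizationExact.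
Variables (S T : comPzRingType) (i : {rmorphism S -> T}) (g : S).
Variables (S' T' : comPzRingType) (lS : {rmorphism S -> S'}).
Variables (lT : {rmorphism T -> T'}) (i' : {rmorphism S' -> T'}).
Hypotheses (lSg : is_localization g lS) (lTg : is_localization (i g) lT).
Hypothesis comm : forall s, i' (lS s) = lT (i s).

Lemma localization_inj : injective i -> injective i'.
Proof.
move=> inji; apply/raddf_inj => c c0.
have [[_ lf _] [_ _ lz]] := (lSg, lTg); have [b [k cb]] := lf c.
have : lT (i b) = 0 by rewrite -comm -cb rmorphM c0 mul0r.
move=> /lz[m]; rewrite -rmorphXn -rmorphM -(rmorph0 i) => /inji gb.
apply: (localization_cancel lSg (k := (k + m)%N)); rewrite exprD mulrA cb.
by rewrite -rmorphXn -rmorphM mulrC gb rmorph0.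
Qed.

(** Localization is exact, hence commutes with finite limits. Finiteness of [J] gives one power of g
    that kills all the differences u_j t - v_j t at once. *)
Lemma localization_equalizer (J : finType) (U U' : J -> comPzRingType)
    (u v : forall j, {rmorphism T -> U j})
    (lU : forall j, {rmorphism U j -> U' j})
    (u' v' : forall j, {rmorphism T' -> U' j}) :
  (forall j, u j (i g) = v j (i g)) ->
  (forall j, is_localization (u j (i g)) (lU j)) ->
  (forall j t, u' j (lT t) = lU j (u j t)) ->
  (forall j t, v' j (lT t) = lU j (v j t)) ->
  (forall t, (forall j, u j t = v j t) -> exists s, i s = t) ->
  forall c, (forall j, u' j c = v' j c) -> exists d, i' d = c.
Proof.
move=> uvg lUg uE vE eqT c cE.
have [[_ lf _] [[y y1] _ _]] := (lTg, lSg); have [t [k ct]] := lf c.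
have /choice[m mE] j : exists m, u j (i g) ^+ m * (u j t - v j t) = 0.
  have [_ _ lz] := lUg j; apply: lz; rewrite rmorphB -uE -vE -ct !rmorphM cE.
  by rewrite !rmorphXn uE vE uvg subrr.
pose M := (\sum_j m j)%N.
have [s sE] : exists s, i s = i g ^+ M * t.
  apply: eqT => j; apply/eqP; rewrite -subr_eq0 !rmorphM !rmorphXn -uvg -mulrBr.
  by rewrite /M (bigD1 j)//= addnC exprD -mulrA mE mulr0.
exists (lS s * y ^+ (M + k)); apply/eqP; rewrite -subr_eq0; apply/eqP.
apply: (localization_cancel lTg (k := (M + k)%N)).
rewrite mulrBl rmorphM comm sE rmorphXn -mulrA -exprMn -comm -rmorphM.
rewrite [y * _]mulrC y1 rmorph1 expr1n mulr1 comm rmorphM -ct exprD !rmorphXn.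
by ring.
Qed.
End LocalizationExact.

(** * Formal groups: injectivity, equalizers and descent *)

Section Localization.
Variables (B : comPzRingType) (g : B).

Definition loc_ring : comPzRingType := sval (cid (localization_exists g)).
Definition loc_map : {rmorphism B -> loc_ring} :=
  sval (cid (svalP (cid (localization_exists g)))).
Lemma loc_mapP : is_localization g loc_map.
Proof. exact: (svalP (cid (svalP (cid (localization_exists g))))). Qed.
End Localization.

Lemma localization_comp_lift (R' B : comPzRingType) (R : comPzRingType) (f : R)
    (h : {rmorphism R -> R'}) (u : {rmorphism R -> B}) : is_localization f h ->
  exists F : {rmorphism R' -> loc_ring (u f)},
    forall r, F (h r) = loc_map (u f) (u r).
Proof.
move=> hf.
apply: (localization_lift hf (f := loc_map (u f) \o u)).
by have [[v v1] _ _] := loc_mapP (u f); exists v.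
Qed.

Section LocalizedAlgebra.
Variables (R R' : comPzRingType) (h : {rmorphism R -> R'}) (f : R).
Hypothesis hf : is_localization f h.

Section Object.
Variable B : algebra R.
Let F := cid (localization_comp_lift (alg_map B) hf).

(** The base change of B along R -> R' = R[1/f], realized as B[1/f]. *)
Definition loc_alg : algebra R' := @Algebra R' (loc_ring (alg_map B f)) (sval F).

Fact loc_alg_map_subproof r :
  loc_map (alg_map B f) (alg_map B r) = alg_map (restrict_scalars h loc_alg) r.
Proof. by rewrite [RHS](svalP F). Qed.

Definition loc_alg_map : alg_hom B (restrict_scalars h loc_alg) :=
  @AlgHom R B (restrict_scalars h loc_alg) (loc_map (alg_map B f))
    loc_alg_map_subproof.

Lemma loc_alg_mapP : is_localization (alg_map B f) loc_alg_map.
Proof. exact: loc_mapP. Qed.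
End Object.

Lemma loc_alg_hom_exists (B C : algebra R) (j : alg_hom B C) :
  exists j' : alg_hom (loc_alg B) (loc_alg C),
    forall b, j' (loc_alg_map B b) = loc_alg_map C (j b).
Proof.
have [F FE] : exists F : {rmorphism loc_alg B -> loc_alg C},
    forall b, F (loc_alg_map B b) = loc_alg_map C (j b).
  apply: (localization_lift (loc_alg_mapP B) (f := loc_alg_map C \o j)).
  by have [[v v1] _ _] := loc_alg_mapP C; exists v; rewrite /= alg_funE.
suff FA r : F (alg_map (loc_alg B) r) = alg_map (loc_alg C) r.
  by exists (AlgHom FA).
apply: (localization_ext hf (F := F \o alg_map (loc_alg B))) => {}r /=.
have := alg_funE (loc_alg_map B) r; have := alg_funE (loc_alg_map C) r.
by move=> /= <- <-; rewrite FE alg_funE.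
Qed.

Definition loc_alg_hom B C j := sval (cid (@loc_alg_hom_exists B C j)).
Lemma loc_alg_homE B C (j : alg_hom B C) b :
  loc_alg_hom j (loc_alg_map B b) = loc_alg_map C (j b).
Proof. exact: (svalP (cid (loc_alg_hom_exists j))). Qed.

Lemma loc_alg_hom_inj B C (j : alg_hom B C) : injective j ->
  injective (loc_alg_hom j).
Proof.
apply: (localization_inj (loc_alg_mapP B) _ (loc_alg_homE j)).
by rewrite alg_funE; exact: loc_alg_mapP.
Qed.
End LocalizedAlgebra.

Section DoubleLocalization.
Variables (R : comPzRingType) (B : algebra R) (f g : R).

(** The ring B[1/(f g)] of the overlap of the charts over f and over g. *)
Definition loc2_alg : algebra R :=
  @Algebra R (loc_ring (alg_map B f * alg_map B g))
    (loc_map (alg_map B f * alg_map B g) \o alg_map B).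

Definition loc2_map : alg_hom B loc2_alg :=
  @AlgHom R B loc2_alg (loc_map (alg_map B f * alg_map B g)) (fun=> erefl).

Lemma loc2_mapP : is_localization (alg_map B f * alg_map B g) loc2_map.
Proof. exact: loc_mapP. Qed.

Lemma loc2_unit : exists v, loc2_map (alg_map B f * alg_map B g) * v = 1.
Proof. by have [] := loc2_mapP. Qed.

Lemma loc2_lift (e : R) (C : algebra R) (l : alg_hom B C) :
  is_localization (alg_map B e) l -> (exists v, loc2_map (alg_map B e) * v = 1) ->
  exists p : alg_hom C loc2_alg, forall b, p (l b) = loc2_map b.
Proof.
move=> le ue; have [p pE] := localization_lift le (f := loc2_map) ue.
suff pA r : p (alg_map C r) = alg_map loc2_alg r by exists (AlgHom pA).
by rewrite -(alg_funE l) pE alg_funE.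
Qed.

Variables (R1 R2 : comPzRingType) (h1 : {rmorphism R -> R1}).
Variables (h2 : {rmorphism R -> R2}).
Hypotheses (hf : is_localization f h1) (hg : is_localization g h2).

Lemma loc2_left_exists :
  exists p : alg_hom (restrict_scalars h1 (loc_alg hf B)) loc2_alg,
    forall b, p (loc_alg_map hf B b) = loc2_map b.
Proof.
apply: (loc2_lift (loc_alg_mapP hf B)); have [v v1] := loc2_unit.
by exists (loc2_map (alg_map B g) * v); rewrite mulrA -rmorphM.
Qed.
Lemma loc2_right_exists :
  exists p : alg_hom (restrict_scalars h2 (loc_alg hg B)) loc2_alg,
    forall b, p (loc_alg_map hg B b) = loc2_map b.
Proof.
apply: (loc2_lift (loc_alg_mapP hg B)); have [v v1] := loc2_unit.
exists (loc2_map (alg_map B f) * v).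
by rewrite mulrA -rmorphM [alg_map B g * _]mulrC.
Qed.
Definition loc2_left := sval (cid loc2_left_exists).
Definition loc2_right := sval (cid loc2_right_exists).
Lemma loc2_leftE b : loc2_left (loc_alg_map hf B b) = loc2_map b.
Proof. exact: (svalP (cid loc2_left_exists)). Qed.
Lemma loc2_rightE b : loc2_right (loc_alg_map hg B b) = loc2_map b.
Proof. exact: (svalP (cid loc2_right_exists)). Qed.
End DoubleLocalization.

Lemma loc2_hom_exists (R : comPzRingType) (B C : algebra R) (f g : R)
    (j : alg_hom B C) : injective j ->
  exists2 j2 : alg_hom (loc2_alg B f g) (loc2_alg C f g),
    injective j2 & forall b, j2 (loc2_map B f g b) = loc2_map C f g (j b).
Proof.
move=> jinj; have [F FE] := localization_lift (loc2_mapP B f g)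
  (f := loc2_map C f g \o j) (ltac:(rewrite /= rmorphM !alg_funE; exact: loc2_unit)).
have FA r : F (alg_map (loc2_alg B f g) r) = alg_map (loc2_alg C f g) r.
  by rewrite -(alg_funE (loc2_map B f g)) FE /= !alg_funE.
exists (AlgHom FA) => //.
apply: (localization_inj (loc2_mapP B f g) _ FE jinj).
by rewrite rmorphM !alg_funE; exact: loc2_mapP.
Qed.

(** The data whose existence [locally_affine] asserts over R[1/f], bundled as a type so that one
    chart can be chosen for every member of the cover. *)
Record chart (R : comPzRingType) (X : functor R) (f : R) := Chart {
  chart_ring : comPzRingType;
  chart_map : {rmorphism R -> chart_ring};
  chart_loc : is_localization f chart_map;
  chart_alg : top_algebra chart_ring;
  chart_iso : forall B : algebra chart_ring,
    X (restrict_scalars chart_map B) -> Spf chart_alg B;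
  chart_bij : forall B, bijective (@chart_iso B);
  chart_natural : forall (B C : algebra chart_ring) (u : alg_hom B C)
    (x : X (restrict_scalars chart_map B)),
    chart_iso (fmap (restrict_hom chart_map u) x) = fmap u (chart_iso x)
}.

Section Atlas.
Variables (R : comPzRingType) (G : formal_group R).
Variables (k : nat) (f : 'I_k -> R).
Hypothesis f1 : unit_family f.
Variable ch : forall i, chart (underlying G) (f i).

Definition piece (B : algebra R) (i : 'I_k) : algebra (chart_ring (ch i)) :=
  loc_alg (chart_loc (ch i)) B.
Definition piece_alg B i : algebra R :=
  restrict_scalars (chart_map (ch i)) (piece B i).
Definition piece_map B i : alg_hom B (piece_alg B i) :=
  loc_alg_map (chart_loc (ch i)) B.
Definition piece_hom B C (j : alg_hom B C) i : alg_hom (piece B i) (piece C i) :=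
  loc_alg_hom (chart_loc (ch i)) j.
Definition piece_alg_hom B C (j : alg_hom B C) i :
    alg_hom (piece_alg B i) (piece_alg C i) :=
  restrict_hom (chart_map (ch i)) (piece_hom j i).

Lemma gmap_eq (B C : algebra R) (u v : alg_hom B C) (x : G B) :
  u =1 v -> gmap G u x = gmap G v x.
Proof. by move=> /alg_hom_ext ->. Qed.

Lemma gmap_square (B C D E : algebra R) (u : alg_hom B C) (v : alg_hom C E)
    (u' : alg_hom B D) (v' : alg_hom D E) (x : G B) :
  (forall b, v (u b) = v' (u' b)) ->
  gmap G v (gmap G u x) = gmap G v' (gmap G u' x).
Proof. by move=> uv; rewrite -!gmap_comp; exact: gmap_eq. Qed.

Definition piece_point B i (x : G (piece_alg B i)) :
    spf_point (chart_alg (ch i)) (piece B i) :=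
  @chart_iso _ _ _ (ch i) (piece B i) x.

Lemma piece_hom_inj B C (j : alg_hom B C) i : injective j ->
  injective (piece_hom j i).
Proof. exact: loc_alg_hom_inj. Qed.

Lemma piece_point_inj B i : injective (@piece_point B i).
Proof. by move=> x y xy; have := bij_inj (@chart_bij _ _ _ (ch i) (piece B i)) xy. Qed.

Lemma piece_point_surj B i z : exists x, @piece_point B i x = z.
Proof.
by have [e eK Ke] := @chart_bij _ _ _ (ch i) (piece B i); exists (e z); exact: Ke.
Qed.

Lemma piece_point_natural B C (j : alg_hom B C) i (x : G (piece_alg B i)) a :
  piece_point (gmap G (piece_alg_hom j i) x) a = piece_hom j i (piece_point x a).
Proof.
exact: (congr1 (fun z : spf_point _ _ => z a) (chart_natural (piece_hom j i) x)).
Qed.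

Lemma piece_square B C (j : alg_hom B C) i (x : G B) :
  gmap G (piece_alg_hom j i) (gmap G (piece_map B i) x) =
  gmap G (piece_map C i) (gmap G j x).
Proof. by apply: gmap_square => b; exact: loc_alg_homE. Qed.

Let left B i j := @loc2_left R B (f i) (f j) _ _ (chart_loc (ch i)).
Let right B i j := @loc2_right R B (f i) (f j) _ _ (chart_loc (ch j)).

Lemma atlas_glue (B : algebra R) (x : forall i, G (piece_alg B i)) :
  (forall i j, gmap G (left B i j) (x i) = gmap G (right B i j) (x j)) ->
  exists! y : G B, forall i, gmap G (piece_map B i) y = x i.
Proof.
move=> xE; apply: (@fg_sheaf R G B k (fun i => alg_map B (f i)) (piece_alg B)
  (fun i j => loc2_alg B (f i) (f j)) (piece_map B) (left B) (right B)) => //.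
- have [c c1] := f1; exists (fun i => alg_map B (c i)).
  by rewrite -[RHS](rmorph1 (alg_map B)) -c1 rmorph_sum; apply: eq_bigr => i _; rewrite rmorphM.
- by move=> i; exact: loc_alg_mapP.
- move=> i j; have -> : left B i j \o piece_map B i = loc2_map B (f i) (f j).
    by apply/funext => b; exact: loc2_leftE.
  exact: loc2_mapP.
- by move=> i j b; rewrite [LHS]loc2_leftE [RHS]loc2_rightE.
Qed.

Lemma atlas_compat (B : algebra R) (y : G B) i j :
  gmap G (left B i j) (gmap G (piece_map B i) y) =
  gmap G (right B i j) (gmap G (piece_map B j) y).
Proof.
by apply: gmap_square => b; rewrite [LHS]loc2_leftE [RHS]loc2_rightE.
Qed.

Lemma atlas_separated (B : algebra R) (x y : G B) :
  (forall i, gmap G (piece_map B i) x = gmap G (piece_map B i) y) -> x = y.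
Proof.
move=> xy; have [z [_ zu]] := atlas_glue (atlas_compat x).
by rewrite -(zu x)// -(zu y)// => i; rewrite xy.
Qed.

(** In a chart a point is a ring morphism out of the chart algebra, and j acts by composition with a
    localization of j, which is again injective. *)
Lemma atlas_piece_inj (B C : algebra R) (j : alg_hom B C) i : injective j ->
  injective (gmap G (piece_alg_hom j i)).
Proof.
move=> jinj x y xy; apply/piece_point_inj/spf_point_ext => a.
apply: (piece_hom_inj (i := i) jinj).
by have := piece_point_natural j x a; rewrite xy piece_point_natural => ->.
Qed.

Lemma atlas_inj (B C : algebra R) (j : alg_hom B C) : injective j ->
  injective (gmap G j).
Proof.
move=> jinj x y xy; apply: atlas_separated => i.
by apply: (atlas_piece_inj (i := i) jinj); rewrite !piece_square xy.
Qed.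

(** In a chart, s is a ring morphism into a localization of T whose values are equalized by all
    localized pairs, so it factors through the localization of S. The factorization is continuous
    because that localization injects into the one of T. The local points are then glued. *)
Lemma atlas_equalizer (S T : algebra R) (i : alg_hom S T) (J : finType)
    (U : J -> algebra R) (u v : forall j, alg_hom T (U j)) (s : G T) :
  injective i ->
  (forall t, (forall j, u j t = v j t) -> exists r, i r = t) ->
  (forall j, gmap G (u j) s = gmap G (v j) s) -> exists y, gmap G i y = s.
Proof.
move=> iinj iE sE.
have loc a : exists x : G (piece_alg S a),
    gmap G (piece_alg_hom i a) x = gmap G (piece_map T a) s.
  pose s' := piece_point (gmap G (piece_map T a) s).
  have vE c : exists d, piece_hom i a d = s' c.
    apply: (@localization_equalizer S T i (alg_map S (f a)) _ _
      (piece_map S a) (piece_map T a) (piece_hom i a) (loc_alg_mapP _ S) _ _ J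
      U (fun j => piece (U j) a) u v (fun j => piece_map (U j) a)
      (fun j => piece_hom (u j) a) (fun j => piece_hom (v j) a)) => //.
    - by rewrite alg_funE; exact: loc_alg_mapP.
    - by move=> b; exact: loc_alg_homE.
    - by move=> j; rewrite !alg_funE.
    - by move=> j; rewrite !alg_funE; exact: loc_alg_mapP.
    - by move=> j t; exact: loc_alg_homE.
    - by move=> j t; exact: loc_alg_homE.
    move=> j.
    have E (w : alg_hom T (U j)) : piece_hom w a (s' c) =
        piece_point (gmap G (piece_map (U j) a) (gmap G w s)) c.
      by rewrite -piece_square piece_point_natural.
    by rewrite !E sE.
  have [z zE] := choice vE.
  have inj := piece_hom_inj (i := a) iinj.
  have zB : zmod_morphism z.
    by move=> b c; apply: inj; rewrite rmorphB [LHS]zE rmorphB -!zE.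
  have zM : monoid_morphism z.
    split; first by apply: inj; rewrite [LHS]zE !rmorph1.
    by move=> b c; apply: inj; rewrite rmorphM [LHS]zE rmorphM -!zE.
  pose Z := mk_rmorphism zB zM.
  have ZA r : Z (talg_map (chart_alg (ch a)) r) = alg_map (piece S a) r.
    by apply: inj; rewrite [LHS]zE spf_funE alg_funE.
  have Zc : continuous (Z : chart_alg (ch a) -> discrete_topology (piece S a)).
    apply/continuous_discreteP => b.
    apply: filterS ((continuous_discreteP _).1 (@spf_cont _ _ _ s') b) => c /= cb.
    by apply: inj; rewrite [LHS]zE [RHS]zE.
  have [x xE] := piece_point_surj (SpfPoint ZA Zc).
  exists x; apply/piece_point_inj/spf_point_ext => b.
  by rewrite piece_point_natural xE; exact: zE.
pose x a := sval (cid (loc a)).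
have xE a : gmap G (piece_alg_hom i a) (x a) = gmap G (piece_map T a) s.
  exact: (svalP (cid (loc a))).
have [|y [yE _]] := @atlas_glue S x.
  (* Agreement on an overlap is tested over T, into which the overlap ring of S injects; there the
     local points are restrictions of s. *)
  move=> a b; have [i2 i2inj i2E] := @loc2_hom_exists _ _ _ (f a) (f b) _ iinj.
  apply: (atlas_inj i2inj).
  have -> : gmap G i2 (gmap G (left S a b) (x a)) =
      gmap G (left T a b) (gmap G (piece_alg_hom i a) (x a)).
    apply: gmap_square; apply: (localization_ext (loc_alg_mapP (chart_loc (ch a)) S)
      (F := i2 \o left S a b) (F' := left T a b \o piece_alg_hom i a)) => r /=.
    by rewrite [left S a b _]loc2_leftE i2E [piece_hom i a _]loc_alg_homE loc2_leftE.
  have -> : gmap G i2 (gmap G (right S a b) (x b)) =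
      gmap G (right T a b) (gmap G (piece_alg_hom i b) (x b)).
    apply: gmap_square; apply: (localization_ext (loc_alg_mapP (chart_loc (ch b)) S)
      (F := i2 \o right S a b) (F' := right T a b \o piece_alg_hom i b)) => r /=.
    by rewrite [right S a b _]loc2_rightE i2E [piece_hom i b _]loc_alg_homE loc2_rightE.
  by rewrite !xE atlas_compat.
exists y; apply: atlas_separated => a.
by rewrite -piece_square yE xE.
Qed.
End Atlas.

Lemma formal_group_atlas (R : comPzRingType) (G : formal_group R) :
  exists (k : nat) (f : 'I_k -> R),
    unit_family f /\ inhabited (forall i, chart (underlying G) (f i)).
Proof.
have [k [f [f1 loc]]] := fg_local G; exists k, f; split=> //; constructor => i.
have c : exists c : chart (underlying G) (f i), True.
  have [R' [h [A [e [hf _ eb en]]]]] := loc i.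
  by exists (Chart hf eb en).
exact: sval (cid c).
Qed.

Section FormalGroup.
Variables (R : comPzRingType) (G : formal_group R).

Lemma formal_group_inj (B C : algebra R) (j : alg_hom B C) : injective j ->
  injective (gmap G j).
Proof.
by have [k [f [f1 [ch]]]] := formal_group_atlas G; exact: (atlas_inj f1 ch).
Qed.

Lemma formal_group_equalizer (S T : algebra R) (i : alg_hom S T) (J : finType)
    (U : J -> algebra R) (u v : forall j, alg_hom T (U j)) (s : G T) :
  injective i ->
  (forall t, (forall j, u j t = v j t) -> exists r, i r = t) ->
  (forall j, gmap G (u j) s = gmap G (v j) s) -> exists y, gmap G i y = s.
Proof.
by have [k [f [f1 [ch]]]] := formal_group_atlas G; exact: (atlas_equalizer f1 ch).
Qed.
End FormalGroup.

Section Subring.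
Variables (A : comPzRingType) (P : A -> Prop).
Hypotheses (P1 : P 1) (PB : forall x y, P x -> P y -> P (x - y))
  (PM : forall x y, P x -> P y -> P (x * y)).

Definition subring_pred : {pred A} := fun x => `[< P x >].
Fact subring_pred_closed : subring_closed subring_pred.
Proof.
split=> [|x y|x y]; first exact/asboolP.
- by move=> /asboolP px /asboolP py; apply/asboolP/PB.
- by move=> /asboolP px /asboolP py; apply/asboolP/PM.
Qed.
HB.instance Definition _ := GRing.isSubringClosed.Build A subring_pred
  subring_pred_closed.

Definition subring_of := {x : A | x \in subring_pred}.
HB.instance Definition _ := SubChoice.on subring_of.
HB.instance Definition _ :=
  GRing.SubChoice_isSubComPzRing.Build A subring_pred subring_of subring_pred_closed.

Lemma subring_exists : exists (S : comPzRingType) (i : {rmorphism S -> A}),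
  injective i /\ forall x, P x <-> exists s, i s = x.
Proof.
exists subring_of, (\val : {rmorphism subring_of -> A}); split; first exact: val_inj.
move=> x; split=> [/asboolP px|[s <-]]; first by exists (exist _ x px).
by have /asboolP := valP s.
Qed.
End Subring.

Lemma subalgebra_exists (R : comPzRingType) (A : algebra R) (P : A -> Prop) :
  (forall r, P (alg_map A r)) -> (forall x y, P x -> P y -> P (x - y)) ->
  (forall x y, P x -> P y -> P (x * y)) ->
  exists (S : algebra R) (i : alg_hom S A),
    injective i /\ forall x, P x <-> exists s, i s = x.
Proof.
move=> PR PB PM; have P1 : P 1 by rewrite -(rmorph1 (alg_map A)).
have [S [i [ii iP]]] := subring_exists P1 PB PM.
have /choice[m mE] r := (iP _).1 (PR r).
have mB : zmod_morphism m by move=> x y; apply: ii; rewrite rmorphB !mE rmorphB.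
have mM : monoid_morphism m.
  by split=> [|x y]; apply: ii; rewrite ?rmorph1 ?rmorphM !mE ?rmorph1 ?rmorphM.
by exists (Algebra (mk_rmorphism mB mM)), (@AlgHom R (Algebra (mk_rmorphism mB mM)) A i mE).
Qed.

(* The ring-theoretic equalizer S of the u a and v a maps to B, since its image *)
(* under c lies in the subring B of B'; the point s descends to S because G     *)
(* preserves the equalizer.                                                     *)
Lemma formal_group_descent (R : comPzRingType) (G : formal_group R)
    (T : algebra R) (J : finType) (U : J -> algebra R)
    (u v : forall a, alg_hom T (U a)) (s : G T) (B : algebra R)
    (K : forall C : algebra R, alg_hom B C -> alg_hom T C -> Prop)
    (B' : algebra R) (j : alg_hom B B') (c : alg_hom T B') :
  injective j -> K B' j c ->
  (forall a, gmap G (u a) s = gmap G (v a) s) ->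
  (forall t, (forall a, u a t = v a t) ->
    exists b, forall C h d, K C h d -> h b = d t) ->
  exists y : G B, forall C h d, K C h d -> gmap G h y = gmap G d s.
Proof.
move=> jinj Kj sE tE.
have [|||S [i [iinj iP]]] := @subalgebra_exists R T (fun t => forall a, u a t = v a t).
- by move=> r a; rewrite !alg_funE.
- by move=> x y xE yE a; rewrite !rmorphB xE yE.
- by move=> x y xE yE a; rewrite !rmorphM xE yE.
have [y0 y0E] := formal_group_equalizer iinj (fun t => (iP t).1) sE.
have tE' (r : S) : exists b, forall C h d, K C h d -> h b = d (i r).
  by apply: tE; apply/iP; exists r.
have [g gE] := choice tE'; have gj r : j (g r) = c (i r) by exact: gE.
have gB : zmod_morphism g by move=> x y; apply: jinj; rewrite rmorphB !gj !rmorphB.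
have gM : monoid_morphism g.
  by split=> [|x y]; apply: jinj; rewrite ?rmorph1 ?rmorphM !gj ?rmorph1 ?rmorphM.
have gA r : mk_rmorphism gB gM (alg_map S r) = alg_map B r.
  by apply: jinj; rewrite [LHS]gj !alg_funE.
exists (gmap G (AlgHom gA) y0) => C h d Khd; rewrite -y0E -!gmap_comp.
by apply: gmap_eq => r; exact: gE.
Qed.

(** * Nilpotent families and truncated polynomials *)

Definition is_nil (B : pzRingType) (x : B) := exists k, x ^+ k = 0.

Section Nilpotent.
Variable B : comPzRingType.
Implicit Types x y : B.

Lemma is_nil0 : is_nil (0 : B). Proof. by exists 1%N; rewrite expr1. Qed.

Lemma is_nilM x y : is_nil x -> is_nil (x * y).
Proof. by move=> [k xk]; exists k; rewrite exprMn xk mul0r. Qed.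

Lemma is_nilD x y : is_nil x -> is_nil y -> is_nil (x + y).
Proof.
move=> [i xi] [j yj]; exists (i + j)%N; rewrite exprDn big1// => k _.
have [jk|kj] := leqP j k.
  by rewrite -(subnKC jk) [y ^+ _]exprD yj mul0r mulr0 mul0rn.
by rewrite -addnBA ?(ltnW kj)// exprD xi !mul0r mul0rn.
Qed.

Lemma is_nil_sum (I : Type) (s : seq I) (P : pred I) (F : I -> B) :
  (forall i, P i -> is_nil (F i)) -> is_nil (\sum_(i <- s | P i) F i).
Proof.
by move=> FP; elim/big_ind: _ => // [|x y]; [exact: is_nil0|exact: is_nilD].
Qed.

Lemma is_nil_exp x k : is_nil (x ^+ k) -> is_nil x.
Proof. by move=> [j xj]; exists (k * j)%N; rewrite exprM. Qed.

Lemma is_nil_expS x k : is_nil x -> is_nil (x ^+ k.+1).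
Proof. by rewrite exprS; exact: is_nilM. Qed.
End Nilpotent.

Lemma is_nil_map (B C : pzRingType) (h : {rmorphism B -> C}) x :
  is_nil x -> is_nil (h x).
Proof. by move=> [k xk]; exists k; rewrite -rmorphXn xk rmorph0. Qed.

Section CofinitelyNullNilpotent.
Variables (I : choiceType) (B : comPzRingType).
Implicit Types x : I -> B.

Lemma mon_eval_msetn x i k : mon_eval x (msetn k i : monomial I) = x i ^+ k.
Proof. by rewrite /mon_eval enum_msetn big_nseq -Monoid.iteropE. Qed.

Lemma mon_eval_dvd x (m : monomial I) i k : (k <= m i)%N ->
  exists b, mon_eval x m = x i ^+ k * b.
Proof.
move=> km; exists (mon_eval x ((m : {mset I}%mset) `\` msetn k i)%mset).
rewrite -mon_eval_msetn -mon_evalD; congr mon_eval.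
apply/msetP => j; rewrite msetE2 /= msetE2 /= msetnE.
by case: eqVneq => [->|_]; rewrite ?add0n ?subn0// subnKC.
Qed.

(** The powers of x_i are values of monomials, and the exponent K below exceeds the exponent of i in
    every monomial with nonzero value. *)
Lemma cofinitely_null_is_nil x i : cofinitely_null x -> is_nil (x i).
Proof.
move=> xfin; pose S := fset_set [set m : monomial I | mon_eval x m != 0].
exists (\sum_(m <- S) (m : {mset I}%mset) i).+1; apply/eqP/negPn/negP => x0.
set K := (\sum_(m <- S) _).+1 in x0.
have KS : (msetn K i : monomial I) \in S.
  by rewrite in_fset_set//; apply/mem_set; rewrite /= mon_eval_msetn.
have : (K <= \sum_(m <- S) (m : {mset I}%mset) i)%N.
  by rewrite (bigD1_seq (msetn K i : monomial I)) ?fset_uniq//= msetnxx leq_addr.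
by rewrite ltnn.
Qed.

Lemma cofinitely_null_support x : cofinitely_null x ->
  exists F : seq I, forall i, i \notin F -> x i = 0.
Proof.
move=> xfin; pose S := fset_set [set m : monomial I | mon_eval x m != 0].
exists (flatten [seq (EnumMset.f m : seq I) | m <- S]) => i.
apply: contraNeq => xi; apply/flatten_mapP; exists (msetn 1 i : monomial I).
  by rewrite in_fset_set//; apply/mem_set; rewrite /= mon_eval_msetn expr1.
by rewrite enum_msetn mem_head.
Qed.

(** A monomial with nonzero value is supported in [F] and has every exponent below the uniform bound
    K; there are finitely many of these. *)
Lemma is_nil_cofinitely_null x (F : seq I) :
  (forall i, i \notin F -> x i = 0) -> (forall i, is_nil (x i)) ->
  cofinitely_null x.
Proof.
move=> xF /choice[k xk]; pose K := (\sum_(i <- F) k i).+1.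
pose m (e : {ffun 'I_(size F) -> 'I_K}) : monomial I :=
  seq_mset (flatten [seq nseq (e j) (tnth (in_tuple F) j) | j <- enum 'I_(size F)]).
apply: (@sub_finite_set _ _ (m @` setT)); last exact: finite_image.
move=> p /= px.
have pF i : i \in p -> i \in F.
  move=> ip; apply: contraNT px => /xF xi.
  have [b ->] := @mon_eval_dvd x p i 1 (ltac:(by rewrite mset_gt0)).
  by rewrite xi expr1 mul0r.
have pK i : (p i < K)%N.
  rewrite ltnNge; apply: contraNN px => Kp.
  have iF : i \in F by apply: pF; rewrite -mset_gt0; apply: leq_trans Kp.
  have ki : (k i <= p i)%N.
    apply: leq_trans Kp; rewrite /K; apply: leqW; elim: {+}F iF => // j s IH.
    rewrite inE big_cons => /predU1P[->|/IH]; first exact: leq_addr.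
    by move=> /leq_trans; apply; exact: leq_addl.
  by have [b ->] := mon_eval_dvd x ki; rewrite xk mul0r.
pose U := undup F.
(* [F] may contain repetitions: the whole exponent is placed at the first occurrence of an index,
   and 0 at the later ones. *)
pose e : {ffun 'I_(size F) -> 'I_K} := [ffun j =>
  if index (tnth (in_tuple F) j) F == j then Ordinal (pK (tnth (in_tuple F) j)) else ord0].
exists e => //; apply/msetP => i; rewrite mset_seqE count_flatten -map_comp sumnE big_map.
rewrite big_enum/=.
under eq_bigr do rewrite count_nseq /= ffunE.
have [iF|iF] := boolP (i \in F); last first.
  rewrite big1 => [|j _].
    by apply/esym/eqP; rewrite mset_eq0; apply: contraNN iF; exact: pF.
  have [E|_] := eqVneq (tnth (in_tuple F) j) i; last by rewrite mul0n.
  by case/negP: iF; rewrite -E; exact: mem_tnth.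
have iS : (index i F < size F)%N by rewrite index_mem.
have ti : tnth (in_tuple F) (Ordinal iS) = i.
  by rewrite (tnth_nth i) /= nth_index.
rewrite (bigD1 (Ordinal iS))//= ti !eqxx mul1n big1 ?addn0// => j ji.
have [E|_] := eqVneq (tnth (in_tuple F) j) i; last by rewrite mul0n.
rewrite mul1n E.
by case: eqP => // Ej; case/eqP: ji; apply/val_inj; rewrite /= Ej.
Qed.
End CofinitelyNullNilpotent.

Lemma cofinitely_null_ordP (B : comPzRingType) n (x : 'I_n -> B) :
  cofinitely_null x <-> forall i, is_nil (x i).
Proof.
split=> [xfin i|xn]; first exact: cofinitely_null_is_nil.
by apply: (is_nil_cofinitely_null (F := enum 'I_n)) => // i; rewrite mem_enum.
Qed.

Lemma mon_evalE (I : finType) (B : comPzRingType) (x : I -> B) (m : monomial I) :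
  mon_eval x m = \prod_i x i ^+ m i.
Proof.
elim/(@monomial_ind I): m => [|j m IH].
  by rewrite mon_eval0 big1// => i _; rewrite mset0E expr0.
rewrite mon_evalD mon_eval1 IH (bigD1 j)//= [RHS](bigD1 j)//= mset1DE eqxx.
rewrite exprS -mulrA; congr (_ * (_ * _)); apply: eq_bigr => i /negPf ij.
by rewrite mset1DE ij.
Qed.

Section TruncatedPolynomials.
Variables (R : comPzRingType) (N M' : nat).
Local Notation M := M'.+1.

Definition mexp (e : 'I_N -> nat) : monomial 'I_N :=
  seq_mset (flatten [seq nseq (e i) i | i <- enum 'I_N]).

Lemma mexpE e i : mexp e i = e i.
Proof.
rewrite mset_seqE count_flatten -map_comp sumnE big_map big_enum/=.
rewrite (bigD1 i)//= count_nseq /= eqxx mul1n big1 ?addn0// => j /negPf ji.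
by rewrite count_nseq /= ji.
Qed.

Lemma monom_mexp (e : 'I_N -> nat) :
  monom 1 (mexp e) = \prod_i ps_var R i ^+ e i :> power_series R 'I_N.
Proof.
have -> : monom 1 (mexp e) = mon_eval (ps_var R (I := 'I_N)) (mexp e)
    :> series (monomial 'I_N) R.
  elim/(@monomial_ind 'I_N): (mexp e) => [|i m IH]; first by rewrite mon_eval0.
  by rewrite mon_evalD mon_eval1 -IH [RHS]monomM mulr1.
by rewrite mon_evalE; apply: eq_bigr => i _; rewrite mexpE.
Qed.

(* T is R[X_1, ..., X_N] / (X_1^M, ..., X_N^M), with M = M'.+1. *)
Lemma truncated_polynomials :
  exists (T : algebra R) (X : 'I_N -> T) (coef : T -> {ffun 'I_N -> 'I_M} -> R),
  [/\ forall i, X i ^+ M = 0,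
      forall t, t = \sum_e alg_map T (coef t e) * \prod_i X i ^+ e i,
      forall (a : {ffun 'I_N -> 'I_M} -> R) e,
        coef (\sum_(e : {ffun 'I_N -> 'I_M}) alg_map T (a e) * \prod_i X i ^+ e i) e = a e
    & forall (B : algebra R) (x : 'I_N -> B), (forall i, x i ^+ M = 0) ->
        exists c : alg_hom T B, forall i, c (X i) = x i].
Proof.
pose A := power_series R 'I_N.
(* T is realized as a quotient of the power series ring: [J] consists of the series in which every
   occurring monomial has some exponent at least M. *)
pose J (s : A) := forall m : monomial 'I_N, (forall i, (m i < M)%N) -> s m = 0.
have [||s r Js m mM|Q [q [qs q0]]] := @quotient_ring A J.
- by [].
- by move=> s r Js Jr m mM; rewrite series_addE Js// Jr// addr0.
- rewrite series_mulE big_seq big1// => p; rewrite mem_decomp => /eqP pm.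
  rewrite Js ?mulr0// => i; apply: leq_ltn_trans (mM i).
  by rewrite -pm [leqRHS](_ : _ = p.1 i + p.2 i)%N ?leq_addl// msetE2.
pose T := @Algebra R Q (q \o talg_map A).
pose X i : T := q (ps_var R i).
have [sec secK] := choice qs.
have TE r : alg_map T r = q (talg_map A r).
  rewrite [LHS]/=; reflexivity.
pose coef (t : T) (e : {ffun 'I_N -> 'I_M}) : R := sec t (mexp (fun i => e i)).
pose G (a : {ffun 'I_N -> 'I_M} -> R) : A :=
  \sum_(e : {ffun 'I_N -> 'I_M}) talg_map A (a e) * monom 1 (mexp (fun i => e i)).
have GE a (e : {ffun 'I_N -> 'I_M}) : G a (mexp (fun i => e i)) = a e.
  rewrite /G series_sumE (bigD1 e)//= seriesCE /monom eqxx mulr1 big1 ?addr0//.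
  move=> e' /eqP ee'; rewrite seriesCE /monom; case: eqP; rewrite ?mulr0// => E.
  case: ee'; apply/ffunP => i; apply/val_inj.
  by have := congr1 (fun m : monomial 'I_N => m i) E; rewrite !mexpE.
have qG a : q (G a) = \sum_(e : {ffun 'I_N -> 'I_M}) alg_map T (a e) * \prod_i X i ^+ e i.
  rewrite /G (rmorph_sum q); apply: eq_bigr => e _; rewrite TE.
  rewrite (rmorphM q) monom_mexp (rmorph_prod q).
  by under [in LHS]eq_bigr do rewrite rmorphXn.
have secE a (e : {ffun 'I_N -> 'I_M}) : sec (q (G a)) (mexp (fun i => e i)) = a e.
  have : J (sec (q (G a)) - G a) by apply/q0; rewrite rmorphB secK subrr.
  move=> /(_ (mexp (fun i => e i))); rewrite series_addE series_oppE GE => E.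
  by apply/eqP; rewrite -subr_eq0 E// => i; rewrite mexpE.
exists T, X, coef; split=> [i|t|a e|B x xM].
- rewrite -rmorphXn; apply/q0 => m mM.
  have -> : ps_var R i ^+ M = monom 1 (mexp (fun j => if j == i then M else 0%N)) :> A.
    rewrite monom_mexp (bigD1 i)//= eqxx big1 ?mulr1// => j /negPf ->.
    by rewrite expr0.
  rewrite /monom; case: eqP => // mE; have := mM i.
  by rewrite mE mexpE eqxx ltnn.
- rewrite -qG; apply/eqP; rewrite -subr_eq0 -[t in t - _]secK -rmorphB; apply/eqP.
  apply/q0 => m mM; pose e : {ffun 'I_N -> 'I_M} := [ffun i => Ordinal (mM i)].
  have -> : m = mexp (fun i => e i) by apply/msetP => i; rewrite mexpE ffunE.
  by rewrite series_addE series_oppE GE subrr.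
- by rewrite -qG; exact: secE.
have xnull : cofinitely_null x.
  by apply/cofinitely_null_ordP => i; exists M; exact: xM.
(* Evaluation at x kills [J], since a monomial with an exponent at least M takes the value 0. *)
have [|F FE] := @quotient_lift A Q B q (spf_fun (ps_eval xnull)) qs.
  move=> s /q0 Js; rewrite (_ : spf_fun _ s = @ps_eval_fun R 'I_N B x s)//.
  rewrite /ps_eval_fun big_seq big1// => m.
  rewrite (mem_N xnull) => mx; rewrite Js ?rmorph0 ?mul0r// => i.
  rewrite ltnNge; apply: contraNN mx => Mm.
  by have [b ->] := mon_eval_dvd x Mm; rewrite xM mul0r.
have FA r : F (alg_map T r) = alg_map B r by rewrite FE; exact: spf_funE.
by exists (AlgHom FA) => i; rewrite [LHS]FE; exact: ps_eval_var.
Qed.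
End TruncatedPolynomials.

(** * Descent of symmetric sums *)

Lemma zero_ring_algebra (R : comPzRingType) (B : algebra R) :
  (forall x y : R, x = y) -> forall x y : B, x = y.
Proof.
move=> R0 x y; rewrite -[x]mul1r -[y]mul1r.
by rewrite -(rmorph1 (alg_map B)) (R0 1 0) rmorph0 !mul0r.
Qed.

Section SignedElementary.
Variables (B : comPzRingType) (I : finType).
Implicit Types x : I -> B.

Lemma prod_monom (x : I -> B) (J : {set I}) :
  \prod_(i in J) monom (x i) 1%N = monom (\prod_(i in J) x i) #|J|
    :> series nat B.
Proof.
rewrite -sum1_card; elim/big_rec3: _ => // i f c k _ ->.
by rewrite [LHS]monomM.
Qed.

Lemma elementary_coef x k :
  (\prod_i (1 - monom (x i) 1%N) : series nat B) k =
  (-1) ^+ k * \sum_(J : {set I} | #|J| == k) \prod_(i in J) x i.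
Proof.
have E i : 1 - monom (x i) 1%N = monom (- x i) 1%N + 1 :> series nat B.
  rewrite addrC; congr (_ + _); apply/seriesP => m.
  by rewrite series_oppE /monom; case: eqP; rewrite ?oppr0.
rewrite (eq_bigr _ (fun i _ => E i)) bigA_distr series_sumE mulr_sumr.
rewrite [RHS]big_mkcond; apply: eq_bigr => J _.
rewrite -big_mkcond /= prod_monom /monom eq_sym; case: eqP => // <-.
by rewrite prodrN.
Qed.
End SignedElementary.

(* The signed elementary symmetric functions of x are the coefficients of the   *)
(* product of the 1 - x_i t.                                                    *)
Lemma symmetric_expression (R : comPzRingType) (N M : nat)
    (a : {ffun 'I_N -> 'I_M} -> R) :
  (forall (s : 'S_N) (e : {ffun 'I_N -> 'I_M}), a [ffun i => e (s i)] = a e) ->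
  exists q : forall B : algebra R, series nat B -> B,
    (forall (B C : algebra R) (h : alg_hom B C) f,
       h (q B f) = q C (series_map h f)) /\
    forall (B : algebra R) (x : 'I_N -> B),
      \sum_(e : {ffun 'I_N -> 'I_M}) alg_map B (a e) * \prod_i x i ^+ e i =
      q B (\prod_i (1 - monom (x i) 1%N)).
Proof.
elim/nz_case: R a => [R a asym|R R0 a _]; last first.
  have B0 (B : algebra R) := zero_ring_algebra (B := B) R0.
  by exists (fun B _ => 0); split=> *; exact: B0.
pose p : {mpoly R[N]} :=
  \sum_(e : {ffun 'I_N -> 'I_M}) a e *: 'X_[[multinom (e i : nat) | i < N]].
have psym : p \is symmetric.
  apply/issymP => s; rewrite /p raddf_sum/=.
  pose ps (e : {ffun 'I_N -> 'I_M}) : {ffun 'I_N -> 'I_M} := [ffun i => e (s i)].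
  have ps_inj : injective ps.
    move=> e e' /ffunP ee; apply/ffunP => i.
    by have := ee (s^-1%g i); rewrite !ffunE permKV.
  rewrite [LHS](reindex_inj ps_inj)/=; apply: eq_bigr => e _.
  rewrite asym msymZ msymX; congr (_ *: 'X_[_]); apply/mnmP => i.
  by rewrite !mnmE ffunE permKV.
have [Q [Qp _]] := sym_fundamental psym.
(* The sign turns the coefficient of t^(i+1) in the product of the 1 - x_j t back into the
   elementary symmetric function of degree i+1. *)
exists (fun B f => \sum_(m <- msupp Q)
  alg_map B (Q@_m) * \prod_(i < N) ((-1) ^+ i.+1 * f i.+1) ^+ m i).
split=> [B C h f|].
  rewrite rmorph_sum; apply: eq_bigr => m _; rewrite rmorphM alg_funE; congr (_ * _).
  rewrite rmorph_prod; apply: eq_bigr => i _.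
  by rewrite rmorphXn rmorphM rmorphXn rmorphN1.
case; elim/nz_case => [B al x|B B0 al x]; last exact: B0.
pose F := mmap al x : {mpoly R[N]} -> B.
transitivity (F p).
  rewrite /F raddf_sum/=; apply: eq_bigr => e _.
  rewrite mmapZ mmapX; congr (_ * _); rewrite /mmap1; apply: eq_bigr => i _.
  by rewrite mnmE.
rewrite -Qp comp_mpolyE /F raddf_sum/=; apply: eq_bigr => m _.
rewrite mmapZ; congr (_ * _); rewrite rmorph_prod; apply: eq_bigr => i _.
rewrite rmorphXn/= tnth_mktuple elementary_coef mulrA -exprMn mulrNN mulr1 expr1n mul1r.
congr (_ ^+ _); rewrite /mesym raddf_sum/=; apply: eq_bigr => J _.
by rewrite rmorph_prod; apply: eq_bigr => j _; rewrite /= mmapX mmap1U.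
Qed.

(** Padding by zeros lets lists of different lengths be treated as families over the same ['I_N]. *)
Lemma big_nth_pad (A : zmodType) (V : Type) (idx : V) (op : Monoid.com_law idx)
    (F : A -> V) (s : seq A) (N : nat) : (size s <= N)%N -> F 0 = idx ->
  \big[op/idx]_(i < N) F (nth 0 s i) = \big[op/idx]_(x <- s) F x.
Proof.
move=> sN F0; rewrite (big_nth 0) -(big_mkord xpredT (fun i => F (nth 0 s i))).
rewrite (big_cat_nat (n := size s))//= [X in op _ X]big_nat [X in op _ X]big1 ?Monoid.mulm1//.
by move=> i /andP[si _]; rewrite nth_default.
Qed.

Section SymmetricExtension.
Variables (R : comPzRingType) (G : formal_group R).
Variable lam : forall B : algebra R, B -> G B.

(** The sum of the [lam (X i)] over T = R[X_1, ..., X_N]/(X_i^(M+1)) is invariant under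
    permutations. Invariant elements of T are polynomials in the coefficients of the product of the
    1 - X_i t, and f provides values in B for these coefficients. *)
Lemma symmetric_descent (M N : nat) (B : algebra R) (f : series nat B)
    (B' : algebra R) (j : alg_hom B B') (x : 'I_N -> B') :
  (forall (C D : algebra R) (h : alg_hom C D) c, c ^+ M.+1 = 0 ->
     lam (h c) = gmap G h (lam c)) ->
  injective j -> (forall i, x i ^+ M.+1 = 0) ->
  \prod_i (1 - monom (x i) 1%N) = series_map j f ->
  exists z : G B, forall (C : algebra R) (h : alg_hom B C) (y : 'I_N -> C),
    (forall i, y i ^+ M.+1 = 0) ->
    \prod_i (1 - monom (y i) 1%N) = series_map h f ->
    gmap G h z = \sum_i lam (y i).
Proof.
move=> lam_nat jinj xM xf.
have [T [X [coef [XM tE coefE Tlift]]]] := truncated_polynomials R N M.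
have uX (s : 'S_N) : exists c : alg_hom T T, forall i, c (X i) = X (s i).
  by apply: Tlift => i; exact: XM.
have [u uE] := choice uX.
(* [K] holds when d specializes the variables to a factorization of the image of f. *)
pose K (C : algebra R) (h : alg_hom B C) (d : alg_hom T C) :=
  \prod_i (1 - monom (d (X i)) 1%N) = series_map h f.
have [c cE] := Tlift B' x xM.
have [||t tu|z zE] := @formal_group_descent R G T {perm 'I_N} (fun=> T) u
  (fun=> alg_id T) (\sum_i lam (X i)) B K B' j c jinj.
- by rewrite /K -xf; apply: eq_bigr => i _; rewrite cE.
- move=> s; rewrite gmap_id raddf_sum/= [RHS](reindex_inj (@perm_inj _ s)).
  by apply: eq_bigr => i _; rewrite -lam_nat// uE.
- have [|q [qnat qE]] := @symmetric_expression R N M.+1 (coef t).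
    move=> s e.
    pose ps (e : {ffun 'I_N -> 'I_M.+1}) : {ffun 'I_N -> 'I_M.+1} := [ffun i => e (s i)].
    have ps_inj : injective ps.
      move=> e1 e2 /ffunP ee; apply/ffunP => i.
      by have := ee (s^-1%g i); rewrite !ffunE permKV.
    have ts : t = \sum_(e : {ffun 'I_N -> 'I_M.+1})
        alg_map T (coef t (ps e)) * \prod_i X i ^+ e i.
      rewrite -[LHS](tu s) [X in u s X]tE rmorph_sum (reindex_inj ps_inj).
      apply: eq_bigr => e' _; rewrite rmorphM alg_funE; congr (_ * _).
      rewrite rmorph_prod [RHS](reindex_inj (@perm_inj _ s)); apply: eq_bigr => i _.
      by rewrite rmorphXn uE ffunE.
    by have := coefE (coef t \o ps) e; rewrite -ts.
  exists (q B f) => C h d Kd; rewrite qnat -Kd -qE {2}(tE t) rmorph_sum.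
  apply: eq_bigr => e _; rewrite rmorphM alg_funE rmorph_prod.
  by congr (_ * _); apply: eq_bigr => i _; rewrite rmorphXn.
exists z => C h y yM yf; have [d dE] := Tlift C y yM.
rewrite (zE C h d); last by rewrite /K -yf; apply: eq_bigr => i _; rewrite dE.
by rewrite raddf_sum/=; apply: eq_bigr => i _; rewrite -lam_nat// dE.
Qed.

Variable ok : pred nat.
Hypotheses (ok_ex : exists M, ok M)
  (ok_max : forall M M', ok M -> ok M' -> ok (maxn M M')).

(** The elements on which [lam] is natural: all nilpotent ones when [ok] is [xpredT] (one variable),
    the square-zero ones when it is [pred1 1] (over Q). *)
Definition small (B : pzRingType) (x : B) := exists M, ok M && (x ^+ M.+1 == 0).

Hypothesis lam_natural : forall (C D : algebra R) (h : alg_hom C D) c, small c ->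
  lam (h c) = gmap G h (lam c).
Hypothesis lam0 : forall C : algebra R, lam (0 : C) = 0.

Lemma small_bound (B : pzRingType) (s : seq B) : (forall x, x \in s -> small x) ->
  exists2 M, ok M & forall x, x \in s -> x ^+ M.+1 = 0.
Proof.
elim: s => [_|x s IH sm]; first by have [M okM] := ok_ex; exists M.
have [M okM ME] := IH (fun y ys => sm y (mem_behead (s := x :: s) ys)).
have [M' /andP[okM' /eqP M'E]] := sm x (mem_head x s).
exists (maxn M M'); first exact: ok_max.
move=> y; rewrite inE => /predU1P[->|/ME yM].
  by rewrite -(subnK (leq_maxr M M')) -addnS exprD M'E mulr0.
by rewrite -(subnK (leq_maxl M M')) -addnS exprD yM mulr0.
Qed.

(** One point z must serve factorizations of every length and nilpotency order. For given ys, the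
    descent is repeated with bounds that cover both xs and ys; the new point equals z because both
    map to the sum over xs under the injective map induced by j. *)
Lemma symmetric_extension (B : algebra R) (f : series nat B)
    (B' : algebra R) (j : alg_hom B B') (xs : seq B') :
  injective j -> (forall x, x \in xs -> small x) ->
  \prod_(x <- xs) (1 - monom x 1%N) = series_map j f ->
  exists z : G B, forall (C : algebra R) (h : alg_hom B C) (ys : seq C),
    (forall y, y \in ys -> small y) ->
    \prod_(y <- ys) (1 - monom y 1%N) = series_map h f ->
    gmap G h z = \sum_(y <- ys) lam y.
Proof.
move=> jinj xsm xf; have [M okM xM] := small_bound xsm.
have mon0 (C : algebra R) : 1 - monom (0 : C) 1%N = 1 :> series nat C.
  apply/seriesP => m; rewrite series_addE series_oppE /monom.
  by case: ifP; rewrite ?subr0.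
have nthM (C : algebra R) (s : seq C) k i : (forall y, y \in s -> y ^+ k.+1 = 0) ->
    s`_i ^+ k.+1 = 0.
  move=> sk; have [si|si] := ltnP i (size s); first by apply: sk; exact: mem_nth.
  by rewrite nth_default// expr0n.
have main N k : (size xs <= N)%N -> (M <= k)%N -> ok k ->
    exists z : G B, gmap G j z = \sum_(x <- xs) lam x /\
      forall (C : algebra R) (h : alg_hom B C) (ys : seq C),
      (size ys <= N)%N -> (forall y, y \in ys -> y ^+ k.+1 = 0) ->
      \prod_(y <- ys) (1 - monom y 1%N) = series_map h f ->
      gmap G h z = \sum_(y <- ys) lam y.
  move=> xN Mk okk.
  have xk i : xs`_i ^+ k.+1 = 0.
    apply: nthM => x /xM xE.
    by rewrite -(subnK Mk) -addnS exprD xE mulr0.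
  have [||z zE] := @symmetric_descent k N B f B' j (fun i => xs`_i) _ jinj (fun i => xk i).
  - move=> C D h c ck; apply: lam_natural; exists k; rewrite okk ck eqxx//.
  - rewrite -xf.
    exact: (@big_nth_pad _ _ _ _ (fun x => 1 - monom x 1%N : series nat B') _ _ xN (mon0 B')).
  exists z; split=> [|C h ys yN yk yf].
    rewrite (zE B' j (fun i => xs`_i))//.
      exact: (@big_nth_pad _ _ _ _ (@lam B')).
    rewrite -xf.
    exact: (@big_nth_pad _ _ _ _ (fun x => 1 - monom x 1%N : series nat B') _ _ xN (mon0 B')).
  rewrite (zE C h (fun i => ys`_i)) => [|i|].
  - exact: (@big_nth_pad _ _ _ _ (@lam C)).
  - exact: nthM.
  rewrite -yf.
  exact: (@big_nth_pad _ _ _ _ (fun x => 1 - monom x 1%N : series nat C) _ _ yN (mon0 C)).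
have [z [zx _]] := main _ _ (leqnn _) (leqnn _) okM.
exists z => C h ys ysm yf; have [M' okM' yM] := small_bound ysm.
have [z' [z'x z'E]] := main (maxn (size xs) (size ys)) (maxn M M')
  (leq_maxl _ _) (leq_maxl _ _) (ok_max okM okM').
have -> : z = z' by apply: (formal_group_inj jinj); rewrite zx z'x.
apply: z'E => //; first exact: leq_maxr.
by move=> y /yM yE; rewrite -(subnK (leq_maxr M M')) -addnS exprD yE mulr0.
Qed.
End SymmetricExtension.

(** * The universal curve *)

Lemma windex_pos n (J : windex n) : exists i, (0 < val J i)%N.
Proof.
apply/existsP; apply: contraT; rewrite negb_exists => /forallP J0.
case/negP: (valP J); apply/eqP/ffunP => i; rewrite ffunE.
by have := J0 i; rewrite -eqn0Ngt => /eqP.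
Qed.

Lemma is_nil_windex n (B : comPzRingType) (b : 'I_n -> B) (J : windex n) :
  (forall i, is_nil (b i)) -> is_nil (\prod_i b i ^+ val J i).
Proof.
move=> bn; have [i] := windex_pos J; rewrite (bigD1 i)//=.
by case: (val J i) => // k _; apply/is_nilM/is_nil_expS.
Qed.

Section UniversalCurve.
Variable n : nat.

Section Coordinates.
Variable B : comPzRingType.
Implicit Types b : 'I_n -> B.

(* Along a ray with primitive vector J its series is 1 - b^J t, so that its     *)
(* ghost components are the monomials b^I.                                      *)
Definition omega b : witt n B :=
  fun J => if wgcd J == 1%N then \prod_i b i ^+ val J i else 0.

Lemma omega_ray b I d : (0 < d)%N -> omega b (ray I d) =
  if d == 1%N then \prod_i b i ^+ (val I i %/ wgcd I) else 0.
Proof.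
move=> d0; rewrite /omega wgcd_ray//; case: eqP => // ->.
by apply: eq_bigr => i _; rewrite val_rayE// muln1.
Qed.

Lemma ray_series_omega b I : ray_series (omega b) I =
  1 - monom (\prod_i b i ^+ (val I i %/ wgcd I)) 1%N.
Proof.
apply/seriesP => -[|m]; rewrite /ray_series /euler_series.
  by rewrite euler0 series_addE series_oppE /monom subr0.
rewrite /euler big_nat_recl//= omega_ray// eqxx.
rewrite [X in _ * X]big_nat [X in _ * X]big1 ?mulr1//.
move=> d /andP[d1 _]; rewrite omega_ray// eqSS; case: eqP d1 => [->//|_ _].
apply/seriesP => k; rewrite series_addE series_oppE /monom.
by case: ifP; rewrite ?subr0.
Qed.

Lemma ghost_omega b I : ghost (omega b) I = \prod_i b i ^+ val I i.
Proof.
rewrite ghostE /unighost big_mkcond big_ltn ?ltnS ?wgcd_gt0//= dvd1n divn1.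
rewrite omega_ray// eqxx mulr1n [X in _ + X]big_nat [X in _ + X]big1.
  rewrite addr0 -prodrXl; apply: eq_bigr => i _; rewrite -exprM divnK//.
  exact: big_gcd_dvd.
move=> d /andP[d1 dI]; case: ifP => // dI'; rewrite omega_ray ?(ltnW d1)// (gtn_eqF d1).
by rewrite expr0n eqn0Ngt divn_gt0 ?(ltnW d1)// -ltnS dI mul0rn.
Qed.

Lemma omega0 : omega (fun=> 0) = 0.
Proof.
apply/funext => J; rewrite /omega; case: ifP => // _; have [i] := windex_pos J.
by rewrite (bigD1 i)//=; case: (val J i) => // k _; rewrite expr0n mul0r.
Qed.

(** The monomial b^J vanishes as soon as one exponent reaches the common bound K, which leaves only
    indices J of total size at most n K. *)
Lemma omega_null b : (forall i, is_nil (b i)) -> cofinitely_null (omega b).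
Proof.
move=> bn; have /choice[k kE] := bn; pose K := (\sum_i k i).+1.
pose F : seq (windex n) := fset_set [set J : windex n | (isize J < (n * K).+1)%N]%classic.
apply: (is_nil_cofinitely_null (F := F)) => J; last first.
  by rewrite /omega; case: ifP => _; [exact: is_nil_windex|exact: is_nil0].
rewrite in_fset_set; last exact: finite_isize.
apply: contraNeq => oJ; apply/mem_set; rewrite /= /isize.
have JK i : (val J i < K)%N.
  rewrite ltnNge; apply: contraNN oJ => Ki; rewrite /omega; case: ifP => // _.
  rewrite (bigD1 i)//= -(subnK (leq_trans _ Ki : k i <= val J i)%N).
    by rewrite exprD kE mulr0 mul0r.
  by rewrite /K (bigD1 i)//= -addnS leq_addr.
rewrite ltnS; apply: (@leq_trans (\sum_(i < n) K)%N); first by apply: leq_sum => i _; exact: ltnW.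
by rewrite sum_nat_const card_ord.
Qed.
End Coordinates.

Lemma omega_map (B C : comPzRingType) (h : {rmorphism B -> C}) (b : 'I_n -> B) :
  omega (h \o b) = h \o omega b.
Proof.
apply/funext => J /=; rewrite /omega; case: ifP => _; last by rewrite rmorph0.
by rewrite rmorph_prod; apply: eq_bigr => i _; rewrite rmorphXn.
Qed.
End UniversalCurve.

Section Points.
Variables (R : comPzRingType) (n : nat).
Local Notation W := (witt_formal_group R n).

(* The value outside nilpotent families is irrelevant. *)
Definition Omega (B : algebra R) (b : 'I_n -> B) : W B :=
  match pselect (forall i, is_nil (b i)) with
  | left bn => ps_eval (omega_null bn)
  | right _ => 0 : W B
  end.

Lemma witt_coord_Omega (B : algebra R) (b : 'I_n -> B) :
  (forall i, is_nil (b i)) -> witt_coord (Omega b) = omega b.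
Proof.
move=> bn; rewrite /Omega; case: pselect => // bn'.
by apply/funext => J; rewrite /witt_coord /ps_coord ps_eval_var.
Qed.

Lemma Omega_natural (B C : algebra R) (h : alg_hom B C) (b : 'I_n -> B) :
  (forall i, is_nil (b i)) -> gmap W h (Omega b) = Omega (h \o b).
Proof.
move=> bn; apply: witt_coord_inj; rewrite [LHS]witt_coord_map.
rewrite !witt_coord_Omega ?omega_map// => i; exact: is_nil_map.
Qed.

Lemma Omega0 (B : algebra R) : Omega (fun=> 0 : B) = 0.
Proof.
apply: witt_coord_inj; rewrite witt_coord_Omega ?omega0 ?witt_coord0//.
by move=> i; exact: is_nil0.
Qed.

Section Curve.
Variables (G : formal_group R) (c : pointed_mor (affine_space R n) (pointed_group G)).

(** The curve as a total function of coordinates, with the default value 0 off nilpotent families,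
    so that its finite differences can be written without nilpotency proofs. *)
Definition curve_at (B : algebra R) (b : 'I_n -> B) : G B :=
  match pselect (forall i, is_nil (b i)) with
  | left bn => c B (ps_eval ((cofinitely_null_ordP b).2 bn))
  | right _ => 0
  end.

Lemma curve_at_coord (B : algebra R) (x : affine_space R n B) :
  curve_at (ps_coord x) = c B x.
Proof.
rewrite /curve_at; case: pselect => [bn|[]]; last first.
  by apply/cofinitely_null_ordP; exact: coord_cofinitely_null.
congr (c B _); apply: coord_inj => i; exact: ps_eval_var.
Qed.

Lemma curve_at_eval (B : algebra R) (b : 'I_n -> B) (bn : cofinitely_null b) :
  curve_at b = c B (ps_eval bn).
Proof.
by rewrite -curve_at_coord; congr curve_at; apply/funext => i; rewrite /ps_coord ps_eval_var.
Qed.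

Lemma curve_at_natural (B C : algebra R) (h : alg_hom B C) (b : 'I_n -> B) :
  (forall i, is_nil (b i)) -> curve_at (h \o b) = gmap G h (curve_at b).
Proof.
move=> /cofinitely_null_ordP bn; rewrite (curve_at_eval bn).
have /= <- := pmor_natural c h (ps_eval bn); rewrite -curve_at_coord.
by congr curve_at; apply/funext => i; rewrite /= coord_map /ps_coord ps_eval_var.
Qed.

Lemma curve_at0 (B : algebra R) : curve_at (fun=> 0 : B) = 0.
Proof.
by rewrite (curve_at_eval (@null_cofinitely_null 'I_n B)); exact: (pmor_base c B).
Qed.
End Curve.

Lemma pointed_mor_ext (X Y : pointed_functor R) (c d : pointed_mor X Y) :
  (forall B x, c B x = d B x) -> c = d.
Proof.
case: c d => [c c1 c2] [d d1 d2] /= cd.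
have E : c = d by apply: functional_extensionality_dep => B; apply/funext => x; exact: cd.
by case: _ / E in d1 d2 *; rewrite (Prop_irrelevance c1 d1) (Prop_irrelevance c2 d2).
Qed.

Lemma additive_ext (U V : zmodType) (f g : {additive U -> V}) : f =1 g -> f = g.
Proof.
case: f g => [f [[f1]]] [g [[g1]]] /= /funext fg.
by case: _ / fg in g1 *; rewrite (Prop_irrelevance f1 g1).
Qed.

Lemma fg_hom_ext (F G : group_functor R) (u v : fg_hom F G) :
  (forall B x, u B x = v B x) -> u = v.
Proof.
case: u v => [u u1] [v v1] /= uv.
have E : u = v by apply: functional_extensionality_dep => B; apply: additive_ext => x; exact: uv.
by case: _ / E in v1 *; rewrite (Prop_irrelevance u1 v1).
Qed.

Section Restriction.
Variables (G : group_functor R) (u : fg_hom W G).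

Definition curve_of_fun (B : algebra R) (x : affine_space R n B) : G B :=
  u B (Omega (ps_coord x)).

Lemma coord_is_nil (B : algebra R) (x : affine_space R n B) i : is_nil (ps_coord x i).
Proof. exact/cofinitely_null_is_nil/coord_cofinitely_null. Qed.

Fact curve_of_natural (B C : algebra R) (h : alg_hom B C) x :
  curve_of_fun (fmap h x) = gmap G h (curve_of_fun x).
Proof.
rewrite /curve_of_fun -fg_natural; congr (u C _).
by rewrite (Omega_natural h)//; exact: coord_is_nil.
Qed.

Fact curve_of_base (B : algebra R) : curve_of_fun (basepoint (affine_space R n) B) = 0.
Proof.
rewrite /curve_of_fun (_ : ps_coord _ = fun=> 0) ?Omega0 ?raddf0//.
by apply/funext => i; rewrite /ps_coord ps_eval_var.
Qed.

Definition curve_of : pointed_mor (affine_space R n) (pointed_group G) :=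
  @PointedMor R (affine_space R n) (pointed_group G) curve_of_fun
    curve_of_natural curve_of_base.
End Restriction.

Inductive omega_span (B : algebra R) : W B -> Prop :=
| span_zero : omega_span 0
| span_Omega b : (forall i, is_nil (b i)) -> omega_span (Omega b)
| span_sub u v : omega_span u -> omega_span v -> omega_span (u - v).

(** The map is restriction to [Omega]. The second hypothesis makes it surjective. It is injective by
    the first one: two morphisms with the same curve agree on the span of [Omega], hence on every
    point after an injective extension, hence on every point. *)
Lemma representable_criterion :
  (forall (B : algebra R) (u : W B), exists (B' : algebra R) (j : alg_hom B B'),
     injective j /\ omega_span (gmap W j u)) ->
  (forall (G : formal_group R) (c : pointed_mor (affine_space R n) (pointed_group G)),
     exists phi : fg_hom W G, forall (B : algebra R) (b : 'I_n -> B),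
       (forall i, is_nil (b i)) -> phi B (Omega b) = curve_at c b) ->
  exists Phi : forall G : formal_group R,
      fg_hom W G -> pointed_mor (affine_space R n) (pointed_group G),
    [/\ forall G : formal_group R, bijective (Phi G),
        forall (G : formal_group R) (u v : fg_hom W G),
          Phi G (fg_add u v) = pmor_add (Phi G u) (Phi G v)
      & forall (G H : formal_group R) (f : fg_hom G H) (u : fg_hom W G),
          Phi H (fg_comp f u) = pmor_fg_comp f (Phi G u)].
Proof.
move=> span ext; exists (fun G => @curve_of G); split; last 2 first.
- by move=> G u v; exact: pointed_mor_ext.
- by move=> G H f u; exact: pointed_mor_ext.
move=> G.
have surj (c : pointed_mor (affine_space R n) (pointed_group G)) :
    exists u : fg_hom W G, curve_of u = c.
  have [phi phiE] := ext G c; exists phi; apply: pointed_mor_ext => B x.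
  by rewrite /= /curve_of_fun phiE ?curve_at_coord//; exact: coord_is_nil.
have [g gE] := choice surj; exists g => // u; apply: fg_hom_ext => B x.
have {}gE (B' : algebra R) (b : 'I_n -> B') : (forall i, is_nil (b i)) ->
    g (curve_of u) B' (Omega b) = u B' (Omega b).
  move=> bn; have bnull := (cofinitely_null_ordP b).2 bn.
  have := congr1 
    (fun c : pointed_mor (affine_space R n) (pointed_group G) => c B' (ps_eval bnull))
    (gE (curve_of u)).
  rewrite /= /curve_of_fun (_ : ps_coord _ = b)//.
  by apply/funext => i; rewrite /ps_coord ps_eval_var.
have [B' [j [jinj jx]]] := span B x; apply: (formal_group_inj jinj).
rewrite -!fg_natural; elim: jx => [|b bn|y z _ yE _ zE].
- by rewrite !raddf0.
- exact: gE.
- by rewrite !raddfB yE zE.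
Qed.
End Points.

(** * Curves in one variable *)

Section ExtensionByDecomposition.
Variables (R : comPzRingType) (n : nat) (G : formal_group R).
Variable c : pointed_mor (affine_space R n) (pointed_group G).
Local Notation W := (witt_formal_group R n).
Variable Dec : forall B : algebra R, W B -> G B -> Prop.
Hypotheses
  (Dec_map : forall (B C : algebra R) (h : alg_hom B C) u z,
     Dec u z -> Dec (gmap W h u) (gmap G h z))
  (Dec_add : forall (B : algebra R) (u v : W B) y z,
     Dec u y -> Dec v z -> Dec (u + v) (y + z))
  (Dec_curve : forall (B : algebra R) (b : 'I_n -> B), (forall i, is_nil (b i)) ->
     exists (B' : algebra R) (j : alg_hom B B'), injective j /\
       Dec (gmap W j (Omega b)) (gmap G j (curve_at c b)))
  (Dec_exists : forall (B : algebra R) (u : W B),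
     exists (B' : algebra R) (j : alg_hom B B') z, injective j /\ Dec (gmap W j u) z)
  (Dec_descent : forall (B : algebra R) (u : W B), exists z : G B,
     forall (C : algebra R) (h : alg_hom B C) y, Dec (gmap W h u) y -> gmap G h z = y).

Lemma curve_extension : exists phi : fg_hom W G,
  forall (B : algebra R) (b : 'I_n -> B), (forall i, is_nil (b i)) ->
    phi B (Omega b) = curve_at c b.
Proof.
have sE (B : algebra R) : exists f : W B -> G B, forall (u : W B) (C : algebra R)
    (h : alg_hom B C) y, Dec (gmap W h u) y -> gmap G h (f u) = y.
  by have [f fE] := choice (fun u : W B => Dec_descent u); exists f.
pose f (B : algebra R) := sval (cid (sE B)).
have fE (B C : algebra R) (h : alg_hom B C) u y :
    Dec (gmap W h u) y -> gmap G h (f B u) = y.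
  exact: (svalP (cid (sE B))).
have fD (B : algebra R) (u v : W B) : f B (u + v) = f B u + f B v.
  (* The image of v is decomposed over the extension already made for u, so that both decompositions
     are available over [B2]. *)
  have [B1 [j1 [y [j1inj uy]]]] := Dec_exists u.
  have [B2 [j2 [z [j2inj vz]]]] := Dec_exists (gmap W j1 v).
  apply: (formal_group_inj j1inj); apply: (formal_group_inj j2inj).
  have Du : Dec (gmap W (alg_comp j2 j1) u) (gmap G j2 y).
    by rewrite gmap_comp; exact: Dec_map.
  have Dv : Dec (gmap W (alg_comp j2 j1) v) z by rewrite gmap_comp.
  rewrite -!gmap_comp raddfD (fE _ _ _ _ _ Du) (fE _ _ _ _ _ Dv).
  by apply: fE; rewrite raddfD; exact: Dec_add.
have f_nmod (B : algebra R) : nmod_morphism (f B).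
  by split; [apply: (addrI (f B 0)); rewrite -fD !addr0|exact: fD].
pose F (B : algebra R) : {additive W B -> G B} :=
  HB.pack (f B) (GRing.isNmodMorphism.Build (W B) (G B) (f B) (f_nmod B)).
have Fnat (B C : algebra R) (h : alg_hom B C) (u : W B) :
    F C (gmap W h u) = gmap G h (F B u).
  have [C' [j [z [jinj uz]]]] := Dec_exists (gmap W h u).
  apply: (formal_group_inj jinj); rewrite [LHS](fE _ _ _ _ _ uz) -gmap_comp.
  by apply/esym/fE; rewrite gmap_comp.
exists (FgHom Fnat) => B b bn; have [B' [j [jinj jb]]] := Dec_curve bn.
by apply: (formal_group_inj jinj); exact: fE.
Qed.
End ExtensionByDecomposition.

Lemma alg_comp_inj (R : comPzRingType) (B C D : algebra R) (g : alg_hom C D)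
  (f : alg_hom B C) : injective f -> injective g -> injective (alg_comp g f).
Proof. by move=> fi gi x y /gi /fi. Qed.

Lemma series_map_mon (B C : comPzRingType) (h : {rmorphism B -> C}) x k :
  series_map h (1 - monom x k) = 1 - monom (h x) k.
Proof.
apply/seriesP => m.
rewrite /series_map !series_addE !series_oppE !series_1E rmorphB /monom.
by do 2!case: ifP; rewrite ?rmorph1 ?rmorph0.
Qed.

(** The extension is B[x]/(p) with p monic of positive degree d; a nonzero multiple of p has degree
    at least d, so no nonzero constant is killed. *)
Lemma adjoin_root (R : comPzRingType) (B : algebra R) (d : nat) (a : nat -> B) :
  (0 < d)%N -> exists (B' : algebra R) (j : alg_hom B B') (x : B'),
    injective j /\ x ^+ d + \sum_(i < d) j (a i) * x ^+ i = 0.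
Proof.
case: B a; elim/nz_case => [B al a d0|B B0 al a d0]; last first.
  by exists (Algebra al), (alg_id _), 0; split; [|exact: B0].
pose p : {poly B} := 'X^d + \poly_(i < d) a i.
have psz : size p = d.+1 by rewrite size_polyDl ?size_polyXn// ltnS size_poly.
have pmon : p \is monic.
  rewrite monicE lead_coefDl ?lead_coefXn// size_polyXn ltnS; exact: size_poly.
have [Q [q [qs q0]]] := principal_quotient p.
exists (Algebra (q \o polyC \o al)), (@AlgHom R (Algebra al)
  (Algebra (q \o polyC \o al)) (q \o polyC) (fun=> erefl)), (q 'X); split.
  apply/raddf_inj => b /q0[h bh].
  have h0 : h = 0.
    apply: contraTeq (size_polyC_leq1 b) => h0.
    by rewrite bh size_monicM// psz -ltnNge addSn /=; apply: (@leq_add 1 1); rewrite ?size_poly_gt0.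
  by apply/polyC_inj; rewrite bh h0 mulr0.
transitivity (q p); last by apply/q0; exists 1; rewrite mulr1.
rewrite rmorphD rmorphXn poly_def rmorph_sum; congr (_ + _).
by apply: eq_bigr => i _; rewrite -mul_polyC rmorphM rmorphXn.
Qed.

(** A root x of the reversed polynomial of f splits off a factor 1 - x t. It is nilpotent because a
    power of it is a combination of the nilpotent coefficients of f. *)
Lemma split_series (R : comPzRingType) (D : nat) (B : algebra R) (f : series nat B) :
  f 0%N = 1 -> (forall k, (D < k)%N -> f k = 0) ->
  (forall k, (0 < k)%N -> is_nil (f k)) ->
  exists (B' : algebra R) (j : alg_hom B B') (xs : seq B'),
    [/\ injective j, forall x, x \in xs -> is_nil x
      & \prod_(x <- xs) (1 - monom x 1%N) = series_map j f].
Proof.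
elim: D B f => [|D IH] B f f0 fD fnil.
  exists B, (alg_id B), [::]; split=> //; rewrite big_nil; apply/seriesP => -[|k].
    by rewrite /series_map f0.
  by rewrite /series_map fD// rmorph0.
have [B1 [j1 [x [j1inj xroot]]]] := adjoin_root (d := D.+1) (fun i => f (D.+1 - i)%N) isT.
(* g is f / (1 - x t). Its coefficient of degree D+1 is the polynomial equation satisfied by x, so g
   has degree at most D. *)
pose g : series nat B1 := fun k => \sum_(i < k.+1) j1 (f i) * x ^+ (k - i).
have g0 : g 0%N = 1 by rewrite /g big_ord1 f0 rmorph1 mul1r.
have gS k : g k.+1 = j1 (f k.+1) + x * g k.
  rewrite /g big_ord_recr /= subnn expr0 mulr1 addrC mulr_sumr; congr (_ + _).
  apply: eq_bigr => i _; by rewrite subSn ?leq_ord// exprS mulrCA.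
have xnil : is_nil x.
  apply: (@is_nil_exp _ _ D.+1); rewrite -[_ ^+ _]addr0 -[0]oppr0 -xroot opprD addrA.
  rewrite subrr sub0r -sumrN; apply: is_nil_sum => i _; rewrite -mulNr -rmorphN.
  apply/is_nilM/is_nil_map; rewrite -mulN1r mulrC; apply/is_nilM/fnil.
  by rewrite subn_gt0.
have gnil k : (0 < k)%N -> is_nil (g k).
  elim: k => // k _ _; rewrite gS; apply: is_nilD.
    by apply/is_nil_map/fnil.
  exact: is_nilM.
have gD k : (D < k)%N -> g k = 0.
  elim: k => // k IHk; rewrite ltnS leq_eqVlt => /predU1P[<-|Dk].
    rewrite -[RHS]xroot /g big_ord_recl f0 rmorph1 mul1r subn0; congr (_ + _).
    rewrite [RHS](reindex_inj rev_ord_inj); apply: eq_bigr => i _ /=.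
    by rewrite /bump/= add1n subKn// ltnS -ltnS ltn_ord.
  by rewrite gS IHk// mulr0 addr0 fD ?rmorph0.
have [B2 [j2 [xs [j2inj xsnil xsg]]]] := IH B1 g g0 gD gnil.
exists B2, (alg_comp j2 j1), (j2 x :: xs); split; first exact: alg_comp_inj.
  by move=> y; rewrite inE => /predU1P[->|/xsnil//]; exact: is_nil_map.
rewrite big_cons xsg -series_map_mon -series_mapM; apply/seriesP => k.
rewrite /series_map /=; congr (j2 _).
rewrite mulrC mulrBr mulr1 series_addE series_oppE series_mul_monom.
case: k => [|k]; first by rewrite subr0 g0 f0 rmorph1.
by rewrite gS subn1 /= [x * _]mulrC addrK.
Qed.

Lemma euler_bound (B : comPzRingType) (a : nat -> B) N :
  exists D, forall k, (D < k)%N -> euler a N k = 0.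
Proof.
elim: N => [|N [D ND]].
  by exists 0%N => -[//|k] _; rewrite /euler big_geq// series_1E.
exists (D + N.+1)%N => k Dk; rewrite eulerSE !ND ?mul0r ?if_same ?subr0//.
  by rewrite ltn_subRL addnC.
by apply: leq_ltn_trans Dk; rewrite leq_addr.
Qed.

Lemma euler_nil (B : comPzRingType) (a : nat -> B) N :
  (forall d, (0 < d)%N -> is_nil (a d)) -> forall k, (0 < k)%N -> is_nil (euler a N k).
Proof.
move=> anil; elim: N => [[//|k] _|N IH k k0].
  by rewrite /euler big_geq// series_1E; exact: is_nil0.
rewrite eulerSE; apply: is_nilD; first exact: IH.
rewrite -mulN1r mulrC; apply: is_nilM; case: ifP => _; last exact: is_nil0.
by rewrite mulrC; apply: is_nilM; exact: anil.
Qed.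

Section CurvesInOneVariable.
Variable R : comPzRingType.
Local Notation W := (witt_formal_group R 1).

Fact unit_windex_subproof : [ffun=> 1%N] != 0 :> {ffun 'I_1 -> nat}.
Proof. by apply/eqP => /ffunP/(_ ord0); rewrite !ffunE. Qed.
Definition unit_windex : windex 1 := exist _ [ffun=> 1%N] unit_windex_subproof.

Lemma wgcd1 (I : windex 1) : wgcd I = val I ord0.
Proof. by rewrite /wgcd big_ord_recl big_ord0 gcdn0. Qed.

Lemma windex1_ray (I : windex 1) : I = ray unit_windex (wgcd I).
Proof.
apply/val_inj/ffunP => i; rewrite ord1 val_rayE ?wgcd_gt0//.
by rewrite !wgcd1 ffunE divn1 mul1n.
Qed.

(** For n = 1 all indices lie on a single ray, so a point is determined by this one series, and
    points are added by multiplying series. *)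
Definition witt_series (B : algebra R) (u : W B) : series nat B :=
  ray_series (witt_coord u) unit_windex.

Lemma witt_series_inj (B : algebra R) : injective (@witt_series B).
Proof.
move=> u v uv; apply/witt_coord_inj/ray_series_inj => I.
by rewrite (windex1_ray I) !ray_series_ray ?wgcd_gt0.
Qed.

Lemma witt_seriesD (B : algebra R) (u v : W B) :
  witt_series (u + v) = witt_series u * witt_series v.
Proof. by rewrite /witt_series witt_coordD ray_series_add. Qed.

Lemma witt_series0 (B : algebra R) : witt_series (0 : W B) = 1.
Proof. by rewrite /witt_series witt_coord0 ray_series_zero. Qed.

Lemma witt_series_map (B C : algebra R) (h : alg_hom B C) (u : W B) :
  witt_series (gmap W h u) = series_map h (witt_series u).
Proof.
rewrite /witt_series [witt_coord _]witt_coord_map.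
apply/seriesP => m; rewrite /ray_series /euler_series /series_map.
by rewrite -[h \o _ \o _]/(h \o (_ \o _)) -euler_map.
Qed.

Lemma witt_series_Omega (B : algebra R) (x : B) : is_nil x ->
  witt_series (Omega (fun=> x)) = 1 - monom x 1%N.
Proof.
move=> xn; rewrite /witt_series witt_coord_Omega// ray_series_omega big_ord1.
by rewrite wgcd1 /= ffunE divnn expr1.
Qed.

Lemma witt_series_sum (B : algebra R) (xs : seq B) : (forall x, x \in xs -> is_nil x) ->
  witt_series (\sum_(x <- xs) Omega (fun=> x)) = \prod_(x <- xs) (1 - monom x 1%N).
Proof.
elim: xs => [_|x xs IH xn]; first by rewrite !big_nil witt_series0.
rewrite !big_cons witt_seriesD IH => [|y ys].
  by rewrite witt_series_Omega//; apply: xn; exact: mem_head.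
by apply: xn; rewrite inE ys orbT.
Qed.

(** Almost all coordinates vanish and all are nilpotent, so the series of u is a polynomial with
    nilpotent non-constant coefficients and [split_series] applies. *)
Lemma witt_split (B : algebra R) (u : W B) :
  exists (B' : algebra R) (j : alg_hom B B') (xs : seq B'),
    [/\ injective j, forall x, x \in xs -> is_nil x
      & gmap W j u = \sum_(x <- xs) Omega (fun=> x)].
Proof.
have unull : cofinitely_null (witt_coord u) := coord_cofinitely_null u.
have [F FE] := cofinitely_null_support unull.
pose a : nat -> B := witt_coord u \o ray unit_windex.
have anil d : is_nil (a d) := cofinitely_null_is_nil (ray unit_windex d) unull.
pose N := (\sum_(I <- F) wgcd I)%N.
have aN d : (N < d)%N -> a d = 0.
  move=> Nd; apply: FE; apply/negP => IF; have d0 : (0 < d)%N by case: d Nd {IF}.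
  suff : (d <= N)%N by rewrite leqNgt Nd.
  rewrite -{1}(wgcd_ray unit_windex d0) /N; elim: {+}F IF => // I s IH.
  rewrite inE big_cons => /predU1P[<-|/IH le]; first by rewrite leq_addr.
  by apply: leq_trans le _; rewrite leq_addl.
have [D DE] := euler_bound a N.
have euN k : (N <= k)%N -> euler a k = euler a N.
  elim: k => [|k IH]; first by rewrite leqn0 => /eqP ->.
  rewrite leq_eqVlt => /predU1P[->//|Nk]; rewrite eulerS IH// aN//.
  have -> : 1 - monom 0 k.+1 = 1 :> series nat B.
    by apply/seriesP => m; rewrite series_addE series_oppE /monom; case: ifP; rewrite subr0.
  by rewrite mulr1.
have [||k|B' [j [xs [jinj xn xE]]]] := @split_series R (D + N) B (witt_series u).
- exact: ray_series0.
- move=> k Dk; rewrite /witt_series /ray_series /euler_series euN.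
    by apply: DE; apply: leq_ltn_trans Dk; rewrite leq_addr.
  by apply: ltnW; apply: leq_ltn_trans Dk; rewrite leq_addl.
- by move=> k0; apply: euler_nil.
exists B', j, xs; split=> //; apply: witt_series_inj.
by rewrite witt_series_map witt_series_sum.
Qed.

Lemma omega_span_sum (n : nat) (B : algebra R) (T : eqType) (s : seq T)
    (F : T -> witt_formal_group R n B) :
  (forall x, x \in s -> omega_span (F x)) -> omega_span (\sum_(x <- s) F x).
Proof.
move=> Fs; rewrite big_seq; elim/big_ind: _ => // [|u v su sv]; first exact: span_zero.
rewrite -[v]opprK; apply: span_sub => //; rewrite -[- v]sub0r.
by apply: span_sub => //; exact: span_zero.
Qed.

Lemma witt_span1 (B : algebra R) (u : W B) :
  exists (B' : algebra R) (j : alg_hom B B'),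
    injective j /\ omega_span (gmap W j u).
Proof.
have [B' [j [xs [jinj xn xE]]]] := witt_split u; exists B', j; split=> //.
rewrite xE.
by apply: omega_span_sum => x xxs; apply: span_Omega => _; exact: xn.
Qed.

(** If u is the sum of the values [Omega] at x_i, the product of the 1 - x_i t is [witt_series u].
    Hence the sum of the values of c at the x_i descends by [symmetric_extension] to a point
    depending on u alone. *)
Lemma curve_extension1 (G : formal_group R)
    (c : pointed_mor (affine_space R 1) (pointed_group G)) :
  exists phi : fg_hom W G, forall (B : algebra R) (b : 'I_1 -> B),
    (forall i, is_nil (b i)) -> phi B (Omega b) = curve_at c b.
Proof.
pose lam (B : algebra R) (x : B) : G B := curve_at c (fun=> x).
pose Dec (B : algebra R) (u : W B) (z : G B) := exists xs : seq B,
  [/\ forall x, x \in xs -> is_nil x, u = \sum_(x <- xs) Omega (fun=> x)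
    & z = \sum_(x <- xs) lam B x].
have lam_nat (B C : algebra R) (h : alg_hom B C) x : is_nil x ->
    lam C (h x) = gmap G h (lam B x).
  by move=> xn; rewrite /lam -curve_at_natural.
apply: (@curve_extension R 1 G c Dec).
- move=> B C h u z [xs [xn -> ->]]; exists [seq h x | x <- xs]; split.
  + by move=> _ /mapP[x /xn xn' ->]; exact: is_nil_map.
  + rewrite raddf_sum big_map big_seq [RHS]big_seq; apply: eq_bigr => x /xn xn'.
    by rewrite Omega_natural.
  + rewrite raddf_sum big_map big_seq [RHS]big_seq; apply: eq_bigr => x /xn xn'.
    by rewrite lam_nat.
- move=> B u v y z [xs [xn -> ->]] [ys [yn -> ->]]; exists (xs ++ ys).
  split; rewrite ?big_cat// => x; rewrite mem_cat => /orP[]; [exact: xn|exact: yn].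
- move=> B b bn; exists B, (alg_id B); split=> //; exists [:: b ord0].
  have bE : b = fun=> b ord0 by apply/funext => i; rewrite ord1.
  rewrite !big_seq1 !gmap_id; split=> [x||]; rewrite /lam -?bE//.
  by rewrite inE => /eqP ->.
- move=> B u; have [B' [j [xs [jinj xn xE]]]] := witt_split u.
  by exists B', j, (\sum_(x <- xs) lam B' x); split=> //; exists xs.
move=> B u; have [B' [j [xs [jinj xn xE]]]] := witt_split u.
have smallE (C : algebra R) (x : C) : small xpredT x <-> is_nil x.
  split=> [[M /= /eqP xM]|[k xk]]; first by exists M.+1.
  by exists k; rewrite /= exprS xk mulr0.
have [||||x /xn /smallE //||z zE] := @symmetric_extension R G lam xpredT _ _ _ _ B
  (witt_series u) B' j xs jinj.
- by exists 0%N.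
- by [].
- by move=> C D h x /smallE xn'; rewrite lam_nat.
- by move=> C; exact: curve_at0.
- by rewrite -witt_series_map xE witt_series_sum.
exists z => C h _ [ys [yn uE ->]]; apply: zE => [y /yn /smallE //|].
by rewrite -witt_series_map uE witt_series_sum.
Qed.
End CurvesInOneVariable.

(** * Finite differences over a rational base *)

Section FiniteDifferences.
Variable n : nat.

Definition shift (B : zmodType) (x : 'I_n -> B) (p : 'I_n * B) : 'I_n -> B :=
  fun i => x i + (if p.1 == i then p.2 else 0).

Fixpoint fd (B V : zmodType) (F : ('I_n -> B) -> V) (L : seq ('I_n * B)) x : V :=
  if L is p :: L' then fd F L' (shift x p) - fd F L' x else F x.

(** Only nonempty sublists are listed; the empty one contributes the separate term F x in
    [fd_expansion]. *)
Fixpoint sublists (T : Type) (L : seq T) : seq (seq T) :=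
  if L is p :: L' then sublists L' ++ [:: p] :: map (cons p) (sublists L') else [::].

Lemma sublistsP (T : eqType) (L L' : seq T) : L' \in sublists L ->
  L' != [::] /\ subseq L' L.
Proof.
elim: L L' => // p L IH L'; rewrite mem_cat inE => /or3P[/IH[L'0 s]|/eqP ->|].
- by split=> //; apply: subseq_trans s _; exact: subseq_cons.
- by split=> //; rewrite /= eqxx sub0seq.
by move=> /mapP[L'' /IH[_ s] ->]; split=> //=; rewrite eqxx.
Qed.

(** The shift along p is the identity plus the difference along p; composing these over [L] and
    expanding gives one iterated difference for each sublist. *)
Lemma fd_expansion (B V : zmodType) (F : ('I_n -> B) -> V) L x :
  F (foldl (@shift B) x L) = F x + \sum_(L' <- sublists L) fd F L' x.
Proof.
elim: L x => [|p L IH] x; first by rewrite big_nil addr0.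
rewrite /= IH big_cat big_cons big_map /= sumrB.
set a := F (shift x p); set s1 := \sum_(L' <- _) _; set s2 := \sum_(L' <- _) fd F L' x.
by rewrite [s2 + _]addrCA [s2 + _]addrC subrK addrA [F x + _]addrC subrK.
Qed.

Lemma foldl_shift (B : zmodType) L (x : 'I_n -> B) i :
  foldl (@shift B) x L i = x i + \sum_(p <- L | p.1 == i) p.2.
Proof.
elim: L x => [|p L IH] x; first by rewrite big_nil addr0.
by rewrite /= IH big_cons /shift -addrA; case: eqP => //; rewrite add0r.
Qed.

Lemma fd_null (B V : zmodType) (F : ('I_n -> B) -> V) k L x :
  (k, 0) \in L -> fd F L x = 0.
Proof.
elim: L x => // p L IH x; rewrite inE => /predU1P[<-|kL] /=; last by rewrite !IH ?subr0.
rewrite (_ : shift x (k, 0) = x) ?subrr//.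
by apply/funext => i; rewrite /shift /=; case: ifP; rewrite addr0.
Qed.

Definition map_difference (B C : Type) (h : B -> C) (L : seq ('I_n * B)) :
    seq ('I_n * C) :=
  [seq (p.1, h p.2) | p <- L].

Lemma fd_map (B C : comPzRingType) (h : {rmorphism B -> C}) (V U : zmodType)
    (F : ('I_n -> B) -> V) (F' : ('I_n -> C) -> U) (f : V -> U) L x :
  {morph f : u v / u - v} ->
  (forall y, (forall i, is_nil (y i)) -> F' (h \o y) = f (F y)) ->
  (forall p, p \in L -> is_nil p.2) -> (forall i, is_nil (x i)) ->
  fd F' (map_difference h L) (h \o x) = f (fd F L x).
Proof.
move=> fB FF; elim: L x => [|p L IH] x Ln xn /=; first exact: FF.
have {}Ln q : q \in p :: L -> is_nil q.2 := Ln q.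
have Ln' q : q \in L -> is_nil q.2 by move=> qL; apply: Ln; rewrite inE qL orbT.
rewrite fB -!IH// => [|i]; last first.
  apply: is_nilD => //; case: ifP => _; last exact: is_nil0.
  by apply: Ln; exact: mem_head.
congr (fd _ _ _ - _); apply/funext => i; rewrite /shift /= rmorphD.
by case: ifP => _; rewrite ?rmorph0.
Qed.

Lemma exprD_square_zero (B : comPzRingType) (x e : B) k : e ^+ 2 = 0 ->
  (x + e) ^+ k.+1 = x ^+ k.+1 + e * x ^+ k *+ k.+1.
Proof.
move=> e2; elim: k => [|k IH]; first by rewrite !expr1 expr0 mulr1.
rewrite exprS IH mulrDl !mulrDr -exprS -!addrA; congr (_ + _).
rewrite [e * (e * _ *+ _)](_ : _ = 0) ?addr0.
  rewrite mulrnAr mulrCA -exprS addrC -mulrS; congr (_ *+ _).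
by rewrite mulrnAr mulrA -expr2 e2 mul0r mul0rn.
Qed.

Definition color_count (T : Type) (L : seq ('I_n * T)) (i : 'I_n) : nat :=
  count (fun p => p.1 == i) L.

(** Along a square-zero increment the difference of a polynomial is the increment times the partial
    derivative; iterated derivatives of a power produce the falling factorials. *)
Lemma fd_monomial (B : comPzRingType) (e : 'I_n -> nat) (L : seq ('I_n * B)) x :
  (forall p, p \in L -> p.2 ^+ 2 = 0) ->
  fd (fun y : 'I_n -> B => \prod_i y i ^+ e i) L x =
  (\prod_(p <- L) p.2) *
  \prod_i (x i ^+ (e i - color_count L i) *+ (e i) ^_ (color_count L i)).
Proof.
elim: L x => [|p L IH] x L2.
  rewrite big_nil mul1r; apply: eq_bigr => i _.
  by rewrite /color_count /= subn0 ffactn0.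
have p2 : p.2 ^+ 2 = 0 by apply: L2; exact: mem_head.
rewrite /= !IH => [|q qL|q qL]; try by apply: L2; rewrite inE qL orbT.
rewrite -mulrBr big_cons [p.2 * _]mulrC -mulrA; congr (_ * _).
rewrite (bigD1 p.1)//= [X in _ - X](bigD1 p.1)//= [in RHS](bigD1 p.1)//=.
rewrite [X in X * _ - _](_ : _ = (x p.1 + p.2) ^+ (e p.1 - color_count L p.1)
  *+ (e p.1) ^_ (color_count L p.1)); last by rewrite /shift eqxx.
have E (i : 'I_n) : i != p.1 -> shift x p i = x i.
  by move=> /negPf ip; rewrite /shift eq_sym ip addr0.
rewrite (eq_bigr (fun i => x i ^+ (e i - color_count L i)
  *+ (e i) ^_ (color_count L i))) => [|i ip]; last by rewrite E.
rewrite -mulrBl mulrA; congr (_ * _); last first.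
  by apply: eq_bigr => i /negPf ip; rewrite /color_count /= eq_sym ip.
rewrite {3 4}/color_count /= eqxx add1n ffactnSr -/(color_count L p.1) subnS.
set k := (e p.1 - _)%N; set c := _ ^_ _.
case: k => [|k]; first by rewrite muln0 mulr0n mulr0 !expr0 subrr.
rewrite exprD_square_zero//= mulrnDl addrC addKr.
by rewrite -mulrnA mulnC mulrnAr.
Qed.

Definition mfact (e : 'I_n -> nat) : nat := \prod_i (e i)`!.

(** At the origin a derivative of y^e survives only if each variable is differentiated exactly e_i
    times, and it is then e!. *)
Lemma fd_monomial0 (B : comPzRingType) (e : {ffun 'I_n -> nat})
    (L : seq ('I_n * B)) : (forall p, p \in L -> p.2 ^+ 2 = 0) ->
  fd (fun y : 'I_n -> B => \prod_i y i ^+ e i) L (fun=> 0) =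
  if [ffun i => color_count L i] == e
  then (\prod_(p <- L) p.2) *+ mfact e else 0.
Proof.
move=> L2; rewrite fd_monomial//; case: eqP => [<-|Le].
  rewrite -[RHS]mulr_natr /mfact; congr (_ * _); rewrite natr_prod.
  by apply: eq_bigr => i _; rewrite !ffunE subnn expr0 ffactnn.
have [i ie] : exists i, color_count L i != e i.
  apply/existsP; apply: contraT; rewrite negb_exists => /forallP E; case: Le.
  by apply/ffunP => i; rewrite ffunE; apply/eqP; have := E i; rewrite negbK.
rewrite (bigD1 i)//= [X in _ * (X * _)](_ : _ = 0) ?mul0r ?mulr0//.
have [lt|gt|E] := ltngtP (color_count L i) (e i); last by rewrite E eqxx in ie.
  by rewrite expr0n subn_eq0 leqNgt lt mul0rn.
by rewrite ffact_small// mulr0n.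
Qed.
End FiniteDifferences.

(** * Extensions splitting nilpotent elements into square-zero ones *)

Definition square_zero (B : pzRingType) (s : seq B) := forall x, x \in s -> x ^+ 2 = 0.

Lemma square_zero_map (B C : pzRingType) (h : {rmorphism B -> C}) s :
  square_zero s -> square_zero [seq h x | x <- s].
Proof. by move=> s2 _ /mapP[x xs ->]; rewrite -rmorphXn s2// rmorph0. Qed.

Lemma map_nth_ord_enum (T : Type) (x0 : T) (s : seq T) r : size s = r ->
  [seq nth x0 s (i : 'I_r) | i <- enum 'I_r] = s.
Proof.
move=> sr; apply: (@eq_from_nth _ x0); rewrite size_map size_enum_ord//.
by move=> i ir; rewrite (nth_map (Ordinal ir)) ?size_enum_ord// nth_enum_ord.
Qed.

(* B' is B[x_1, ..., x_r] / (x_i^2, x_1 ... x_r - theta). *)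
Lemma split_product (R : comPzRingType) (B : algebra R) (theta : B) (r : nat) :
  (0 < r)%N -> theta ^+ 2 = 0 ->
  exists (B' : algebra R) (j : alg_hom B B') (xs : seq B'),
    [/\ injective j, size xs = r, square_zero xs & \prod_(x <- xs) x = j theta].
Proof.
move=> r0 th2.
have [T [X [coef [X2 tE coefE _]]]] := truncated_polynomials B r 1.
have [Q [q [qs q0]]] := principal_quotient (\prod_i X i - alg_map T theta).
pose B' := @Algebra R Q (q \o alg_map T \o alg_map B).
pose j := @AlgHom R B B' (q \o alg_map T) (fun=> erefl).
exists B', j, [seq q (X i) | i <- enum 'I_r]; split; last first.
- rewrite big_map big_enum/= -rmorph_prod; apply/eqP; rewrite -subr_eq0 -rmorphB.
  by apply/eqP/q0; exists 1; rewrite mulr1.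
- by move=> _ /mapP[i _ ->]; rewrite -rmorphXn X2 rmorph0.
- by rewrite size_map size_enum_ord.
(* If b = (X_1 ... X_r - theta) t, comparing the coefficients of 1 and of X_1 ... X_r, distinct
   monomials since r > 0, gives b = -theta t_0 and t_0 = theta t_1, so b = -theta^2 t_1 = 0. *)
apply/raddf_inj => b /q0[t bt].
pose e0 : {ffun 'I_r -> 'I_2} := [ffun=> ord0].
pose e1 : {ffun 'I_r -> 'I_2} := [ffun=> ord_max].
have e10 : e1 != e0 by apply/eqP => /ffunP/(_ (Ordinal r0)); rewrite !ffunE.
have X0 : \prod_i X i ^+ e0 i = 1 by rewrite big1// => i _; rewrite ffunE expr0.
have X1 : \prod_i X i ^+ e1 i = \prod_i X i.
  by apply: eq_bigr => i _; rewrite ffunE expr1.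
have XX e : e != e0 -> \prod_i X i * \prod_i X i ^+ e i = 0.
  move=> ee0; have [i ei] : exists i, (0 < e i)%N.
    apply/existsP; apply: contraT; rewrite negb_exists => /forallP E.
    case/eqP: ee0; apply/ffunP => i; apply/val_inj; rewrite ffunE /=.
    by have := E i; rewrite -eqn0Ngt => /eqP.
  rewrite (bigD1 i)//= [X in _ * X](bigD1 i)//= mulrACA -exprS.
  by case: (e i : nat) ei => // k _; rewrite -addn2 exprD X2 mulr0 mul0r.
pose lhs (e : {ffun 'I_r -> 'I_2}) : B := if e == e0 then b else 0.
pose rhs (e : {ffun 'I_r -> 'I_2}) : B :=
  (if e == e1 then coef t e0 else 0) - theta * coef t e.
have E : \sum_(e : {ffun 'I_r -> 'I_2}) alg_map T (lhs e) * \prod_i X i ^+ e i =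
         \sum_(e : {ffun 'I_r -> 'I_2}) alg_map T (rhs e) * \prod_i X i ^+ e i.
  transitivity (alg_map T b).
    rewrite (bigD1 e0)//= /lhs eqxx X0 mulr1 big1 ?addr0// => e /negPf ->.
    by rewrite rmorph0 mul0r.
  rewrite bt mulrBl /rhs.
  under [RHS]eq_bigr do rewrite rmorphB mulrBl.
  rewrite sumrB; congr (_ - _).
    rewrite [t in LHS]tE mulr_sumr (bigD1 e0)//= X0 mulr1 [X in _ + X]big1 => [|e /XX E].
      rewrite addr0 [RHS](bigD1 e1)//= eqxx X1 mulrC [X in _ = _ + X]big1 ?addr0// => e /negPf ->.
      by rewrite rmorph0 mul0r.
    by rewrite mulrCA E mulr0.
  rewrite [t in LHS]tE mulr_sumr; apply: eq_bigr => e _.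
  by rewrite rmorphM mulrA.
have F e : lhs e = rhs e by rewrite -(coefE lhs) E coefE.
have := F e0; have := F e1; rewrite /lhs /rhs eqxx (negPf e10) eq_sym (negPf e10) eqxx.
move=> /esym/eqP; rewrite subr_eq0 => /eqP c0 ->.
by rewrite c0 sub0r mulrA -expr2 th2 mul0r oppr0.
Qed.

Section RationalAlgebra.
Variable R : comPzRingType.
Hypothesis hQ : forall k, exists r : R, r * k.+1%:R = 1.

Lemma natf_cancel (B : algebra R) (x : B) k : (0 < k)%N -> x *+ k = 0 -> x = 0.
Proof.
case: k => // k _ xk; have [r rk] := hQ k.
rewrite -[x]mul1r -(rmorph1 (alg_map B)) -rk rmorphM rmorph_nat.
by rewrite -mulrA mulr_natl xk mulr0.
Qed.

Lemma factf_inv k : exists r : R, r * k`!%:R = 1.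
Proof. by have := hQ k`!.-1; rewrite prednK// fact_gt0. Qed.

Lemma mfact_inv n (e : 'I_n -> nat) : exists r : R, r * (mfact e)%:R = 1.
Proof.
have := hQ (mfact e).-1; rewrite prednK// /mfact.
by rewrite prodn_gt0// => i; exact: fact_gt0.
Qed.

(* Modulo x^2 one has (w - x)^(m+1) = w^(m+1) - (m+1) w^m x: this is the second *)
(* relation imposed on x.                                                       *)
Lemma adjoin_square_zero (B : algebra R) (w : B) m : w ^+ m.+2 = 0 ->
  exists (B' : algebra R) (j : alg_hom B B') (x : B'),
    [/\ injective j, x ^+ 2 = 0 & (j w - x) ^+ m.+1 = 0].
Proof.
case: B w; elim/nz_case => [B al w wm|B B0 al w _]; last first.
  by exists (Algebra al), (alg_id _), 0; split=> //; exact: B0.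
pose g : {poly B} := (w ^+ m.+1)%:P - (w ^+ m *+ m.+1)%:P * 'X.
have [|||Q [q [qs q0]]] := @quotient_ring {poly B}
  (fun p => exists a b, p = 'X^2 * a + g * b).
- by exists 0, 0; rewrite !mulr0 addr0.
- move=> _ _ [a [b ->]] [a' [b' ->]]; exists (a + a'), (b + b').
  by rewrite !mulrDr addrACA.
- by move=> r _ [a [b ->]]; exists (r * a), (r * b); rewrite mulrDr !(mulrCA r).
pose A := Algebra al; pose B' := @Algebra R Q (q \o polyC \o al).
exists B', (@AlgHom R A B' (q \o polyC) (fun=> erefl)), (q 'X); split.
(* For c in the ideal, degrees 0 and 1 give c = w^(m+1) b_0 and w^(m+1) b_1 = (m+1) w^m b_0.
   Multiplying the latter by w yields (m+1) c = w^(m+2) b_1 = 0. *)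
- apply/raddf_inj => c /q0[a [b cE]].
  have cE' : c%:P = 'X * ('X * a) + ((w ^+ m.+1)%:P * b
      - (w ^+ m *+ m.+1)%:P * ('X * b)).
    by rewrite cE /g expr2; ring.
  have c0 : c = w ^+ m.+1 * b`_0.
    have := congr1 (fun p : {poly B} => p`_0) cE'.
    by rewrite !(coefD, coefN, coefC, coefCM, coefXM)/= mulr0 subr0 add0r.
  have c1 : w ^+ m.+1 * b`_1 = w ^+ m *+ m.+1 * b`_0.
    have := congr1 (fun p : {poly B} => p`_1) cE'.
    rewrite !(coefD, coefN, coefC, coefCM, coefXM)/= add0r => /esym/eqP.
    by rewrite subr_eq0 => /eqP.
  apply: (@natf_cancel A c m.+1) => //.
  have := congr1 (fun x => w * x) c1.
  rewrite mulrA -exprS wm mul0r mulrnAl mulrnAr mulrA -exprS -c0 => <-//.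
- by rewrite -rmorphXn; apply/q0; exists 1, 0; rewrite mulr1 mulr0 addr0.
have x2 : (- q 'X) ^+ 2 = 0.
  by rewrite sqrrN -rmorphXn; apply/q0; exists 1, 0; rewrite mulr1 mulr0 addr0.
rewrite exprD_square_zero//; transitivity (q g).
  rewrite /g rmorphB rmorphM -[q (w ^+ m.+1)%:P]/((q \o polyC) _).
  rewrite -[q (w ^+ m *+ m.+1)%:P]/((q \o polyC) _) rmorphXn rmorphMn rmorphXn.
  by rewrite mulNr mulNrn mulrnAl [q 'X * _]mulrC.
by apply/q0; exists 0, 1; rewrite mulr0 add0r mulr1.
Qed.

(** Each use of [adjoin_square_zero] splits off one square-zero summand and lowers the nilpotency
    order of the remainder by one. *)
Lemma split_sum (B : algebra R) (w : B) : is_nil w ->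
  exists (B' : algebra R) (j : alg_hom B B') (xs : seq B'),
    [/\ injective j, square_zero xs & \sum_(x <- xs) x = j w].
Proof.
suff main m (C : algebra R) (v : C) : v ^+ m.+1 = 0 ->
    exists (B' : algebra R) (j : alg_hom C B') (xs : seq B'),
    [/\ injective j, square_zero xs & \sum_(x <- xs) x = j v].
  by move=> [m wm]; apply: (main m); rewrite exprS wm mulr0.
elim: m C v => [|m IH] C v vm.
  exists C, (alg_id C), [::]; split=> //; rewrite big_nil.
  by move: vm; rewrite expr1 => ->.
have [B1 [j1 [x [j1inj x2 xm]]]] := adjoin_square_zero vm.
have [B2 [j2 [xs [j2inj xs2 xsE]]]] := IH _ _ xm.
exists B2, (alg_comp j2 j1), (j2 x :: xs); split; first exact: alg_comp_inj.
  move=> y; rewrite inE => /predU1P[->|/xs2//].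
  by rewrite -rmorphXn x2 rmorph0.
by rewrite big_cons xsE rmorphB addrC subrK.
Qed.

(** The system is triangular: the component of index d is d a_d plus terms in the a_i with i < d,
    and multiplication by d is injective. *)
Lemma unighost_inj (B : algebra R) (a b : nat -> B) :
  (forall m, (0 < m)%N -> unighost a m = unighost b m) ->
  forall d, (0 < d)%N -> a d = b d.
Proof.
move=> ab; elim/ltn_ind => -[//|d] IH _.
have E (c : nat -> B) : unighost c d.+1 =
    \sum_(1 <= i < d.+1 | (i %| d.+1)%N) c i ^+ (d.+1 %/ i) *+ i + c d.+1 *+ d.+1.
  rewrite /unighost big_mkcond big_nat_recr//= dvdnn divnn expr1.
  by rewrite -big_mkcond.
have := ab d.+1 isT; rewrite !E.
have -> : \sum_(1 <= i < d.+1 | (i %| d.+1)%N) a i ^+ (d.+1 %/ i) *+ i =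
          \sum_(1 <= i < d.+1 | (i %| d.+1)%N) b i ^+ (d.+1 %/ i) *+ i.
  rewrite big_nat_cond [RHS]big_nat_cond; apply: eq_bigr => i /andP[/andP[i0 id] _].
  by rewrite IH.
move=> /addrI/eqP; rewrite -subr_eq0 -mulrnBl => /eqP /natf_cancel ab0.
by apply/eqP; rewrite -subr_eq0 ab0.
Qed.

Lemma ghost_inj n (B : algebra R) (a b : witt n B) : ghost a =1 ghost b -> a = b.
Proof.
move=> ab; apply/funext => I; rewrite -(ray_wgcd I).
apply: (@unighost_inj B (a \o ray I) (b \o ray I)) (wgcd_gt0 I) => m m0.
have := ab (ray I m); rewrite !ghostE wgcd_ray//.
have E (c : witt n B) : unighost (c \o ray (ray I m)) m = unighost (c \o ray I) m.
  rewrite /unighost big_nat_cond [RHS]big_nat_cond; apply: eq_bigr => d.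
  by move=> /andP[/andP[d0 _] _] /=; rewrite ray_ray.
by rewrite !E.
Qed.
End RationalAlgebra.

Lemma square_zero_nil (B : comPzRingType) (x : B) : x ^+ 2 = 0 -> is_nil x.
Proof. by move=> x2; exists 2%N. Qed.

Lemma prod_square_zero (B : comPzRingType) (s : seq B) : s != [::] ->
  square_zero s -> (\prod_(x <- s) x) ^+ 2 = 0.
Proof.
case: s => // x s _ s2; rewrite big_cons exprMn s2 ?mul0r//; exact: mem_head.
Qed.

Lemma map_difference_zip n (B C : Type) (h : B -> C) (cs : seq 'I_n) (xs : seq B) :
  map_difference h (zip cs xs) = zip cs [seq h x | x <- xs].
Proof. by elim: cs xs => [|k cs IH] [|x xs] //=; rewrite IH. Qed.

Lemma mem_zip2 (S T : eqType) (s : seq S) (t : seq T) p :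
  p \in zip s t -> p.2 \in t.
Proof.
elim: s t => [|x s IH] [|y t] //=; rewrite !inE => /predU1P[->|/IH ->]; first by rewrite eqxx.
by rewrite orbT.
Qed.

(** * Iterated differences of a curve *)

Section Differences.
Variables (R : comPzRingType) (n : nat) (G : formal_group R).
Variable c : pointed_mor (affine_space R n) (pointed_group G).

Lemma fd_curve_map (B C : algebra R) (h : alg_hom B C) (L : seq ('I_n * B)) :
  (forall p, p \in L -> is_nil p.2) ->
  fd (@curve_at R n G c C) (map_difference h L) (fun=> 0) =
  gmap G h (fd (@curve_at R n G c B) L (fun=> 0)).
Proof.
move=> Ln; rewrite -(@fd_map n B C h _ _ _ (@curve_at R n G c C))//.
- by congr fd; apply/funext => i /=; rewrite rmorph0.
- exact: raddfB.
- by move=> y yn; exact: curve_at_natural.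
- by move=> i; exact: is_nil0.
Qed.

(* The difference along x_1, ..., x_r vanishes as soon as some x_i does, hence  *)
(* lives over the subring of R[x_1, ..., x_r]/(x_i^2) generated by x_1 ... x_r. *)
Lemma difference_descent (cs : seq 'I_n) (F : nat) (r : R) (B : algebra R) (theta : B) :
  cs != [::] -> r * F%:R = 1 -> theta ^+ 2 = 0 ->
  exists z : G B, forall (C : algebra R) (h : alg_hom B C) (xs : seq C),
    size xs = size cs -> square_zero xs -> (\prod_(x <- xs) x) *+ F = h theta ->
    gmap G h z = fd (@curve_at R n G c C) (zip cs xs) (fun=> 0).
Proof.
move=> cs0 rF th2; have m0 : (0 < size cs)%N by rewrite lt0n size_eq0.
set m := size cs in m0 *.
have [T [X [coef [X2 tE coefE Tlift]]]] := truncated_polynomials R m 1.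
(* An element of T for which killing any one variable has the same effect as killing all of them
   involves only the monomials 1 and X_1 ... X_m; this is the equalizer used for the descent. *)
have kill (i : 'I_m) : exists u : alg_hom T T, forall k, u (X k) = if k == i then 0 else X k.
  by apply: Tlift => k; case: ifP => _; rewrite ?X2// expr0n.
have [u uE] := choice kill.
have [v vE] : exists v : alg_hom T T, forall k, v (X k) = 0.
  by apply: Tlift => k; rewrite expr0n.
pose Xs := [seq X i | i <- enum 'I_m].
have Xsz : size Xs = m by rewrite size_map size_enum_ord.
have Xs2 : square_zero Xs by move=> _ /mapP[i _ ->]; exact: X2.
have Xn p : p \in zip cs Xs -> is_nil p.2.
  by move=> /mem_zip2 /Xs2; exact: square_zero_nil.
have fd_zero (C : algebra R) (xs : seq C) : size xs = m -> 0 \in xs ->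
    fd (@curve_at R n G c C) (zip cs xs) (fun=> 0) = 0.
  move=> xsz /(nthP 0)[i im xi]; have icz : (i < size cs)%N by rewrite -/m -xsz.
  pose k0 : 'I_n := tnth (in_tuple cs) (Ordinal icz).
  apply: (@fd_null _ _ _ _ (nth k0 cs i)); rewrite -xi -nth_zip ?xsz//.
  by rewrite mem_nth// size_zip xsz minnn.
pose K (C : algebra R) (h : alg_hom B C) (d : alg_hom T C) :=
  (\prod_i d (X i)) *+ F = h theta.
have rth2 : (alg_map B r * theta) ^+ 2 = 0 by rewrite exprMn th2 mulr0.
have [B' [j [xs [jinj xsz xs2 xsE]]]] := split_product m0 rth2.
have lift (C : algebra R) (ys : seq C) : size ys = m -> square_zero ys ->
    exists d : alg_hom T C, [seq d x | x <- Xs] = ys /\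
      \prod_i d (X i) = \prod_(y <- ys) y.
  move=> ysz ys2; have [i|d dE] := Tlift C (fun i => ys`_i).
    by apply: ys2; rewrite mem_nth// ysz.
  have dys : [seq d x | x <- Xs] = ys.
    rewrite -map_comp -[RHS](map_nth_ord_enum 0 ysz); apply: eq_map => i /=.
    exact: dE.
  by exists d; split=> //; rewrite -dys /Xs 2!big_map big_enum.
have [d0 [d0xs d0prod]] := lift B' xs xsz xs2.
have [|i|t tu|z zE] := @formal_group_descent R G T 'I_m (fun=> T) u (fun=> v)
  (fd (@curve_at R n G c T) (zip cs Xs) (fun=> 0)) B K B' j d0 jinj.
- rewrite /K d0prod xsE -[LHS]mulr_natl -(rmorph_nat j) -rmorphM; congr (j _).
  by rewrite mulrA -(rmorph_nat (alg_map B)) -rmorphM mulrC [F%:R * _]mulrC rF rmorph1 mulr1.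
- have killed (w : alg_hom T T) k : w (X k) = 0 ->
      gmap G w (fd (@curve_at R n G c T) (zip cs Xs) (fun=> 0)) = 0.
    move=> wk; rewrite -fd_curve_map// map_difference_zip fd_zero//.
      by rewrite size_map Xsz.
    by rewrite -wk !map_f// mem_enum.
  by rewrite (killed _ i) ?uE ?eqxx// (killed _ (Ordinal m0)).
- pose e0 : {ffun 'I_m -> 'I_2} := [ffun=> ord0].
  pose e1 : {ffun 'I_m -> 'I_2} := [ffun=> ord_max].
  have e10 : e1 != e0 by apply/eqP => /ffunP/(_ (Ordinal m0)); rewrite !ffunE.
  have coef0 e : e != e0 -> e != e1 -> coef t e = 0.
    move=> ee0 ee1; have [i /eqP ei] : exists i, (e i : nat) == 0%N.
      apply/existsP; apply: contraT; rewrite negb_exists => /forallP E.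
      case/eqP: ee1; apply/ffunP => i; apply/val_inj; rewrite ffunE /=.
      by move: (E i) (ltn_ord (e i)); case: (e i : nat) => [|[]].
    pose a (e : {ffun 'I_m -> 'I_2}) := if e i == ord0 then coef t e else 0.
    pose b (e : {ffun 'I_m -> 'I_2}) := if e == e0 then coef t e else 0.
    have ab : \sum_(e : {ffun 'I_m -> 'I_2}) alg_map T (a e) * \prod_k X k ^+ e k =
              \sum_(e : {ffun 'I_m -> 'I_2}) alg_map T (b e) * \prod_k X k ^+ e k.
      transitivity (u i t).
        rewrite [in RHS](tE t) rmorph_sum; apply: eq_bigr => e' _.
        rewrite rmorphM alg_funE rmorph_prod /a; case: eqP => [ei'|/eqP ei'].
          congr (_ * _); apply: eq_bigr => k _; rewrite rmorphXn uE.
          by case: eqP => [->|//]; rewrite ei' !expr0.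
        rewrite rmorph0 mul0r (bigD1 i)//= rmorphXn uE eqxx.
        by rewrite expr0n (_ : (e' i == 0 :> nat) = false) ?mul0r ?mulr0//; exact: negPf ei'.
      rewrite tu [in LHS](tE t) rmorph_sum; apply: eq_bigr => e' _.
      rewrite rmorphM alg_funE rmorph_prod /b; case: eqP => [->|/eqP ee].
        by congr (_ * _); apply: eq_bigr => k _; rewrite rmorphXn ffunE !expr0.
      have [k ek] : exists k, (e' k : nat) != 0%N.
        apply/existsP; apply: contraT; rewrite negb_exists => /forallP E.
        case/eqP: ee; apply/ffunP => k; apply/val_inj; rewrite ffunE /=.
        by have := E k; rewrite negbK => /eqP.
      by rewrite rmorph0 mul0r (bigD1 k)//= rmorphXn vE expr0n (negPf ek) mul0r mulr0.
    have := coefE a e; rewrite ab coefE /a /b (negPf ee0).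
    by rewrite (_ : (e i == ord0)) // -val_eqE /= ei.
  (* As r is the inverse of F, the relation [K] forces the product of the variables to become r
     theta. *)
  exists (alg_map B (coef t e0) + alg_map B (coef t e1) * (alg_map B r * theta)).
  move=> C h d Kd; rewrite rmorphD !rmorphM !alg_funE [in RHS](tE t) rmorph_sum.
  rewrite (bigD1 e0)//= (bigD1 e1)//= [X in _ + (_ + X)]big1 => [|e /andP[ee0 ee1]]; last first.
    by rewrite coef0// rmorph0 mul0r rmorph0.
  rewrite addr0 !rmorphM !alg_funE !rmorph_prod; congr (_ + _ * _).
    by rewrite big1 ?mulr1// => i _; rewrite rmorphXn ffunE expr0.
  rewrite -Kd -mulr_natl mulrA -(rmorph_nat (alg_map C)) -rmorphM rF rmorph1 mul1r.
  by apply: eq_bigr => i _; rewrite rmorphXn ffunE expr1.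
exists z => C h ys ysz ys2 yE; have [d [dys dprod]] := lift C ys ysz ys2.
rewrite (zE C h d); last by rewrite /K dprod.
by rewrite -fd_curve_map// map_difference_zip dys.
Qed.
End Differences.

(** Finitely many elements each need their own injective extension; the extensions are composed, and
    what was achieved earlier persists because [P] is stable under morphisms. *)
Lemma extend_all (R : comPzRingType) (K : eqType)
    (P : K -> forall B : algebra R, B -> Prop) (cls : forall B : algebra R, B -> Prop) :
  (forall k (B C : algebra R) (h : alg_hom B C) x, P k B x -> P k C (h x)) ->
  (forall (B C : algebra R) (h : alg_hom B C) x, cls B x -> cls C (h x)) ->
  (forall k (B : algebra R) x, cls B x -> exists (B' : algebra R) (j : alg_hom B B'),
     injective j /\ P k B' (j x)) ->
  forall (B : algebra R) (s : seq (K * B)), (forall p, p \in s -> cls B p.2) ->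
  exists (B' : algebra R) (j : alg_hom B B'),
    injective j /\ forall p, p \in s -> P p.1 B' (j p.2).
Proof.
move=> Pmap cmap Pex B; elim=> [_|p s IH sc]; first by exists B, (alg_id B).
have [|B1 [j1 [j1inj j1P]]] := IH.
  by move=> q qs; apply: sc; rewrite inE qs orbT.
have [|B2 [j2 [j2inj j2P]]] := Pex p.1 B1 (j1 p.2).
  by apply: cmap; apply: sc; exact: mem_head.
exists B2, (alg_comp j2 j1); split; first exact: alg_comp_inj.
by move=> q; rewrite inE => /predU1P[->//|/j1P]; exact: Pmap.
Qed.

(** * Ghost components of points *)

Section Ghost.
Variables (R : comPzRingType) (n : nat).
Local Notation W := (witt_formal_group R n).

Definition point_ghost (B : algebra R) (I : windex n) (u : W B) : B :=
  ghost (witt_coord u) I.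

Lemma point_ghostD (B : algebra R) I (u v : W B) :
  point_ghost I (u + v) = point_ghost I u + point_ghost I v.
Proof. by rewrite /point_ghost witt_coordD ghostD. Qed.

Lemma point_ghostB (B : algebra R) I : {morph @point_ghost B I : u v / u - v}.
Proof. by move=> u v; apply/eqP; rewrite eq_sym subr_eq -point_ghostD subrK. Qed.

Lemma point_ghost0 (B : algebra R) I : point_ghost I (0 : W B) = 0.
Proof. by rewrite -[X in point_ghost I X](subrr (0 : W B)) point_ghostB subrr. Qed.

Lemma point_ghost_sum (B : algebra R) I (T : Type) (s : seq T) (F : T -> W B) :
  point_ghost I (\sum_(x <- s) F x) = \sum_(x <- s) point_ghost I (F x).
Proof.
by elim/big_rec2: _ => [|x y z _ <-]; rewrite ?point_ghost0 ?point_ghostD.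
Qed.

Lemma point_ghost_map (B C : algebra R) (h : alg_hom B C) I (u : W B) :
  point_ghost I (gmap W h u) = h (point_ghost I u).
Proof.
rewrite /point_ghost [witt_coord _]witt_coord_map !ghostE /unighost rmorph_sum.
by apply: eq_bigr => d _; rewrite rmorphMn rmorphXn.
Qed.

Lemma point_ghost_nil (B : algebra R) I (u : W B) : is_nil (point_ghost I u).
Proof.
rewrite /point_ghost ghostE /unighost big_nat_cond; apply: is_nil_sum => d.
move=> /andP[/andP[d0 dI] dvd]; rewrite -mulr_natr; apply: is_nilM.
have : (0 < wgcd I %/ d)%N by rewrite divn_gt0// -ltnS.
case: (_ %/ _)%N => // k _; apply: is_nil_expS.
exact: cofinitely_null_is_nil (coord_cofinitely_null u).
Qed.

(** The component of index I is built from powers a_J^k with k J = I. The nonzero ones are among the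
    finitely many monomials with nonzero value, and I is recovered from J and the degree k. *)
Lemma point_ghost_support (B : algebra R) (u : W B) :
  exists F : seq (windex n), forall I, I \notin F -> point_ghost I u = 0.
Proof.
have ufin : cofinitely_null (witt_coord u) := coord_cofinitely_null u.
pose S := fset_set [set m : monomial (windex n) | mon_eval (witt_coord u) m != 0]%classic.
exists (flatten [seq [seq ray J (wgcd J * size (EnumMset.f m)) |
  J <- (EnumMset.f m : seq (windex n))] | m <- S]) => I IF.
rewrite /point_ghost ghostE /unighost big_nat_cond big1// => d.
move=> /andP[/andP[d0 dI] dvd]; set J := ray I d; set k := (wgcd I %/ d)%N.
have k0 : (0 < k)%N by rewrite divn_gt0// -ltnS.
suff -> : (witt_coord u \o ray I) d ^+ k = 0 by rewrite mul0rn.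
apply/eqP; apply: contraNT IF => uk; apply/flatten_mapP.
exists (msetn k J : monomial (windex n)).
  by rewrite in_fset_set//; apply/mem_set; rewrite /= mon_eval_msetn.
rewrite enum_msetn; apply/mapP; exists J; first by rewrite mem_nseq k0 eqxx.
by rewrite size_nseq wgcd_ray// mulnC divnK// ray_ray ?wgcd_gt0// ray_wgcd.
Qed.

Lemma fd_Omega_map (B C : algebra R) (h : alg_hom B C) (L : seq ('I_n * B)) :
  (forall p, p \in L -> is_nil p.2) ->
  fd (@Omega R n C) (map_difference h L) (fun=> 0) =
  gmap W h (fd (@Omega R n B) L (fun=> 0)).
Proof.
move=> Ln; rewrite -(@fd_map n B C h _ _ _ (@Omega R n C))//.
- by congr fd; apply/funext => i /=; rewrite rmorph0.
- exact: raddfB.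
- by move=> y yn; rewrite Omega_natural.
- by move=> i; exact: is_nil0.
Qed.

(** Ghost components are additive and those of [Omega] are monomials, so [fd_monomial0] shows that
    such a difference is concentrated in a single ghost index. *)
Lemma point_ghost_fd (B : algebra R) (L : seq ('I_n * B)) (I : windex n) :
  square_zero (unzip2 L) ->
  point_ghost I (fd (@Omega R n B) L (fun=> 0)) =
  if [ffun i => color_count L i] == val I
  then (\prod_(p <- L) p.2) *+ mfact (val I) else 0.
Proof.
move=> L2; have L2' p : p \in L -> p.2 ^+ 2 = 0 by move=> pL; apply: L2; exact: map_f.
rewrite -fd_monomial0//.
rewrite -(@fd_map n B B idfun _ _ _ (fun y : 'I_n -> B => \prod_i y i ^+ val I i)).
- by rewrite (_ : map_difference _ L = L)// /map_difference -[RHS]map_id; apply: eq_map => -[].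
- exact: point_ghostB.
- by move=> y yn; rewrite /point_ghost witt_coord_Omega// ghost_omega.
- by move=> p /L2'; exact: square_zero_nil.
- by move=> i; exact: is_nil0.
Qed.
End Ghost.

Section Colors.
Variable n : nat.
Implicit Type e : 'I_n -> nat.

Definition color_le : rel 'I_n := fun i j => (i <= j)%N.

(** Sorting makes the list of directions depend only on the multiplicities e. *)
Definition colors e : seq 'I_n :=
  sort color_le (flatten [seq nseq (e i) i | i <- enum 'I_n]).

Lemma count_colors e i : count_mem i (colors e) = e i.
Proof.
rewrite /colors count_sort count_flatten -map_comp.
rewrite sumnE big_map big_enum/= (bigD1 i)//= count_nseq /= eqxx mul1n.
by rewrite big1 ?addn0// => j /negPf ji; rewrite count_nseq /= ji.
Qed.

Lemma color_le_total : total color_le.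
Proof. by move=> i j; exact: leq_total. Qed.

Lemma colors_sorted e : sorted color_le (colors e).
Proof. exact/sort_sorted/color_le_total. Qed.

Lemma sorted_colors (cs : seq 'I_n) e : sorted color_le cs ->
  (forall i, count_mem i cs = e i) -> cs = colors e.
Proof.
move=> css cse; apply: (sorted_eq (leT := color_le)) => //.
- by move=> i j k; exact: leq_trans.
- by move=> i j ij; apply/val_inj/anti_leq.
- exact: colors_sorted.
- by apply/allP => i _ /=; rewrite cse count_colors.
Qed.

Lemma colors_nonempty (I : windex n) : colors (val I) != [::].
Proof.
have [i Ii] := windex_pos I; apply: contraTneq Ii => cI.
by have := count_colors (val I) i; rewrite cI /= => <-.
Qed.

Lemma color_count_unzip (T : Type) (L : seq ('I_n * T)) i :
  color_count L i = count_mem i (unzip1 L).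
Proof. by rewrite /color_count count_map. Qed.
End Colors.

(** * The map on square-zero ghost components induced by a curve *)

Section RationalCurves.
Variables (R : comPzRingType) (n : nat).
Hypothesis hQ : forall k, exists r : R, r * k.+1%:R = 1.
Local Notation W := (witt_formal_group R n).

Definition colored (I : windex n) (B : algebra R) (L : seq ('I_n * B)) :=
  unzip1 L = colors (val I) /\ square_zero (unzip2 L).

(** For a colored list this is the only possibly nonzero ghost component, of index I, of the
    corresponding difference of [Omega] ([point_ghost_colored]). *)
Definition content (I : windex n) (B : algebra R) (L : seq ('I_n * B)) : B :=
  (\prod_(p <- L) p.2) *+ mfact (val I).

Lemma colored_map I (B C : algebra R) (h : alg_hom B C) L :
  colored I L -> colored I (map_difference h L).
Proof.
move=> [L1 L2]; split; first by rewrite -L1 /unzip1 -map_comp; exact: eq_map.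
have -> : unzip2 (map_difference h L) = [seq h x | x <- unzip2 L].
  by rewrite /unzip2 -!map_comp; exact: eq_map.
exact: square_zero_map.
Qed.

Lemma content_map I (B C : algebra R) (h : alg_hom B C) L :
  content I (map_difference h L) = h (content I L).
Proof. by rewrite /content big_map rmorphMn rmorph_prod. Qed.

Lemma content_square_zero I (B : algebra R) (L : seq ('I_n * B)) :
  colored I L -> content I L ^+ 2 = 0.
Proof.
move=> [L1 L2]; rewrite /content -mulr_natr exprMn -(big_map snd xpredT id).
rewrite prod_square_zero ?mul0r//; apply: contraNneq (colors_nonempty I).
by rewrite -L1 => /(congr1 size)/eqP; rewrite size_map size_eq0 => /eqP ->.
Qed.

Lemma colored_is_nil I (B : algebra R) (L : seq ('I_n * B)) p :
  colored I L -> p \in L -> is_nil p.2.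
Proof. by move=> [_ L2] pL; apply/square_zero_nil/L2/map_f. Qed.

Lemma split_content I (B : algebra R) (theta : B) : theta ^+ 2 = 0 ->
  exists (B' : algebra R) (j : alg_hom B B') (L : seq ('I_n * B')),
    [/\ injective j, colored I L & content I L = j theta].
Proof.
move=> th2; have [r rI] := mfact_inv hQ (val I).
have m0 : (0 < size (colors (val I)))%N by rewrite lt0n size_eq0 colors_nonempty.
have [|B' [j [xs [jinj xsz xs2 xsE]]]] := @split_product R B (alg_map B r * theta) _ m0.
  by rewrite exprMn th2 mulr0.
exists B', j, (zip (colors (val I)) xs); split=> //.
  by split; rewrite ?unzip1_zip ?unzip2_zip ?xsz.
rewrite /content -(big_map snd xpredT id) -/(unzip2 _) unzip2_zip ?xsz// xsE.
by rewrite -rmorphMn -mulrnAl -rmorphMn -mulr_natr rI rmorph1 mul1r.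
Qed.

Section Lambda.
Variables (G : formal_group R) (c : pointed_mor (affine_space R n) (pointed_group G)).
Variable I : windex n.

Lemma lambda_exists (B : algebra R) (theta : B) : theta ^+ 2 = 0 ->
  exists z : G B, forall (C : algebra R) (h : alg_hom B C) (L : seq ('I_n * C)),
    colored I L -> content I L = h theta ->
    gmap G h z = fd (@curve_at R n G c C) L (fun=> 0).
Proof.
move=> th2; have [r rI] := mfact_inv hQ (val I).
have [z zE] := difference_descent c (colors_nonempty I) rI th2.
exists z => C h L [L1 L2] LE; rewrite -(zip_unzip L) L1; apply: zE => //.
  by rewrite -L1 !size_map.
by rewrite big_map.
Qed.

(** The intended value of the morphism at the point whose only ghost component is theta, in index I:
    the difference of c along any colored list of content theta, descended to B. *)
Definition lambda (B : algebra R) (theta : B) : G B :=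
  match pselect (theta ^+ 2 = 0) with
  | left th2 => sval (cid (lambda_exists th2))
  | right _ => 0
  end.

Lemma lambdaE (B C : algebra R) (theta : B) (h : alg_hom B C) (L : seq ('I_n * C)) :
  theta ^+ 2 = 0 -> colored I L -> content I L = h theta ->
  gmap G h (lambda theta) = fd (@curve_at R n G c C) L (fun=> 0).
Proof.
move=> th2; rewrite /lambda; case: pselect => // {}th2.
exact: (svalP (cid (lambda_exists th2))).
Qed.

Lemma lambda_content (B : algebra R) (L : seq ('I_n * B)) : colored I L ->
  lambda (content I L) = fd (@curve_at R n G c B) L (fun=> 0).
Proof.
move=> LI; have := lambdaE (h := alg_id B) (content_square_zero LI) LI erefl.
by rewrite gmap_id.
Qed.

Lemma lambda_natural (B C : algebra R) (h : alg_hom B C) (theta : B) :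
  theta ^+ 2 = 0 -> lambda (h theta) = gmap G h (lambda theta).
Proof.
move=> th2; have hth2 : h theta ^+ 2 = 0 by rewrite -rmorphXn th2 rmorph0.
have [C' [j [L [jinj LI LE]]]] := split_content I hth2.
apply: (formal_group_inj jinj); rewrite (lambdaE hth2 LI LE) -gmap_comp.
by rewrite (lambdaE th2 LI).
Qed.

Lemma lambda0 (B : algebra R) : lambda (0 : B) = 0.
Proof.
pose L := [seq (i, 0 : B) | i <- colors (val I)].
have LI : colored I L.
  split; first by rewrite /unzip1 -map_comp map_id.
  by move=> _ /mapP[_ /mapP[i _ ->] ->]; rewrite expr0n.
have [i iI] : exists i, i \in colors (val I).
  by case: (colors (val I)) (colors_nonempty I) => // i s _; exists i; exact: mem_head.
have L0 : (i, 0 : B) \in L by exact: map_f.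
have cL : content I L = 0 by rewrite /content (big_rem _ L0)/= mul0r mul0rn.
by rewrite -cL lambda_content//; exact: fd_null L0.
Qed.

(** For square-zero x_i with sum w, the product of the 1 - x_i t is exp(-w t), so it depends on w
    only and [symmetric_extension] applies to [lambda]. *)
Lemma lambda_sum (B : algebra R) (w : B) : is_nil w ->
  exists z : G B, forall (C : algebra R) (h : alg_hom B C) (xs : seq C),
    square_zero xs -> \sum_(x <- xs) x = h w ->
    gmap G h z = \sum_(x <- xs) lambda x.
Proof.
move=> wn; have [rho rhoE] := choice (factf_inv hQ).
have rho0 : rho 0%N = 1 by rewrite -(rhoE 0%N) mulr1.
have rhoS k : rho k.+1 * k.+1%:R = rho k.
  transitivity (rho k * (rho k.+1 * k.+1`!%:R)); last by rewrite rhoE mulr1.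
  by rewrite factS natrM -[LHS]mulr1 -[X in _ * X](rhoE k); ring.
(* This is exp(-v t), with [rho k] standing for 1/k!. *)
pose f (C : algebra R) (v : C) : series nat C := fun k => alg_map C (rho k) * (- v) ^+ k.
have fE (C : algebra R) (xs : seq C) : square_zero xs ->
    \prod_(x <- xs) (1 - monom x 1%N) = f C (\sum_(x <- xs) x).
  elim: xs => [_|x xs IH xs2].
    rewrite !big_nil; apply/seriesP => -[|k]; rewrite series_1E /f oppr0.
      by rewrite rho0 rmorph1 expr0 mulr1.
    by rewrite expr0n mulr0.
  have x2 : (- x) ^+ 2 = 0 by rewrite sqrrN xs2//; exact: mem_head.
  rewrite !big_cons IH => [|y ys]; last by apply: xs2; rewrite inE ys orbT.
  apply/seriesP => k; rewrite mulrC mulrBr mulr1 series_addE series_oppE.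
  rewrite series_mul_monom /f opprD.
  case: k => [|k]; first by rewrite subr0 rho0 rmorph1 !expr0.
  rewrite subn1 /= [- x + _]addrC exprD_square_zero// mulrDr; congr (_ + _).
  by rewrite -mulr_natr -(rhoS k) rmorphM rmorph_nat; ring.
have [B' [j [xs [jinj xs2 xsE]]]] := split_sum hQ wn.
have smallE (C : algebra R) (x : C) : small (pred1 1%N) x <-> x ^+ 2 = 0.
  split=> [[M /andP[/eqP -> /eqP xM]]//|x2].
  by exists 1%N; rewrite /= x2 eqxx.
have fmap (C D : algebra R) (h : alg_hom C D) v : series_map h (f C v) = f D (h v).
  by apply/seriesP => k; rewrite /series_map /f rmorphM alg_funE rmorphXn rmorphN.
have [||||x /xs2 /smallE //||z zE] := @symmetric_extension R G lambda (pred1 1%N)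
  _ _ _ _ B (f B w) B' j xs jinj.
- by exists 1%N.
- by move=> M M' /eqP -> /eqP ->.
- by move=> C D h x /smallE x2; exact: lambda_natural.
- by move=> C; exact: lambda0.
- by rewrite fE// xsE fmap.
exists z => C h ys ys2 yE; apply: zE => [y /ys2 /smallE //|].
by rewrite fE// yE fmap.
Qed.
End Lambda.
End RationalCurves.

(** * Decomposition of points and extension of curves over a rational base *)

Section RationalRepresentability.
Variables (R : comPzRingType) (n : nat).
Hypothesis hQ : forall k, exists r : R, r * k.+1%:R = 1.
Local Notation W := (witt_formal_group R n).
Local Notation pieces B := (seq (windex n * seq ('I_n * B))).

Definition well_colored (B : algebra R) (Qs : pieces B) :=
  forall q, q \in Qs -> colored q.1 q.2.

Lemma point_ghost_colored (B : algebra R) (I J : windex n) (L : seq ('I_n * B)) :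
  colored I L -> point_ghost J (fd (@Omega R n B) L (fun=> 0)) =
  if I == J then content I L else 0.
Proof.
move=> [L1 L2]; rewrite point_ghost_fd// (_ : [ffun i => _] = val I); last first.
  by apply/ffunP => i; rewrite ffunE color_count_unzip L1 count_colors.
by rewrite val_eqE; case: eqP => // ->.
Qed.

Lemma point_ghost_pieces (B : algebra R) (J : windex n) (Qs : pieces B) :
  well_colored Qs ->
  point_ghost J (\sum_(q <- Qs) fd (@Omega R n B) q.2 (fun=> 0)) =
  \sum_(q <- Qs | q.1 == J) content q.1 q.2.
Proof.
move=> Qc; rewrite point_ghost_sum [RHS]big_mkcond big_seq [RHS]big_seq.
by apply: eq_bigr => q /Qc /point_ghost_colored.
Qed.

Lemma split_nil (I : windex n) (B : algebra R) (w : B) : is_nil w ->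
  exists (B' : algebra R) (j : alg_hom B B'), injective j /\
    exists Ls : seq (seq ('I_n * B')),
      (forall L, L \in Ls -> colored I L) /\ \sum_(L <- Ls) content I L = j w.
Proof.
move=> wn; have [B1 [j1 [xs [j1inj xs2 xsE]]]] := split_sum hQ wn.
pose P (k : unit) (C : algebra R) (x : C) := exists L, colored I L /\ content I L = x.
have [||||B2 [j2 [j2inj j2P]]] := @extend_all R unit P (fun C x => x ^+ 2 = 0) _ _ _ B1
  [seq (tt, x) | x <- xs].
- move=> k C D h x [L [LI <-]]; exists (map_difference h L).
  by split; [exact: colored_map|exact: content_map].
- by move=> C D h x x2; rewrite -rmorphXn x2 rmorph0.
- move=> k C x x2; have [C' [j [L [jinj LI LE]]]] := split_content hQ I x2.
  by exists C', j; split=> //; exists L.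
- by move=> _ /mapP[x /xs2 x2 ->].
exists B2, (alg_comp j2 j1); split; first exact: alg_comp_inj.
have {}j2P x : x \in xs -> P tt B2 (j2 x).
  by move=> xxs; apply: (j2P (tt, x)); exact: map_f.
rewrite /= -xsE rmorph_sum; elim: xs j2P {xs2 xsE} => [_|x xs IH xP].
  by exists [::]; rewrite !big_nil.
have [|Ls [Lc LE]] := IH; first by move=> y ys; apply: xP; rewrite inE ys orbT.
have [L [LI LxE]] := xP x (mem_head _ _); exists (L :: Ls); split.
  by move=> L'; rewrite inE => /predU1P[->//|/Lc].
by rewrite !big_cons LxE LE.
Qed.

(** A point is determined by its ghost components, of which finitely many are nonzero, all
    nilpotent. Each is written as a sum of contents, and the matching differences of [Omega] have no
    other ghost component. *)
Lemma witt_decomposition (B : algebra R) (u : W B) :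
  exists (B' : algebra R) (j : alg_hom B B') (Qs : pieces B'),
    [/\ injective j, well_colored Qs
      & gmap W j u = \sum_(q <- Qs) fd (@Omega R n B') q.2 (fun=> 0)].
Proof.
have [F FE] := point_ghost_support u.
pose P (I : windex n) (C : algebra R) (x : C) := exists Ls : seq (seq ('I_n * C)),
  (forall L, L \in Ls -> colored I L) /\ \sum_(L <- Ls) content I L = x.
have [||||B' [j [jinj jP]]] := @extend_all R (windex n) P (fun C x => is_nil x) _ _ _ B
  [seq (J, point_ghost J u) | J <- undup F].
- move=> I C D h x [Ls [Lc <-]]; exists [seq map_difference h L | L <- Ls]; split.
    by move=> _ /mapP[L /Lc LI ->]; exact: colored_map.
  by rewrite big_map rmorph_sum; apply: eq_bigr => L _; rewrite content_map.
- by move=> C D h x; exact: is_nil_map.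
- exact: split_nil.
- by move=> _ /mapP[I _ ->]; exact: point_ghost_nil.
have {}jP I : I \in undup F -> P I B' (j (point_ghost I u)).
  by move=> IF; apply: (jP (I, point_ghost I u)); exact: map_f.
have [Qs [Qc QE]] : exists Qs : pieces B', well_colored Qs /\ forall J,
    \sum_(q <- Qs | q.1 == J) content q.1 q.2 =
    if J \in undup F then j (point_ghost J u) else 0.
  elim: (undup F) (undup_uniq F) jP => [_ _|I s IH /= /andP[Is us] sP].
    by exists [::]; split=> // J; rewrite big_nil.
  have [||Qs [Qc QE]] := IH => //; first by move=> J Js; apply: sP; rewrite inE Js orbT.
  have [Ls [Lc LE]] := sP I (mem_head _ _).
  exists ([seq (I, L) | L <- Ls] ++ Qs); split=> [q|J].
    by rewrite mem_cat => /orP[/mapP[L /Lc LI ->]//|/Qc].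
  rewrite big_cat big_map QE inE /= eq_sym.
  have [->|_] := eqVneq J I; first by rewrite LE (negPf Is) addr0.
  by rewrite big_pred0_eq add0r.
exists B', j, Qs; split=> //; apply/witt_coord_inj/(ghost_inj hQ) => J.
rewrite -/(point_ghost J _) -[RHS]/(point_ghost J _) point_ghost_pieces//.
rewrite point_ghost_map QE mem_undup; case: ifP => // /negbT /FE ->.
by rewrite rmorph0.
Qed.

Lemma fd_Omega_span (B : algebra R) (L : seq ('I_n * B)) x :
  (forall p, p \in L -> is_nil p.2) -> (forall i, is_nil (x i)) ->
  omega_span (fd (@Omega R n B) L x).
Proof.
elim: L x => [|p L IH] x Ln xn; first exact: span_Omega.
have Ln' q : q \in L -> is_nil q.2 by move=> qL; apply: Ln; rewrite inE qL orbT.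
apply: span_sub; apply: IH => // i; apply: is_nilD => //.
by case: ifP => _; [apply: Ln; exact: mem_head|exact: is_nil0].
Qed.

Lemma witt_span_rational (B : algebra R) (u : W B) :
  exists (B' : algebra R) (j : alg_hom B B'),
    injective j /\ omega_span (gmap W j u).
Proof.
have [B' [j [Qs [jinj Qc uE]]]] := witt_decomposition u.
exists B', j; split=> //; rewrite uE; apply: omega_span_sum => q /Qc qc.
apply: fd_Omega_span => [p|i]; [exact: colored_is_nil qc|exact: is_nil0].
Qed.

(** A nonempty sublist of a sorted list is sorted, so its directions are the canonical list of its
    own vector of multiplicities, which is nonzero. *)
Lemma sublists_colored (B : algebra R) (L L' : seq ('I_n * B)) :
  sorted (relpre fst (@color_le n)) L -> square_zero (unzip2 L) ->
  L' \in sublists L -> exists I, colored I L'.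
Proof.
move=> Ls L2 /sublistsP[L'0 sub].
pose e : {ffun 'I_n -> nat} := [ffun i => color_count L' i].
have e0 : e != 0.
  case: L' L'0 {sub} @e => // p L' _; apply/eqP => /ffunP/(_ p.1).
  by rewrite !ffunE /color_count /= eqxx.
exists (exist _ e e0); split.
  apply: sorted_colors => [|i]; last by rewrite /= ffunE color_count_unzip.
  rewrite sorted_map; apply: subseq_sorted sub Ls.
  by move=> p q r; exact: leq_trans.
by move=> x xL; apply: L2; apply: (mem_subseq (map_subseq _ sub)).
Qed.

Lemma color_pieces (B : algebra R) (Ls : seq (seq ('I_n * B))) :
  (forall L, L \in Ls -> exists I, colored I L) ->
  exists Qs : pieces B, well_colored Qs /\ [seq q.2 | q <- Qs] = Ls.
Proof.
elim: Ls => [_|L Ls IH Lc]; first by exists [::].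
have [|Qs [Qc QE]] := IH; first by move=> M MLs; apply: Lc; rewrite inE MLs orbT.
have [I LI] := Lc L (mem_head _ _); exists ((I, L) :: Qs).
by split=> [q|] /=; [rewrite inE => /predU1P[->//|/Qc]|rewrite QE].
Qed.

(** Writing each coordinate as a sum of square-zero elements reaches b from the origin by
    square-zero shifts; sorting them by direction prepares for [sublists_colored]. *)
Lemma nil_decomposition (B : algebra R) (b : 'I_n -> B) : (forall i, is_nil (b i)) ->
  exists (B' : algebra R) (j : alg_hom B B') (L : seq ('I_n * B')),
    [/\ injective j, sorted (relpre fst (@color_le n)) L, square_zero (unzip2 L)
      & j \o b = foldl (@shift n B') (fun=> 0) L].
Proof.
move=> bn; pose P (k : 'I_n) (C : algebra R) (x : C) :=
  exists xs, square_zero xs /\ \sum_(y <- xs) y = x.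
have [||||B' [j [jinj jP]]] := @extend_all R 'I_n P (fun C x => is_nil x) _ _ _ B
  [seq (k, b k) | k <- enum 'I_n].
- move=> k C D h x [xs [xs2 <-]]; exists [seq h y | y <- xs]; split.
    exact: square_zero_map.
  by rewrite big_map rmorph_sum.
- by move=> C D h x; exact: is_nil_map.
- move=> k C x xn; have [C' [j [xs [jinj xs2 xsE]]]] := split_sum hQ xn.
  by exists C', j; split=> //; exists xs.
- by move=> _ /mapP[k _ ->]; exact: bn.
have /choice[xs xsP] k : P k B' (j (b k)).
  by apply: (jP (k, b k)); apply: map_f; rewrite mem_enum.
pose L0 := [seq (k, x) | k <- enum 'I_n, x <- xs k].
pose r := relpre fst (@color_le n) : rel ('I_n * B').
exists B', j, (sort r L0); split=> //.
- by apply: sort_sorted => p q; exact: leq_total.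
- move=> _ /mapP[p + ->]; rewrite mem_sort => /allpairsPdep[k [x [_ xk ->]]].
  by have [xs2 _] := xsP k; exact: xs2.
apply/funext => i; rewrite foldl_shift add0r (perm_big L0)/=; last first.
  by rewrite perm_sort.
rewrite big_mkcond big_allpairs_dep big_enum/= (bigD1 i)//= eqxx.
rewrite [X in _ = _ + X]big1 ?addr0; first by have [_ ->] := xsP i.
by move=> k /negPf ki; rewrite ki big1.
Qed.

(** By [fd_expansion] the values of [Omega] and of c are the same sums of colored differences. In a
    decomposition of u, the pieces of index I have contents adding up to the ghost component of u,
    so their contribution descends by [lambda_sum]. *)
Lemma curve_extension_rational (G : formal_group R)
    (c : pointed_mor (affine_space R n) (pointed_group G)) :
  exists phi : fg_hom W G, forall (B : algebra R) (b : 'I_n -> B),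
    (forall i, is_nil (b i)) -> phi B (Omega b) = curve_at c b.
Proof.
pose Dec (B : algebra R) (u : W B) (z : G B) := exists Qs : pieces B,
  [/\ well_colored Qs, u = \sum_(q <- Qs) fd (@Omega R n B) q.2 (fun=> 0)
    & z = \sum_(q <- Qs) fd (@curve_at R n G c B) q.2 (fun=> 0)].
apply: (@curve_extension R n G c Dec).
- move=> B C h u z [Qs [Qc -> ->]].
  exists [seq (q.1, map_difference h q.2) | q <- Qs]; split.
  + by move=> _ /mapP[q /Qc qc ->]; exact: colored_map.
  + rewrite raddf_sum big_map big_seq [RHS]big_seq; apply: eq_bigr => q /Qc qc.
    by rewrite fd_Omega_map// => p; exact: colored_is_nil qc.
  + rewrite raddf_sum big_map big_seq [RHS]big_seq; apply: eq_bigr => q /Qc qc.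
    by rewrite fd_curve_map// => p; exact: colored_is_nil qc.
- move=> B u v y z [Qs [Qc -> ->]] [Ps [Pc -> ->]]; exists (Qs ++ Ps).
  split; rewrite ?big_cat// => q; rewrite mem_cat => /orP[]; [exact: Qc|exact: Pc].
- move=> B b bn; have [B' [j [L [jinj Ls L2 LE]]]] := nil_decomposition bn.
  exists B', j; split=> //.
  have [|Qs [Qc QE]] := @color_pieces B' (sublists L).
    by move=> L'; exact: sublists_colored.
  exists Qs; split=> //; rewrite -(big_map snd xpredT (fun L => fd _ L _)) QE.
    by rewrite Omega_natural// LE fd_expansion Omega0 add0r.
  by rewrite -curve_at_natural// LE fd_expansion curve_at0 add0r.
- move=> B u; have [B' [j [Qs [jinj Qc uE]]]] := witt_decomposition u.
  by exists B', j, (\sum_(q <- Qs) fd (@curve_at R n G c B') q.2 (fun=> 0)); split=> //; exists Qs.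
move=> B u; have [F FE] := point_ghost_support u.
have [z zE] := choice (fun I => lambda_sum hQ c I (point_ghost_nil I u)).
(* The empty list decomposes a zero ghost component, so the descended value is an empty sum. *)
have z0 I : I \notin F -> z I = 0.
  move=> /FE gI; have := zE I B (alg_id B) [::]; rewrite gmap_id !big_nil gI.
  by apply.
exists (\sum_(J <- undup F) z J) => C h _ [Qs [Qc uE ->]].
(* The pieces may use indices outside [F], whose contents then cancel in total; enlarging the index
   set adds only zero terms. *)
pose F' := undup (F ++ [seq q.1 | q <- Qs]).
have -> : \sum_(J <- undup F) z J = \sum_(J <- F') z J.
  rewrite [RHS](bigID (mem F))/= [X in _ = _ + X]big1 ?addr0 => [|I /z0//].
  rewrite -[RHS]big_filter; apply: perm_big; apply: uniq_perm.
  - exact: undup_uniq.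
  - exact/filter_uniq/undup_uniq.
  by move=> I; rewrite mem_filter !mem_undup mem_cat /=; case: (I \in F).
have hz I : gmap G h (z I) = \sum_(q <- Qs | q.1 == I) lambda hQ c q.1 (content q.1 q.2).
  rewrite (zE I C h [seq content I q.2 | q <- Qs & q.1 == I]); first last.
  - rewrite big_map big_filter -point_ghost_map uE point_ghost_pieces//.
    by apply: eq_bigr => q /eqP ->.
  - move=> _ /mapP[q + ->]; rewrite mem_filter => /andP[/eqP <- /Qc].
    exact: content_square_zero.
  by rewrite big_map big_filter; apply: eq_bigr => q /eqP ->.
rewrite raddf_sum; under eq_bigr do rewrite hz big_mkcond.
rewrite exchange_big big_seq [RHS]big_seq; apply: eq_bigr => q qQ /=.
rewrite (bigD1_seq q.1) ?undup_uniq//=; last first.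
  by rewrite mem_undup mem_cat map_f ?orbT.
rewrite eqxx big1 ?addr0 => [|I /negPf Iq]; last by rewrite eq_sym Iq.
by rewrite lambda_content//; exact: Qc.
Qed.
End RationalRepresentability.

Theorem theorem2p1 (R : comPzRingType) (n : nat) (n_gt0 : (0 < n)%N)
    (hR : inhabited {rmorphism rat -> R} \/ n = 1%N) :
  exists Phi : forall G : formal_group R,
      fg_hom (witt_formal_group R n) G ->
      pointed_mor (affine_space R n) (pointed_group G),
    [/\ forall G : formal_group R, bijective (Phi G),
        forall (G : formal_group R) (u v : fg_hom (witt_formal_group R n) G),
          Phi G (fg_add u v) = pmor_add (Phi G u) (Phi G v)
      & forall (G H : formal_group R) (f : fg_hom G H)
          (u : fg_hom (witt_formal_group R n) G),
          Phi H (fg_comp f u) = pmor_fg_comp f (Phi G u)].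
Proof.
have [[rho]|n1] := hR; last first.
  case: _ / (esym n1); apply: representable_criterion.
    exact: witt_span1.
  exact: curve_extension1.
have hQ k : exists r : R, r * k.+1%:R = 1.
  exists (rho (k.+1%:R^-1)); rewrite -(rmorph_nat rho) -rmorphM mulVf ?rmorph1//.
  by rewrite Num.Theory.pnatr_eq0.
apply: representable_criterion.
  exact: witt_span_rational.
exact: curve_extension_rational.
Qed.
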